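(* Let $A=\overline{B}(0,1)\subset\mathbb{R}^2$ and $f(x,a)=a$ for all $x\in\mathbb{R}^2$, $a\in A$. Let $\ell:\mathbb{R}^2\to\mathbb{R}$ (a running cost independent of the control) satisfy $|\ell(x)|\le M$ and $|\ell(x)-\ell(y)|\le m_\ell(|x-y|)$ for all $x,y\in\mathbb{R}^2$, for some $M>0$ and some modulus of continuity $m_\ell$. Let $\lambda>0$ and let $V^\varepsilon$, $\overline{V}$, $V_\Gamma$ be the value functions defined in the context. Then: (1) $\overline{V}=V_\Gamma$ on $\Gamma$. (2) As $\varepsilon\to0$, $V^\varepsilon$ converges locally uniformly on $\mathbb{R}^2$ to $\overline{V}\circ\phi_d$, where $\phi_d:x\in\mathbb{R}^2\mapsto\overline{x}\in\Gamma$, $\overline{x}:=\lim_{t\to\infty}Z^x(t)$, and $Z^x$ is the unique solution of $\dot Z^x=-\nabla d(Z^x)$, $Z^x(0)=x$.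
   Context: $\mathcal{A}=L^\infty((0,\infty);\overline{B}(0,1))$. $\Gamma=\{(x_1,x_2)\in\mathbb{R}^2:x_1x_2=0\}$ is the union of the two coordinate axes, and $d(x)=x_1^2x_2^2$. For $\varepsilon>0$, $x\in\mathbb{R}^2$, $\alpha\in\mathcal{A}$, $X^{x,\alpha,\varepsilon}$ is the unique solution of $\dot X=\alpha(t)-\frac1\varepsilon\nabla d(X)$, $X(0)=x$, and $k^{x,\alpha,\varepsilon}(t)=\frac1\varepsilon\int_0^t\nabla d(X^{x,\alpha,\varepsilon}(s))\,ds$. $\omega(x,\alpha)$ is the (nonempty) set of $X^{x,\alpha}\in H^1_{\rm loc}(0,\infty)$ such that, for some $k^{x,\alpha}\in H^1_{\rm loc}(0,\infty)$, $(X^{x,\alpha},k^{x,\alpha})$ is a subsequential limit as $\varepsilon\to0$ (locally uniformly on $(0,\infty)$) of $(X^{x,\alpha,\varepsilon},k^{x,\alpha,\varepsilon})$. Value functions: $$V^\varepsilon(x)=\inf_{\alpha\in\mathcal{A}}\int_0^\infty e^{-\lambda t}\ell(X^{x,\alpha,\varepsilon}(t))\,dt,\qquad \overline{V}(x)=\inf_{\alpha\in\mathcal{A},\,X^{x,\alpha}\in\omega(x,\alpha)}\int_0^\infty e^{-\lambda t}\ell(X^{x,\alpha}(t))\,dt\quad(x\in\mathbb{R}^2),$$ and, for $x\in\Gamma$, $$V_\Gamma(x)=\inf_{\alpha\in\mathcal{A}_x}\int_0^\infty e^{-\lambda t}\ell(X(t))\,dt,$$ where $\mathcal{A}_x$ is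 the set of $\alpha\in\mathcal{A}$ such that the solution $X(t)=x+\int_0^t\alpha(s)\,ds$ of $\dot X=\alpha$, $X(0)=x$, satisfies $X(t)\in\Gamma$ for all $t\ge0$. A modulus of continuity is a nondecreasing function $m:[0,\infty)\to[0,\infty)$ with $m(r)\to m(0)=0$ as $r\to0^+$. *)

(* Defs.v *)
From HB Require Import structures.
From mathcomp Require Import all_boot all_order all_algebra.
From mathcomp Require Import all_classical all_reals all_analysis.
Set Implicit Arguments.
Unset Strict Implicit.
Unset Printing Implicit Defensive.
Import Order.TTheory GRing.Theory Num.Theory.
Import numFieldNormedType.Exports.
Local Open Scope classical_set_scope.
Local Open Scope ring_scope.

(* The library's norm on R * R is the sup norm (same topology); every norm of
   the mathematics is the Euclidean one. *)
Definition enorm (R : realType) (x : R * R) : R :=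
  Num.sqrt (x.1 ^+ 2 + x.2 ^+ 2).

Definition is_modulus (R : realType) (m : R -> R) : Prop :=
  [/\ (forall r s, 0 <= r -> r <= s -> m r <= m s),
      (forall r, 0 <= r -> 0 <= m r),
      m 0 = 0
    & m r @[r --> 0^'+] --> 0].

Definition halfline {R : realType} : set R := `]0, +oo[%classic.

Definition Gamma {R : realType} : set (R * R) := [set x | x.1 * x.2 = 0].

Definition dfun (R : realType) (x : R * R) : R := x.1 ^+ 2 * x.2 ^+ 2.

Definition grad (R : realType) (g : R * R -> R) (x : R * R) : R * R :=
  ('D_((1, 0) : R * R) g x, 'D_((0, 1) : R * R) g x).

Definition int0 (R : realType) (t : R) (g : R -> R * R) : R * R :=
  (\int[lebesgue_measure]_(s in `[0, t]) (g s).1,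
   \int[lebesgue_measure]_(s in `[0, t]) (g s).2).

(* Representatives of the classes in L^oo((0, oo); closed unit ball); the
   values of a representative outside (0, oo) are irrelevant. *)
Definition controls {R : realType} : set (R -> R * R) :=
  [set a | measurable_fun halfline a /\
    {ae (@lebesgue_measure R), forall t, halfline t -> enorm (a t) <= 1}].

(* X' = a - grad d (X) / eps, X 0 = x on [0, oo), in the sense of
   Caratheodory, i.e. in integrated form since a is merely measurable. *)
Definition is_traj (R : realType) (eps : R) (x : R * R) (a X : R -> R * R)
    : Prop :=
  {within `[0, +oo[, continuous X} /\
  forall t, 0 <= t ->
    X t = x + int0 t (fun s => a s - eps^-1 *: grad (@dfun R) (X s)).

(* The solution is unique on [0, oo), the only place where its values are
   used. *)
Definition traj (R : realType) (eps : R) (x : R * R) (a : R -> R * R)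
    : R -> R * R :=
  xget (fun=> 0) [set X | is_traj eps x a X].

Definition ktraj (R : realType) (eps : R) (x : R * R) (a : R -> R * R)
    : R -> R * R :=
  fun t => eps^-1 *: int0 t (fun s => grad (@dfun R) (traj eps x a s)).

Definition cvg_locally_uniformly (T U : uniformType) (D : set T)
    (F : set_system (T -> U)) (g : T -> U) : Prop :=
  forall K, compact K -> K `<=` D -> {uniform K, F --> g}.

Definition L2loc (R : realType) (u : R -> R) : Prop :=
  measurable_fun halfline u /\
  forall K, compact K -> K `<=` halfline ->
    (\int[lebesgue_measure]_(t in K) ((u t) ^+ 2)%:E < +oo)%E.

Definition test_fun (R : realType) (p : R -> R) : Prop :=
  [/\ (forall t, derivable p t 1), continuous (derive1 p),
      compact (closure [set t | p t != 0])
    & closure [set t | p t != 0] `<=` halfline].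

(* H^1_loc(0, oo), with weak derivatives tested against C^1_c(0, oo). *)
Definition H1loc (R : realType) (u : R -> R) : Prop :=
  L2loc u /\
  exists2 v, L2loc v & forall p, test_fun p ->
    \int[lebesgue_measure]_(t in halfline) (u t * derive1 p t) =
    - \int[lebesgue_measure]_(t in halfline) (v t * p t).

Definition H1loc2 (R : realType) (X : R -> R * R) : Prop :=
  H1loc (fun t => (X t).1) /\ H1loc (fun t => (X t).2).

(* Members matter only through their restrictions to (0, oo); in general
   X(0+) differs from x. *)
Definition omega (R : realType) (x : R * R) (a : R -> R * R)
    : set (R -> R * R) :=
  [set X | H1loc2 X /\
    exists2 k, H1loc2 k &
    exists e : nat -> R,
      [/\ (forall n, 0 < e n), e n @[n --> \oo] --> 0,
          cvg_locally_uniformly halfline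
            ((fun n => traj (e n) x a) @ \oo) X
        & cvg_locally_uniformly halfline
            ((fun n => ktraj (e n) x a) @ \oo) k]].

Definition cost (R : realType) (lambda : R) (l : R * R -> R) (X : R -> R * R)
    : R :=
  \int[lebesgue_measure]_(t in halfline) (expR (- (lambda * t)) * l (X t)).

Definition Veps (R : realType) (lambda : R) (l : R * R -> R) (eps : R)
    (x : R * R) : R :=
  inf [set cost lambda l (traj eps x a) | a in controls].

Definition Vbar (R : realType) (lambda : R) (l : R * R -> R) (x : R * R) : R :=
  inf [set c | exists a X,
    [/\ controls a, omega x a X & c = cost lambda l X]].

Definition free_traj (R : realType) (x : R * R) (a : R -> R * R)
    : R -> R * R :=
  fun t => x + int0 t a.

Definition controls_at (R : realType) (x : R * R) : set (R -> R * R) :=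
  [set a | controls a /\ forall t, 0 <= t -> Gamma (free_traj x a t)].

Definition VGamma (R : realType) (lambda : R) (l : R * R -> R) (x : R * R)
    : R :=
  inf [set cost lambda l (free_traj x a) | a in controls_at x].

(* Z' = - grad d (Z), Z 0 = x, on [0, oo). *)
Definition is_gradflow (R : realType) (x : R * R) (Z : R -> R * R) : Prop :=
  [/\ Z 0 = x, {within `[0, +oo[, continuous Z}
    & forall t : R, 0 < t -> is_derive t (1 : R) Z (- grad (@dfun R) (Z t))].

Definition gradflow (R : realType) (x : R * R) : R -> R * R :=
  xget (fun=> 0) [set Z | is_gradflow x Z].

(* The limit at infinity; the library's lim has no instance on R * R. *)
Definition phi_d (R : realType) (x : R * R) : R * R :=
  xget 0 [set z : R * R | gradflow x t @[t --> +oo] --> z].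

(* Main.v *)
Require Import Defs.
From mathcomp Require Import all_boot all_order all_algebra.
From mathcomp Require Import all_classical all_reals all_analysis.
From mathcomp Require Import measurable_realfun ring lra.
Import Order.TTheory GRing.Theory Num.Theory.
Import numFieldNormedType.Exports.
Local Open Scope classical_set_scope.
Local Open Scope ring_scope.

(* The penalisation does not move the hyperbolic coordinate u = x^2 - y^2, since
   (x, -y) is orthogonal to grad d (x, y) = 2 x y (y, x); but it drives x y to 0:
   after a short initial layer |x y| <= sigma^2, with sigma -> 0 as eps -> 0. Hence
   phi_d (x, y) = (sgn x sqrt(u^+), sgn y sqrt(u^-)), and a function of u close to
   phi_d turns a penalised trajectory into a nearby admissible trajectory on the
   axes (its shadow): |u'| <= 2 |(x, y)|, and |(x, y)|^2 is close to |u|. So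
   V^eps >= V_Gamma o phi_d - o(1). Conversely, within a short time one can let the
   penalisation act, steer exactly onto the axes, and move along them to phi_d;
   there V^eps <= V_Gamma, because grad d = 0 on the axes and so a control which
   keeps the free trajectory on them yields the same penalised trajectory. The last
   remark gives Vbar <= V_Gamma on the axes; the converse inequality follows from
   the lower bound on V^eps by dominated convergence. *)

Set Implicit Arguments.
Unset Strict Implicit.
Unset Printing Implicit Defensive.

(** * Primitives of locally bounded functions *)

Section LocallyBounded.
Context {R : realType}.
Implicit Types (f g : R -> R) (r s t T C : R).
Notation mu := (@lebesgue_measure R).

(** Controls are merely measurable, so trajectories need not be differentiable. All differential
    inequalities are therefore stated for pairs [prim F f], primitives of locally bounded functions;
    their chain rule is proved by comparing slopes, without almost everywhere differentiation.
    [phi_d] itself cannot be the shadow: off the axes the speed of [sqrt u] is of order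
    [|(x, y)| / sqrt u], unbounded as [u] tends to 0, which is where the projection switches axis.
    [hfun] flattens the root there, at the price of an error of order [sigma]. For the same reason
    [phi_d] is only 1/2-Hoelder in [u], whence the square roots in the error terms. The single
    parameter [sigma] sets all scales. Where [|x y| > sigma^2] the penalisation beats a unit control
    as soon as [eps <= sigma^3]; with [eps <= sigma^7] the initial layer has length of order
    [sigma], uniformly on bounded sets. Every estimate holds at fixed [eps]: no limit trajectory is
    built, and the elements of [omega] enter only through their costs. *)

Definition locbd f := measurable_fun setT f /\
  forall T, exists C, forall s, `|s| <= T -> `|f s| <= C.

Lemma locbd_bound f T : locbd f ->
  exists2 C, 0 < C & forall s, `|s| <= T -> `|f s| <= C.
Proof.
move=> [_ /(_ T)[C fC]]; exists (Num.max C 1); first by rewrite lt_max ltr01 orbT.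
by move=> s /fC fs; rewrite le_max fs.
Qed.

Lemma locbd_continuous f : continuous f -> locbd f.
Proof.
move=> cf; split; first exact: continuous_measurable_fun.
move=> T.
have [T0|T0] := ltP T 0.
  by exists 0 => s sT; have := normr_ge0 s; lra.
have TT : - T <= T by lra.
have cw : {within `[- T, T], continuous f} by apply: continuous_subspaceT.
have [c1 _ h1] := EVT_max TT cw.
have [c2 _ h2] := EVT_min TT cw.
exists (`|f c1| + `|f c2|) => s; rewrite ler_norml => sT.
have sI : s \in `[- T, T] by rewrite in_itv.
have := h1 _ sI; have := h2 _ sI.
have := ler_norm (f c1); have := ler_norm (- f c2); rewrite normrN.
have := normr_ge0 (f c1); have := normr_ge0 (f c2).
by rewrite ler_norml => *; apply/andP; split; lra.
Qed.

Lemma locbd_cst C : locbd (fun=> C).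
Proof. by apply: locbd_continuous => t; exact: cvg_cst. Qed.

Lemma locbd_add f g : locbd f -> locbd g -> locbd (fun s => f s + g s).
Proof.
move=> [mf bf] [mg bg]; split; first exact: measurable_funD.
move=> T; have [C fC] := bf T; have [D gD] := bg T.
by exists (C + D) => s sT; apply: le_trans (ler_normD _ _) _; apply: lerD; auto.
Qed.

Lemma locbd_mul f g : locbd f -> locbd g -> locbd (fun s => f s * g s).
Proof.
move=> [mf bf] [mg bg]; split; first exact: measurable_funM.
move=> T; have [C fC] := bf T; have [D gD] := bg T.
by exists (C * D) => s sT; rewrite normrM; apply: ler_pM; auto.
Qed.

Lemma locbd_opp f : locbd f -> locbd (fun s => - f s).
Proof.
move=> [mf bf]; split; first exact: measurableT_comp.
by move=> T; have [C fC] := bf T; exists C => s sT; rewrite normrN; auto.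
Qed.

Lemma locbd_sub f g : locbd f -> locbd g -> locbd (fun s => f s - g s).
Proof. by move=> lf lg; apply: locbd_add lf (locbd_opp lg). Qed.

Lemma locbd_scale C f : locbd f -> locbd (fun s => C * f s).
Proof. by apply: locbd_mul; exact: locbd_cst. Qed.

Lemma locbd_integrable f (i : interval R) T : locbd f ->
  [set` i] `<=` `[- T, T] -> mu.-integrable [set` i] (EFin \o f).
Proof.
move=> [mf bf] iT.
have iTT : mu.-integrable `[- T, T] (EFin \o f).
  apply: measurable_bounded_integrable => //=.
  - rewrite lebesgue_measure_itv/=; case: ifP => // _.
    by rewrite -EFinD ltry.
  - exact: measurable_funS mf.
  - have [C fC] := bf T; exists C; split; first exact: num_real.
    move=> x Cx s /=; rewrite in_itv/= -ler_norml => /fC fs.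
    exact: le_trans fs (ltW Cx).
exact: integrableS iTT.
Qed.

Lemma locbd_integrable_cc f s t : locbd f -> mu.-integrable `[s, t] (EFin \o f).
Proof.
move=> lf; apply: (@locbd_integrable _ _ (Num.max `|s| `|t|)) => // x /=.
rewrite !in_itv/= => /andP[sx xt].
have := ler_norm (- s); have := ler_norm t; rewrite normrN => h1 h2.
have h3 : `|s| <= Num.max `|s| `|t| by rewrite le_max lexx.
have h4 : `|t| <= Num.max `|s| `|t| by rewrite le_max lexx orbT.
by apply/andP; split; lra.
Qed.

Lemma locbd_integrable_oc f s t : locbd f -> mu.-integrable `]s, t] (EFin \o f).
Proof.
move=> lf; apply: integrableS (locbd_integrable_cc s t lf) => //.
exact: subset_itv_oc_cc.
Qed.

Definition integ f t := \int[mu]_(s in `[0, t]) f s.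

Lemma near_dist r d : 0 < d -> \forall t \near r, `|t - r| < d.
Proof.
by move=> d0; apply/nbhs_ballP; exists d => //= t; rewrite /ball/= distrC.
Qed.

Lemma integ_le0 f t : t <= 0 -> integ f t = 0.
Proof.
rewrite /integ le_eqVlt => /orP[/eqP ->|t0]; first by rewrite set_itv1 Rintegral_set1.
by rewrite set_itv_ge ?Rintegral_set0// bnd_simp -ltNge.
Qed.

Lemma integ_max f t : integ f (Num.max t 0) = integ f t.
Proof. by case: (leP t 0) => // t0; rewrite !integ_le0. Qed.

Lemma integ_add f g t : locbd f -> locbd g -> integ (fun s => f s + g s) t = integ f t + integ g t.
Proof. by move=> lf lg; rewrite /integ RintegralD//; exact: locbd_integrable_cc. Qed.

Lemma integ_sub f g t : locbd f -> locbd g -> integ (fun s => f s - g s) t = integ f t - integ g t.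
Proof. by move=> lf lg; rewrite /integ RintegralB//; exact: locbd_integrable_cc. Qed.

Lemma integ_scale f C t : locbd f -> integ (fun s => C * f s) t = C * integ f t.
Proof. by move=> lf; rewrite /integ RintegralZl//; exact: locbd_integrable_cc. Qed.

Lemma eq_integ f g t : (forall s, 0 <= s -> s <= t -> f s = g s) -> integ f t = integ g t.
Proof.
move=> fg; apply: eq_Rintegral => s; rewrite inE/= in_itv/= => /andP[? ?].
exact: fg.
Qed.

Lemma integ_split f s t : locbd f -> 0 <= s -> s <= t ->
  integ f t - integ f s = \int[mu]_(u in `]s, t]) f u.
Proof.
move=> lf s0 st; rewrite /integ Rintegral_itvB//; first exact: locbd_integrable_cc.
Qed.

Lemma integ_le_cst f s t C : locbd f -> 0 <= s -> s <= t ->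
  (forall u, s < u -> u <= t -> f u <= C) -> integ f t - integ f s <= C * (t - s).
Proof.
move=> lf s0 st fC; rewrite integ_split//.
have -> : C * (t - s) = \int[mu]_(u in `]s, t]) C.
  rewrite Rintegral_cst//= lebesgue_measure_itv/= lte_fin.
  case: ltP => [//|ts]; have -> : t = s by apply/eqP; rewrite eq_le ts st.
  by rewrite subrr.
apply: le_Rintegral => //.
- exact: locbd_integrable_oc.
- exact/locbd_integrable_oc/locbd_cst.
- by move=> u /=; rewrite in_itv/= => /andP[]; exact: fC.
Qed.

Lemma integ_ge_cst f s t C : locbd f -> 0 <= s -> s <= t ->
  (forall u, s < u -> u <= t -> C <= f u) -> C * (t - s) <= integ f t - integ f s.
Proof.
move=> lf s0 st fC.
have := @integ_le_cst (fun u => -1 * f u) s t (- C) (locbd_scale _ lf) s0 st.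
rewrite !integ_scale// => h; suff: -1 * integ f t - -1 * integ f s <= - C * (t - s) by lra.
by apply: h => u su ut; have := fC u su ut; lra.
Qed.

Lemma integ_norm_cst f s t C : locbd f -> 0 <= s -> s <= t ->
  (forall u, s < u -> u <= t -> `|f u| <= C) -> `|integ f t - integ f s| <= C * (t - s).
Proof.
move=> lf s0 st fC; rewrite ler_norml -mulNr; apply/andP; split.
  by apply: integ_ge_cst => // u su ut; have := fC u su ut; rewrite ler_norml => /andP[].
by apply: integ_le_cst => // u su ut; have := fC u su ut; rewrite ler_norml => /andP[].
Qed.

Lemma le_integ f g t : locbd f -> locbd g ->
  (forall s, 0 <= s -> s <= t -> f s <= g s) -> integ f t <= integ g t.
Proof.
move=> lf lg fg; apply: le_Rintegral => //; try exact: locbd_integrable_cc.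
by move=> u /=; rewrite in_itv/= => /andP[]; exact: fg.
Qed.

Lemma integ_near f r e : locbd f -> (\forall s \near r, `|f s| <= e) ->
  \forall t \near r, `|integ f t - integ f r| <= e * `|t - r|.
Proof.
move=> lf /nbhs_ballP[d /= d0 fe].
have e0 : 0 <= e by apply: le_trans (fe _ (ballxx _ d0)); exact: normr_ge0.
suff H s t : s <= t -> (forall u, s <= u -> u <= t -> `|f u| <= e) ->
    `|integ f t - integ f s| <= e * `|t - s|.
  apply/nbhs_ballP; exists d => //= t; rewrite /ball/= => td.
  have [rt|tr] := leP r t.
    apply: H => // u ru ut; apply: fe; rewrite /ball/=.
    by move: td; rewrite !ltr_norml => /andP[? ?]; apply/andP; split; lra.
  rewrite distrC (distrC t); apply: H; first exact: ltW.
  move=> u ru ut; apply: fe; rewrite /ball/=.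
  by move: td; rewrite !ltr_norml => /andP[? ?]; apply/andP; split; lra.
move=> st fC; have [t0|t0] := leP t 0.
  by rewrite !integ_le0 ?subrr ?normr0 ?mulr_ge0//; lra.
rewrite (ger0_norm (_ : 0 <= t - s)); last lra.
rewrite -(integ_max f s); apply: (@le_trans _ _ (e * (t - Num.max s 0))).
  apply: integ_norm_cst => //; first by rewrite le_max lexx orbT.
    by rewrite ge_max st ltW.
  by move=> u; rewrite gt_max => /andP[su _] ut; apply: fC => //; exact: ltW.
by apply: ler_wpM2l => //; apply: lerB => //; rewrite le_max lexx.
Qed.

Lemma integ_cst C t : 0 <= t -> integ (fun=> C) t = C * t.
Proof.
move=> t0; have l := locbd_cst C.
apply/eqP; rewrite eq_le; apply/andP; split.
  by have := @integ_le_cst _ 0 t C l (lexx _) t0 (fun _ _ _ => lexx C); rewrite (integ_le0 _ (lexx 0)) !subr0.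
by have := @integ_ge_cst _ 0 t C l (lexx _) t0 (fun _ _ _ => lexx C); rewrite (integ_le0 _ (lexx 0)) !subr0.
Qed.

(** This form has no division and includes [t = r], so it combines directly with the bounds on
    increments of [integ]. *)
Lemma is_derive_slope (f : R -> R) r d :
  (forall e, 0 < e -> \forall t \near r, `|f t - f r - d * (t - r)| <= e * `|t - r|) <->
  is_derive r 1 f d.
Proof.
have slope_cvg : (forall e, 0 < e ->
      \forall t \near r, `|f t - f r - d * (t - r)| <= e * `|t - r|) <->
    (h^-1 *: (f (h *: 1 + r) - f r)) @[h --> 0^'] --> d.
  split=> [H|H].
    apply/cvgrPdist_le => e e0; have /nbhs_ballP[k /= k0 hk] := H _ e0.
    near=> h.
    have h0 : h != 0 by near: h; exact: nbhs_dnbhs_neq.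
    have hk' : ball r k (h *: 1 + r).
      rewrite /ball/= opprD addrCA subrr addr0 normrN /GRing.scale/= mulr1.
      by near: h; apply: dnbhs0_lt.
    have := hk _ hk'; rewrite addrK /GRing.scale/= mulr1 => hh.
    rewrite -(@ler_pM2r _ `|h|) ?normr_gt0// -normrM.
    apply: le_trans hh; rewrite -[leRHS]normrN.
    by rewrite le_eqVlt; apply/orP; left; apply/eqP; congr (`|_|); field.
  move=> e e0; move/cvgrPdist_le : H => /(_ _ e0)/nbhs_ballP[k /= k0 hk].
  apply/nbhs_ballP; exists k => //= t rt.
  have [->|tr] := eqVneq t r; first by rewrite !subrr mulr0 subr0 normr0 mulr0.
  have tr0 : t - r != 0 by rewrite subr_eq0.
  have rt' : ball 0 k (t - r) by rewrite /ball/= sub0r normrN distrC.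
  have := hk _ rt' tr0.
  rewrite /GRing.scale/= mulr1 subrK => hh.
  rewrite -(@ler_pM2r _ `|t - r|) ?normr_gt0// -normrM in hh.
  apply: le_trans hh; rewrite -[leRHS]normrN.
  by rewrite le_eqVlt; apply/orP; left; apply/eqP; congr (`|_|); field.
split=> [/slope_cvg H|H].
  by apply: DeriveDef; [apply/cvg_ex; exists d|apply/cvg_lim].
apply/slope_cvg; have [? <-] := H; exact: ex_derive.
Unshelve. all: by end_near. Qed.

Lemma zero_slope_cst (D : R -> R) :
  (forall r e, 0 < e -> \forall t \near r, `|D t - D r| <= e * `|t - r|) ->
  forall s t, D s = D t.
Proof.
move=> hD s t; apply: is_derive_0_is_cst => r; apply/is_derive_slope => e e0.
by apply: filterS (hD r e e0) => u; rewrite mul0r subr0.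
Qed.

(* For [t < 0] the integral is over an empty interval, so that [F] is constant on
   the negative half-line: no one-sided limit at 0 is ever needed. *)
Definition prim F f := locbd f /\ forall t, F t = F 0 + integ f t.

Lemma prim_locbd F f : prim F f -> locbd f. Proof. by case. Qed.

Lemma primE F f t : prim F f -> F t = F 0 + integ f t. Proof. by case. Qed.

Lemma primB F f s t : prim F f -> F t - F s = integ f t - integ f s.
Proof. by move=> pF; rewrite (primE t pF) (primE s pF); ring. Qed.

Lemma prim_le0 F f t : prim F f -> t <= 0 -> F t = F 0.
Proof. by move=> pF t0; rewrite (primE _ pF) integ_le0// addr0. Qed.

Lemma prim_le F f s t C : prim F f -> 0 <= s -> s <= t ->
  (forall u, s < u -> u <= t -> f u <= C) -> F t - F s <= C * (t - s).
Proof. by move=> pF; rewrite (primB _ _ pF); apply: integ_le_cst (prim_locbd pF). Qed.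

Lemma prim_norm F f s t C : prim F f -> 0 <= s -> s <= t ->
  (forall u, s < u -> u <= t -> `|f u| <= C) -> `|F t - F s| <= C * (t - s).
Proof. by move=> pF; rewrite (primB _ _ pF); apply: integ_norm_cst (prim_locbd pF). Qed.

Lemma prim_integ C f : locbd f -> prim (fun t => C + integ f t) f.
Proof. by move=> lf; split=> // t; rewrite (integ_le0 _ (lexx 0)) addr0. Qed.

Lemma prim_near F f r : prim F f ->
  exists2 C, 0 < C & \forall t \near r, `|F t - F r| <= C * `|t - r|.
Proof.
move=> pF; have [C C0 fC] := locbd_bound (`|r| + 1) (prim_locbd pF).
exists C => //.
have : \forall s \near r, `|f s| <= C.
  near=> s; apply: fC.
  have : `|s - r| < 1.
    by near: s; exact: near_dist.
  have := ler_normD (s - r) r; rewrite subrK; lra.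
by move/(integ_near (prim_locbd pF)); apply: filterS => t; rewrite (primB r t pF).
Unshelve. all: by end_near. Qed.

Lemma prim_continuous F f : prim F f -> continuous F.
Proof.
move=> pF r; have [C C0 FC] := prim_near r pF.
apply/cvgrPdist_le => e e0; near=> t; rewrite distrC.
apply: (@le_trans _ _ (C * `|t - r|)); first by near: t.
have : `|t - r| < e / C.
  by near: t; apply: near_dist; exact: divr_gt0.
by rewrite ltr_pdivlMr// mulrC => /ltW.
Unshelve. all: by end_near. Qed.

(** The difference of [F] and [integ f] has zero slope at every point, hence is constant. Comparing
    with [integ f] rather than with [f r * (t - r)] is what allows a discontinuous [f]. *)
Lemma prim_intro F f : locbd f ->
  (forall r e, 0 < e -> \forall t \near r,
    `|F t - F r - (integ f t - integ f r)| <= e * `|t - r|) -> prim F f.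
Proof.
move=> lf H; split=> // t.
have := @zero_slope_cst (fun t => F t - integ f t) _ t 0.
rewrite (integ_le0 _ (lexx 0)) subr0 => <-; first by rewrite subrK.
move=> r e e0; apply: filterS (H r e e0) => u.
by have -> : F u - F r - (integ f u - integ f r) = F u - integ f u - (F r - integ f r) by ring.
Qed.

Lemma prim_ext F F' f f' : prim F f -> F =1 F' -> f =1 f' -> prim F' f'.
Proof. by move=> pF /funext <- /funext <-. Qed.

Lemma prim_cst C : prim (fun=> C) (fun=> 0).
Proof.
split; first exact: locbd_cst.
move=> t; have [t0|t0] := leP 0 t; first by rewrite integ_cst// mul0r addr0.
by rewrite integ_le0 ?addr0//; exact: ltW.
Qed.

Lemma prim_add F G f g : prim F f -> prim G g ->
  prim (fun t => F t + G t) (fun t => f t + g t).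
Proof.
move=> pF pG; have lf := prim_locbd pF; have lg := prim_locbd pG.
split; first exact: locbd_add.
by move=> t; rewrite integ_add// (primE t pF) (primE t pG); ring.
Qed.

Lemma prim_scale C F f : prim F f -> prim (fun t => C * F t) (fun t => C * f t).
Proof.
move=> pF; have lf := prim_locbd pF; split; first exact: locbd_scale.
by move=> t; rewrite integ_scale// (primE t pF) mulrDr.
Qed.

Lemma prim_sub F G f g : prim F f -> prim G g ->
  prim (fun t => F t - G t) (fun t => f t - g t).
Proof.
move=> pF /(prim_scale (-1)) pG; apply: prim_ext (prim_add pF pG) _ _ => t /=;
by rewrite mulN1r.
Qed.

(** Two errors are [o(|t - r|)]: the Taylor remainder of [h] at [F r], because [F] is locally
    Lipschitz, and the integral of [(h' (F s) - h' (F r)) * f s], because [h' \o F] is continuous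
    and [f] is locally bounded. *)
Lemma prim_comp h h' F f : (forall r, is_derive r 1 h (h' r)) -> continuous h' ->
  prim F f -> prim (h \o F) (fun t => h' (F t) * f t).
Proof.
move=> dh ch pF; have lf := prim_locbd pF.
have cF := prim_continuous pF.
have lh : locbd (h' \o F).
  by apply: locbd_continuous => t; apply: continuous_comp; [exact: cF|exact: ch].
apply: prim_intro; first exact: locbd_mul lh lf.
move=> r e e0.
have [C C0 FC] := prim_near r pF.
have [B B0 fB] := locbd_bound (`|r| + 1) lf.
have dhr := (is_derive_slope h (F r) (h' (F r))).2 (dh (F r)).
have e1 : 0 < e / 2 / C by rewrite !divr_gt0.
have n1 := dhr _ e1.
have n2 : \forall t \near r, `|h (F t) - h (F r) - h' (F r) * (F t - F r)| <=
    e / 2 / C * `|F t - F r| by exact: (cF r _ n1).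
have n3 : \forall t \near r,
    `|integ (fun s => (h' (F s) - h' (F r)) * f s) t -
      integ (fun s => (h' (F s) - h' (F r)) * f s) r| <= e / 2 * `|t - r|.
  apply: integ_near; first by apply: locbd_mul lf; apply: locbd_sub lh (locbd_cst _).
  near=> s.
  have hB : `|h' (F r) - h' (F s)| <= e / 2 / B.
    near: s; have /cvgrPdist_le/(_ (e / 2 / B)) := continuous_comp (cF r) (ch (F r)).
    by apply; rewrite !divr_gt0.
  have fsB : `|f s| <= B.
    apply: fB.
    have : `|s - r| < 1.
      by near: s; exact: near_dist.
    have := ler_normD (s - r) r; rewrite subrK; lra.
  rewrite normrM distrC.
  have -> : e / 2 = e / 2 / B * B by rewrite divfK// gt_eqF.
  by apply: ler_pM.
near=> t.
have FCt : `|F t - F r| <= C * `|t - r| by near: t.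
have h2 : `|h (F t) - h (F r) - h' (F r) * (F t - F r)| <= e / 2 / C * `|F t - F r|.
  by near: t.
have h3 : `|integ (fun s => (h' (F s) - h' (F r)) * f s) t -
      integ (fun s => (h' (F s) - h' (F r)) * f s) r| <= e / 2 * `|t - r| by near: t.
have JE u : integ (fun s => (h' (F s) - h' (F r)) * f s) u =
    integ (fun s => h' (F s) * f s) u - h' (F r) * integ f u.
  rewrite -integ_scale// -integ_sub//; last exact: locbd_scale.
    by apply: eq_integ => s _ _; ring.
  exact: locbd_mul lh lf.
rewrite !JE in h3; rewrite /=.
have -> : h (F t) - h (F r) - (integ (fun s => h' (F s) * f s) t -
    integ (fun s => h' (F s) * f s) r) =
  (h (F t) - h (F r) - h' (F r) * (F t - F r)) -
  (integ (fun s => h' (F s) * f s) t - h' (F r) * integ f t -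
   (integ (fun s => h' (F s) * f s) r - h' (F r) * integ f r)).
  by rewrite (primB r t pF); ring.
apply: le_trans (ler_normB _ _) _.
have h4 : e / 2 / C * `|F t - F r| <= e / 2 * `|t - r|.
  have -> : e / 2 * `|t - r| = e / 2 / C * (C * `|t - r|).
    by rewrite mulrA divfK// gt_eqF.
  by apply: ler_wpM2l => //; exact: ltW.
have -> : e * `|t - r| = e / 2 * `|t - r| + e / 2 * `|t - r| by field.
by apply: lerD => //; exact: le_trans h2 h4.
Unshelve. all: by end_near. Qed.

Lemma prim_sq F f : prim F f -> prim (fun t => F t ^+ 2) (fun t => 2 * F t * f t).
Proof.
apply: (@prim_comp (fun x => x ^+ 2) (fun x => 2 * x)).
  move=> r; apply/is_derive_slope => e e0; near=> t.
  have : `|t - r| < e.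
    by near: t; exact: near_dist.
  have -> : t ^+ 2 - r ^+ 2 - 2 * r * (t - r) = (t - r) * (t - r) by ring.
  by rewrite normrM => h; apply: ler_wpM2r => //; exact: ltW.
by move=> r; apply: cvgM; [exact: cvg_cst|exact: cvg_id].
Unshelve. all: by end_near. Qed.

(** Polarisation: [2 F G = (F + G)^2 - F^2 - G^2] reduces the product rule to the chain rule for
    squares. *)
Lemma prim_mul F G f g : prim F f -> prim G g ->
  prim (fun t => F t * G t) (fun t => f t * G t + F t * g t).
Proof.
move=> pF pG.
have p := prim_scale 2^-1 (prim_sub (prim_sub (prim_sq (prim_add pF pG)) (prim_sq pF))
  (prim_sq pG)).
by apply: prim_ext p _ _ => t /=; field.
Qed.

(** The square of the positive part: the simplest C^1 function that vanishes exactly on [r <= 0]. *)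
Definition pos2 (r : R) := Num.max r 0 ^+ 2.

Lemma is_derive_pos2 r : is_derive r 1 pos2 (2 * Num.max r 0).
Proof.
apply/is_derive_slope => e e0; near=> t.
have te : `|t - r| < e.
  by near: t; exact: near_dist.
suff : `|pos2 t - pos2 r - 2 * Num.max r 0 * (t - r)| <= `|t - r| * `|t - r|.
  by move/le_trans; apply; apply: ler_wpM2r => //; exact: ltW.
rewrite -normrM (ger0_norm (_ : 0 <= (t - r) * (t - r))); last by rewrite -expr2 sqr_ge0.
rewrite ler_norml /pos2.
have := sqr_ge0 (t - r); have := sqr_ge0 t; have := sqr_ge0 r.
case: (leP t 0) => t0; case: (leP r 0) => r0 h1 h2 h3; apply/andP; split; rewrite ?mulr0 ?mul0r; try nra.
all: have : 0 <= (- t) * r by apply: mulr_ge0; lra.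
all: nra.
Unshelve. all: by end_near. Qed.

Lemma continuous_pos2' : continuous (fun r : R => 2 * Num.max r 0).
Proof.
move=> r; apply: cvgM; first exact: cvg_cst.
by apply: continuous_max; [exact: cvg_id|exact: cvg_cst].
Qed.

Lemma prim_nincr F f s t : prim F f -> 0 <= s -> s <= t ->
  (forall u, s < u -> u <= t -> f u <= 0) -> F t <= F s.
Proof. by move=> pF s0 st h; have := prim_le pF s0 st h; rewrite mul0r subr_le0. Qed.

(* Once below [c], [F] stays there because [Num.max (F - c) 0 ^+ 2] is nonincreasing. *)
Lemma prim_barrier F f c k t : prim F f -> 0 <= k -> 0 <= t ->
  (forall s, 0 < s -> s <= t -> c < F s -> f s <= - k) ->
  F t <= Num.max c (F 0 - k * t).
Proof.
move=> pF k0 t0 H; have [//|Ftc] := leP (F t) c; first by rewrite le_max => ->.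
have pG := prim_comp is_derive_pos2 continuous_pos2' (prim_sub pF (prim_cst c)).
have Fc s : 0 <= s -> s <= t -> c < F s.
  move=> s0 st; rewrite ltNge; apply/negP => Fsc.
  have /(prim_nincr pG s0 st) : forall u, s < u -> u <= t ->
      2 * Num.max (F u - c) 0 * (f u - 0) <= 0.
    move=> u su ut; rewrite subr0; case: (leP (F u - c) 0) => Fu.
      by rewrite mulr0 mul0r.
    have := H u (le_lt_trans s0 su) ut; rewrite -subr_gt0 => /(_ Fu); nra.
  rewrite /= /pos2; case: (leP (F t - c) 0) => [|h1]; first lra.
  by case: (leP (F s - c) 0) => [|]; [nra|lra].
rewrite le_max; apply/orP; right.
have := @prim_le _ _ 0 t (- k) pF (lexx _) t0; rewrite subr0 => h.
suff : F t - F 0 <= - k * t by lra.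
by apply: h => u u0 ut; apply: H => //; apply: Fc => //; exact: ltW.
Qed.

Lemma eq_integB f g s t : locbd f -> locbd g -> 0 <= s -> s <= t ->
  (forall u, s < u -> u <= t -> f u = g u) -> integ f t - integ f s = integ g t - integ g s.
Proof.
move=> lf lg s0 st fg; rewrite !integ_split//; apply: eq_Rintegral => u.
by rewrite inE/= in_itv/= => /andP[]; exact: fg.
Qed.

Lemma measurable_sub (x : R -> R) : continuous x ->
  measurable_fun setT (fun s => 0 < x s).
Proof.
by move=> cx; apply: measurable_fun_ltr; [exact: measurable_cst|exact: continuous_measurable_fun].
Qed.

Lemma locbd_if (b : R -> bool) f g : measurable_fun setT b ->
  locbd f -> locbd g -> locbd (fun s => if b s then f s else g s).
Proof.
move=> mb [mf bf] [mg bg]; split; first exact: measurable_fun_ifT.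
move=> T; have [C fC] := bf T; have [D gD] := bg T.
exists (Num.max C D) => s sT; rewrite le_max; case: ifP => _.
  by rewrite fC.
by rewrite gD ?orbT.
Qed.

Lemma locbd_if_le f g c : locbd f -> locbd g ->
  locbd (fun s => if s <= c then f s else g s).
Proof.
move=> lf lg; apply: (@locbd_if (fun s => s <= c)) => //.
by apply: measurable_fun_ler; [exact: measurable_id|exact: measurable_cst].
Qed.

(** Serves to discard the initial layer without shifting time, so that costs are still compared at
    equal times after [c]. *)
Lemma prim_freeze F f c : prim F f -> 0 <= c ->
  prim (fun t => F (Num.max t c)) (fun s => if s <= c then 0 else f s).
Proof.
move=> pF c0; have lf := prim_locbd pF.
have lg : locbd (fun s => if s <= c then 0 else f s).
  exact: locbd_if_le (locbd_cst 0) lf.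
have J0 t : t <= c -> integ (fun s => if s <= c then 0 else f s) t = 0.
  move=> tc; rewrite (@eq_integ _ (fun=> 0)).
    by have := primE t (prim_cst 0); lra.
  by move=> s _ st; rewrite (le_trans st tc).
split=> // t; rewrite (max_idPr c0); case: (leP t c) => tc.
  by rewrite J0// addr0.
have := @eq_integB f (fun s => if s <= c then 0 else f s) c t lf lg c0 (ltW tc).
rewrite -(primB _ _ pF) (J0 c)// subr0 => <-; first by lra.
by move=> u cu _; rewrite leNgt cu.
Qed.

End LocallyBounded.

(** * Translation, concatenation and multiplication by a sign *)

Section Translation.
Context {R : realType}.
Implicit Types (f g F G : R -> R) (r s t T C : R).
Notation mu := (@lebesgue_measure R).

Lemma measurable_translate (c : R) : measurable_fun setT (fun x : R => x + c : measurableTypeR R).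
Proof. by apply: measurable_funD; [exact: measurable_id|exact: measurable_cst]. Qed.

(** The two measures agree on half-open intervals, which determine Lebesgue measure. *)
Lemma lebesgue_translate (c : R) (A : set R) : measurable A ->
  pushforward mu (fun x => x + c : measurableTypeR R) A = mu A.
Proof.
move=> mA; apply/esym/lebesgue_measure_unique => //=.
  exact: measurable_translate.
move=> _ _ [[a b]] _ <-; rewrite /pushforward.
have -> : (fun x => x + c) @^-1` [set` Interval (BRight a) (BRight b)] = `]a - c, b - c]%classic.
  by apply/seteqP; split => x /=; rewrite !in_itv/= => /andP[h1 h2]; apply/andP; split; lra.
rewrite !lebesgue_measure_itv/= !lte_fin ltrD2r; case: ifP => // _.
by rewrite -!EFinD; congr EFin; ring.
Qed.

Lemma Rintegral_translate (c : R) (D : set R) f : measurable D ->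
  measurable_fun setT f ->
  mu.-integrable ((fun x => x + c) @^-1` D) (EFin \o (fun x => f (x + c))) ->
  \int[mu]_(x in D) f x = \int[mu]_(x in (fun x => x + c) @^-1` D) f (x + c).
Proof.
move=> mD mf intf; rewrite /Rintegral; congr fine.
have := @integral_pushforward _ _ (measurableTypeR R) (measurableTypeR R) R (fun x => x + c) (measurable_translate c) mu D (EFin \o f).
move=> /(_ _ intf mD) <-; last exact/measurable_EFinP.
apply: eq_measure_integral => //=; first exact: measurable_translate.
by move=> _ A mA AD; exact/esym/lebesgue_translate.
Qed.

Lemma locbd_translate f c : locbd f -> locbd (fun s => f (s + c)).
Proof.
move=> [mf bf]; split; first exact: measurableT_comp (measurable_translate c).
move=> T; have [C fC] := bf (T + `|c|); exists C => s sT; apply: fC.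
by apply: le_trans (ler_normD _ _) _; exact: lerD.
Qed.

Lemma integ_translate f c t : locbd f -> 0 <= c -> c <= t ->
  integ (fun s => f (s - c)) t - integ (fun s => f (s - c)) c = integ f (t - c).
Proof.
move=> lf c0 ct; have lg := locbd_translate (- c) lf.
rewrite integ_split// [RHS](_ : _ = integ f (t - c) - integ f 0); last by rewrite (integ_le0 f (lexx 0)) subr0.
rewrite integ_split//; last lra.
have E : (fun x => x + - c) @^-1` `]0, t - c]%classic = `]c, t]%classic.
  by apply/seteqP; split => x /=; rewrite !in_itv/= => /andP[h1 h2]; apply/andP; split; lra.
rewrite (@Rintegral_translate (- c) `]0, t - c] f) ?E => //; first by case: lf.
exact: locbd_integrable_oc lg.
Qed.

(** Switching controls at time [c] only requires the second path to start where the first one is;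
    this is the basis of dynamic programming below. *)
Lemma prim_concat F G f g c : prim F f -> prim G g -> 0 <= c -> G 0 = F c ->
  prim (fun t => if t <= c then F t else G (t - c))
       (fun t => if t <= c then f t else g (t - c)).
Proof.
move=> pF pG c0 GF; have lf := prim_locbd pF; have lg := prim_locbd pG.
have lg' := locbd_translate (- c) lg.
have lh : locbd (fun t => if t <= c then f t else g (t - c)) by exact: locbd_if_le.
split=> // t; rewrite c0; case: ifPn => [tc|]; rewrite ?(primE t pF).
  by congr (_ + _); apply: eq_integ => s _ st; rewrite (le_trans st tc).
rewrite -ltNge => tc.
have e1 : integ (fun t => if t <= c then f t else g (t - c)) c = integ f c.
  by apply: eq_integ => s _ ->.
have e2 : integ (fun t => if t <= c then f t else g (t - c)) t -
    integ (fun t => if t <= c then f t else g (t - c)) c = integ g (t - c).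
  rewrite -integ_translate//; last exact: ltW.
  by apply: eq_integB => //; [exact: ltW|move=> u cu _; rewrite leNgt cu].
by rewrite (primE (t - c) pG) GF (primE c pF); lra.
Qed.

Lemma near_sg (x : R -> R) r : continuous x -> x r != 0 ->
  \forall s \near r, Num.sg (x s) = Num.sg (x r).
Proof.
move=> cx xr; have h : 0 < `|x r| by rewrite normr_gt0.
have /cvgrPdist_lt/(_ _ h) := cx r; apply: filterS => s.
have [x0|x0|x0] := ltgtP (x r) 0; last by rewrite x0 eqxx in xr.
  by rewrite (ltr0_norm x0) ltr_norml => /andP[h1 h2]; rewrite !ltr0_sg//; lra.
by rewrite (gtr0_norm x0) ltr_norml => /andP[h1 h2]; rewrite !gtr0_sg//; lra.
Qed.

Lemma locbd_sg (x : R -> R) : continuous x -> locbd (fun s => Num.sg (x s)).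
Proof.
move=> cx.
have mp (y : R -> R) : continuous y -> locbd (fun s => if 0 < y s then 1 else 0).
  move=> cy; apply: (@locbd_if R (fun s => 0 < y s) (fun=> 1) (fun=> 0)); try exact: locbd_cst.
  exact: measurable_sub.
have -> : (fun s => Num.sg (x s)) =
    (fun s => (if 0 < x s then 1 else 0) - (if 0 < - x s then 1 else 0)).
  apply/funext => s; have [x0|x0|->] := ltgtP (x s) 0.
  - by rewrite ltr0_sg// oppr_gt0 x0 sub0r.
  - by rewrite gtr0_sg// oppr_gt0 ltNge (ltW x0)/= subr0.
  - by rewrite oppr0 ltxx sgr0 subr0.
by apply: locbd_sub; apply: mp => //; move=> t; apply: cvgN; exact: cx.
Qed.

(* Where [x] vanishes, [F] vanishes to second order, so that the jump of
   [Num.sg \o x] is not seen. *)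
Lemma prim_sg F f (x : R -> R) : prim F f -> continuous x ->
  (forall r, x r = 0 -> F r = 0 /\ forall e, 0 < e -> \forall s \near r, `|f s| <= e) ->
  prim (fun t => Num.sg (x t) * F t) (fun t => Num.sg (x t) * f t).
Proof.
move=> pF cx H; have lf := prim_locbd pF; have ls := locbd_sg cx.
have lsf : locbd (fun t => Num.sg (x t) * f t) by exact: locbd_mul.
apply: prim_intro => // r e e0.
have sg1 (a : R) : `|Num.sg a| <= 1.
  by rewrite normr_sg; case: (_ != _).
have [x0|x0] := eqVneq (x r) 0.
  have [Fr fr] := H r x0.
  have e2 : 0 < e / 2 by lra.
  have n1 := integ_near lf (fr _ e2).
  have n2 : \forall t \near r, `|integ (fun t => Num.sg (x t) * f t) t -
      integ (fun t => Num.sg (x t) * f t) r| <= e / 2 * `|t - r|.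
    apply: integ_near => //; apply: filterS (fr _ e2) => s; apply: le_trans.
    by rewrite normrM ler_piMl.
  near=> t.
  have h1 : `|integ f t - integ f r| <= e / 2 * `|t - r| by near: t.
  have h2 : `|integ (fun t => Num.sg (x t) * f t) t -
      integ (fun t => Num.sg (x t) * f t) r| <= e / 2 * `|t - r| by near: t.
  rewrite x0 sgr0 mul0r subr0.
  apply: le_trans (ler_normB _ _) _.
  have -> : e * `|t - r| = e / 2 * `|t - r| + e / 2 * `|t - r| by field.
  apply: lerD h2; apply: le_trans h1; rewrite -(primB r t pF) Fr subr0 normrM.
  by rewrite ler_piMl.
have n3 : \forall t \near r, `|integ (fun s => (Num.sg (x s) - Num.sg (x r)) * f s) t -
    integ (fun s => (Num.sg (x s) - Num.sg (x r)) * f s) r| <= e * `|t - r|.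
  apply: integ_near; first by apply: locbd_mul lf; apply: locbd_sub ls (locbd_cst _).
  by apply: filterS (near_sg cx x0) => s ->; rewrite subrr mul0r normr0 ltW.
have n4 := near_sg cx x0.
near=> t.
have h3 : `|integ (fun s => (Num.sg (x s) - Num.sg (x r)) * f s) t -
    integ (fun s => (Num.sg (x s) - Num.sg (x r)) * f s) r| <= e * `|t - r| by near: t.
have -> : Num.sg (x t) = Num.sg (x r) by near: t.
have JE u : integ (fun s => (Num.sg (x s) - Num.sg (x r)) * f s) u =
    integ (fun s => Num.sg (x s) * f s) u - Num.sg (x r) * integ f u.
  rewrite -integ_scale// -integ_sub//; last exact: locbd_scale.
  by apply: eq_integ => s _ _; ring.
rewrite !JE distrC in h3; apply: le_trans h3; rewrite -mulrBr (primB r t pF).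
by rewrite le_eqVlt; apply/orP; left; apply/eqP; congr (`|_|); ring.
Unshelve. all: by end_near. Qed.

Lemma eq_integ_ae f g t : measurable_fun (@halfline R) f -> measurable_fun (@halfline R) g ->
  {ae mu, forall s, halfline s -> f s = g s} -> integ f t = integ g t.
Proof.
move=> mf mg fg; have [t0|t0] := leP t 0; first by rewrite !integ_le0.
have sub : `]0, t] `<=` @halfline R.
  by move=> s; rewrite /halfline /= !in_itv/= => /andP[-> _].
rewrite /integ /Rintegral; congr fine.
(* The hypothesis says nothing at 0, which is not in [halfline], so the left endpoint is dropped
   first. *)
rewrite -!integral_itv_obnd_cbnd.
- apply: ae_eq_integral => //.
  + by apply/measurable_EFinP; apply: (measurable_funS _ sub) => //; exact: measurable_itv.
  + by apply/measurable_EFinP; apply: (measurable_funS _ sub) => //; exact: measurable_itv.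
  + case: fg => N [mN N0 subN]; exists N; split => // s /= h; apply: subN => /= h'.
    by apply: h => /sub/h' ->.
- by apply/measurable_EFinP; apply: (measurable_funS _ sub) => //; exact: measurable_itv.
- by apply/measurable_EFinP; apply: (measurable_funS _ sub) => //; exact: measurable_itv.
Qed.
End Translation.

(** * Tools for Picard iteration: weighted bounds, geometric convergence, clamping *)

Section Picard.
Context {R : realType}.
Implicit Types (f g F G x y : R -> R) (r s t T C : R).

Lemma prim_eq F f g : prim F f -> locbd g -> (forall s, 0 <= s -> f s = g s) -> prim F g.
Proof.
move=> pF lg fg; split=> // t; rewrite (primE t pF); congr (_ + _).
by apply: eq_integ => s s0 _; exact: fg.
Qed.

(** Time in the sense of [prim], which forces constancy for [t <= 0]. *)
Lemma prim_id : prim (fun t : R => Num.max t 0) (fun=> 1).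
Proof.
split; first exact: locbd_cst.
move=> t; rewrite maxxx add0r; case: (leP t 0) => t0; first by rewrite integ_le0.
by rewrite integ_cst ?mul1r// ltW.
Qed.

(** Integrating against the weight [expR (L * t)] gains a factor [1 / L], so that a large [L] turns
    an integral operator into a contraction on a bounded interval of any length (Bielecki's weighted
    norm). *)
Lemma integ_expR_le f L C t : locbd f -> 0 < L -> 0 <= t ->
  (forall s, 0 <= s -> s <= t -> f s <= C * expR (L * s)) -> 0 <= C ->
  integ f t <= C / L * expR (L * t).
Proof.
move=> lf L0 t0 fC C0.
have pE : prim ((fun r => C / L * expR (L * r)) \o (fun t : R => Num.max t 0))
    (fun t => C * expR (L * Num.max t 0) * 1).
  apply: (@prim_comp _ _ (fun r => C * expR (L * r))); last exact: prim_id.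
    move=> r.
    have d1 : is_derive r (1 : R) (L *: id) (L *: 1) by exact: is_deriveZ.
    have d2 : is_derive ((L *: id) r) (1 : R) (@expR R) (expR (L * r)) by exact: is_derive_expR.
    have d3 := @is_deriveZ _ _ _ _ (C / L) _ _ _ (is_derive1_comp d2 d1).
    apply: (is_derive_eq d3); rewrite /GRing.scale/= mulr1.
    by field; rewrite gt_eqF.
  move=> r; apply: cvgM; first exact: cvg_cst.
  apply: continuous_comp; last exact: continuous_expR.
  by apply: cvgM; [exact: cvg_cst|exact: cvg_id].
have le1 : integ f t <= integ (fun t => C * expR (L * Num.max t 0) * 1) t.
  apply: le_integ => //; first exact: prim_locbd pE.
  by move=> s s0 st; rewrite mulr1 (max_idPl s0); exact: fC.
apply: le_trans le1 _.
have := primE t pE; rewrite /= (max_idPl t0) maxxx mulr0 expR0 mulr1 => ->.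
by rewrite lerDr divr_ge0// ltW.
Qed.

Lemma expn2_gt0 n : 0 < (2 : R) ^+ n. Proof. by rewrite exprn_gt0. Qed.

Lemma expn2_ge n : n%:R <= (2 : R) ^+ n.
Proof. by rewrite -natrX ler_nat ltnW// ltn_expl. Qed.

Lemma le_geometric_small (C e : R) : 0 < e -> exists n, C / 2 ^+ n <= e.
Proof.
move=> e0; exists (Num.bound `|C / e|).
rewrite ler_pdivrMr ?expn2_gt0// mulrC -ler_pdivrMr//.
apply: le_trans (expn2_ge _); apply: le_trans (ler_norm _) _.
by apply/ltW/archi_boundP.
Qed.

Lemma norm_le_geometric0 (C z : R) : (forall n, `|z| <= C / 2 ^+ n) -> z = 0.
Proof.
move=> H; apply/eqP/negPn/negP => z0.
have z1 : 0 < `|z| / 2 by rewrite divr_gt0// normr_gt0.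
have [n hn] := le_geometric_small C z1.
have := le_trans (H n) hn; have : 0 < `|z| by rewrite normr_gt0.
lra.
Qed.

(** The intervals of radius [2 * B / 2 ^+ n] about [u n] are nested; the limit is the supremum of
    their left ends. *)
Lemma geometric_cvg (u : nat -> R) B : (forall n, `|u n.+1 - u n| <= B / 2 ^+ n) ->
  exists l, forall n, `|u n - l| <= 2 * B / 2 ^+ n.
Proof.
move=> H.
pose d n := 2 * B / (2 : R) ^+ n.
have dS n : d n = B / 2 ^+ n + d n.+1.
  by rewrite /d exprS; field; rewrite gt_eqF// expn2_gt0.
have B0 : 0 <= B.
  by have := le_trans (normr_ge0 _) (H 0%N); rewrite expr0 divr1.
have d0 n : 0 <= d n by rewrite /d divr_ge0// ?mulr_ge0// ltW// expn2_gt0.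
have inc m n : u n - d n <= u (n + m)%N - d (n + m)%N.
  elim: m => [|m IH]; first by rewrite addn0.
  apply: le_trans IH _; rewrite addnS.
  have := H (n + m)%N; rewrite ler_norml => /andP[h1 h2].
  have := dS (n + m)%N; lra.
have dec m n : u (n + m)%N + d (n + m)%N <= u n + d n.
  elim: m => [|m IH]; first by rewrite addn0.
  apply: le_trans IH; rewrite addnS.
  have := H (n + m)%N; rewrite ler_norml => /andP[h1 h2].
  have := dS (n + m)%N; lra.
have cross n m : u n - d n <= u m + d m.
  have := inc m n; have := dec n m; have := d0 (n + m)%N; rewrite (addnC m n); lra.
pose A := range (fun n => u n - d n).
have ubA m : ubound A (u m + d m) by move=> _ [n _ <-]; exact: cross.
have sA : has_sup A by split; [exists (u 0%N - d 0%N); exists 0%N|exists (u 0%N + d 0%N)].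
exists (sup A) => n; rewrite -/(d n).
have h1 : u n - d n <= sup A by apply: ub_le_sup; [case: sA|exists n].
have h2 : sup A <= u n + d n by apply: ge_sup; [case: sA|exact: ubA].
by rewrite ler_norml; apply/andP; split; lra.
Qed.

Lemma cubic_lip (K x y x' y' : R) : `|x| <= K -> `|y| <= K -> `|x'| <= K -> `|y'| <= K ->
  `|2 * x * y ^+ 2 - 2 * x' * y' ^+ 2| <= 4 * K ^+ 2 * (`|x - x'| + `|y - y'|).
Proof.
move=> xK yK xK' yK'; have K0 : 0 <= K := le_trans (normr_ge0 _) xK.
have -> : 2 * x * y ^+ 2 - 2 * x' * y' ^+ 2 =
    2 * (x - x') * (y * y) + 2 * x' * (y + y') * (y - y') by ring.
have h1 : `|2 * (x - x') * (y * y)| <= 4 * K ^+ 2 * `|x - x'|.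
  rewrite !normrM (ger0_norm (_ : 0 <= 2))//.
  have : `|y| * `|y| <= K * K by apply: ler_pM.
  have := normr_ge0 (x - x'); nra.
have h2 : `|2 * x' * (y + y') * (y - y')| <= 4 * K ^+ 2 * `|y - y'|.
  rewrite !normrM (ger0_norm (_ : 0 <= 2))//.
  apply: ler_wpM2r => //.
  have := ler_normD y y'; have := normr_ge0 (y + y') ; have := normr_ge0 x'; nra.
by apply: le_trans (ler_normD _ _) _; rewrite [leRHS]mulrDr; exact: lerD.
Qed.

Definition clamp (K r : R) := Num.max (- K) (Num.min K r).

Lemma clamp_norm K r : 0 <= K -> `|clamp K r| <= K.
Proof.
move=> K0; rewrite /clamp ler_norml le_max lexx/= ge_max ge_min lexx/= andbT; lra.
Qed.

Lemma clampP K r : 0 <= K -> [\/ r <= - K /\ clamp K r = - K,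
  [/\ - K <= r, r <= K & clamp K r = r] | K <= r /\ clamp K r = K].
Proof.
move=> K0; have NK : - K <= K by lra.
rewrite /clamp; have [Kr|rK] := leP K r.
  by apply: Or33; rewrite (max_idPr NK).
have [rK'|Kr] := leP r (- K); first by apply: Or31.
by apply: Or32; split => //; exact: ltW.
Qed.

Lemma clamp_lip K r r' : 0 <= K -> `|clamp K r - clamp K r'| <= `|r - r'|.
Proof.
move=> K0; have h1 := ler_norm (r - r'); have h2 := ler_norm (- (r - r')).
rewrite normrN in h2.
by case: (clampP r K0) => -[? ?]; case: (clampP r' K0) => -[? ?] *; rewrite ler_norml;
  apply/andP; split; lra.
Qed.

Lemma clamp_id K r : `|r| <= K -> clamp K r = r.
Proof.
by rewrite ler_norml /clamp => /andP[h1 h2]; rewrite (min_idPr h2) (max_idPr h1).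
Qed.

Lemma clamp_sign K r : 0 <= K -> 0 <= r -> 0 <= clamp K r.
Proof. by move=> K0 r0; rewrite /clamp le_max le_min K0 r0 orbT. Qed.

Lemma clampN K r : 0 <= K -> clamp K (- r) = - clamp K r.
Proof.
by move=> K0; case: (clampP r K0) => -[? ?]; case: (clampP (- r) K0) => -[? ?] *; lra.
Qed.
End Picard.

(** * Existence and uniqueness of penalised trajectories *)

Section Existence.
Context {R : realType}.

Lemma picard_const (c k C L e : R) (n : nat) : L != 0 -> (2 : R) ^+ n != 0 ->
  8 * c * k * (C / 2 ^+ n / L * e) = 16 * c * k / L * (C / 2 ^+ n.+1 * e).
Proof.
move=> L0; rewrite exprS; move: ((2 : R) ^+ n) => p p0.
by field; rewrite L0 p0.
Qed.

Variables (a b : R -> R) (c x0 y0 : R).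
Hypotheses (la : locbd a) (lb : locbd b) (c0 : 0 <= c).
Implicit Types (x y : R -> R) (s t T C : R).

(** A unit control moves a coordinate at speed at most 1, and the penalisation only pulls it towards
    0: this is the resulting a priori bound, with a margin. *)
Let K s : R := `|x0| + `|y0| + `|s| + 1.

Let K0 s : 0 <= K s. Proof. by rewrite /K !addr_ge0. Qed.

(* The field, with its arguments clamped at a level which the solution never reaches. *)
Definition clamped_field x y s := 2 * clamp (K s) (x s) * clamp (K s) (y s) ^+ 2.

Lemma clamped_field_continuous x y : continuous x -> continuous y ->
  continuous (clamped_field x y).
Proof.
move=> cx cy.
have cK : continuous K.
  move=> r; rewrite /K; apply: cvgD; last exact: cvg_cst.
  apply: cvgD; first exact: cvg_cst.
  by apply: cvg_norm; exact: cvg_id.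
have cc z : continuous z -> continuous (fun s => clamp (K s) (z s)).
  move=> cz r; apply: (@continuous_max _ _ (fun s => - K s) (fun s => Num.min (K s) (z s)) r); first by apply: cvgN; exact: cK.
  by apply: continuous_min; [exact: cK|exact: cz].
move=> r; rewrite /clamped_field.
apply: (@continuousM _ _ (fun s => 2 * clamp (K s) (x s)) (fun s => clamp (K s) (y s) ^+ 2)).
  by apply: continuousM; [exact: cvg_cst|exact: cc].
apply: (@continuous_comp _ _ _ (fun s => clamp (K s) (y s)) (fun z => z ^+ 2)).
  exact: cc.
exact: exprn_continuous.
Qed.

Lemma clamped_field_locbd x y : continuous x -> continuous y -> locbd (clamped_field x y).
Proof. by move=> *; apply/locbd_continuous/clamped_field_continuous. Qed.

Definition picard_map x y a0 z0 t := z0 + integ (fun s => a0 s - c * clamped_field x y s) t.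

Lemma picard_map_prim x y a0 z0 : locbd a0 -> continuous x -> continuous y ->
  prim (picard_map x y a0 z0) (fun s => a0 s - c * clamped_field x y s).
Proof.
move=> l0 cx cy; apply: prim_integ; apply: locbd_sub => //.
exact/locbd_scale/clamped_field_locbd.
Qed.

Definition dist2 x y x' y' s := `|x s - x' s| + `|y s - y' s|.

Lemma dist2_locbd x y x' y' : continuous x -> continuous y -> continuous x' ->
  continuous y' -> locbd (dist2 x y x' y').
Proof.
move=> cx cy cx' cy'; apply: locbd_continuous => t.
by apply: cvgD; apply: cvg_norm; apply: cvgB;
  [exact: cx|exact: cx'|exact: cy|exact: cy'].
Qed.

Lemma picard_map_lip x y x' y' a0 z0 t T : locbd a0 ->
  continuous x -> continuous y -> continuous x' -> continuous y' ->
  0 <= t -> t <= T ->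
  `|picard_map x y a0 z0 t - picard_map x' y' a0 z0 t| <=
    4 * c * K T ^+ 2 * integ (dist2 x y x' y') t.
Proof.
move=> l0 cx cy cx' cy' t0 tT.
have l1 := clamped_field_locbd cx cy; have l2 := clamped_field_locbd cx' cy'.
have l3 := locbd_scale c l1; have l4 := locbd_scale c l2.
have l5 := dist2_locbd cx cy cx' cy'.
rewrite /picard_map opprD addrACA subrr add0r -integ_sub; last 2 first.
- exact: locbd_sub.
- exact: locbd_sub.
rewrite -integ_scale// ler_norml.
set g := (fun s => _ * dist2 _ _ _ _ s).
have lg : locbd g by exact: locbd_scale.
have bnd s : 0 <= s -> s <= t ->
    `|a0 s - c * clamped_field x y s - (a0 s - c * clamped_field x' y' s)| <= g s.
  move=> s0 st.
  have -> : a0 s - c * clamped_field x y s - (a0 s - c * clamped_field x' y' s) =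
    - (c * (clamped_field x y s - clamped_field x' y' s)) by ring.
  rewrite normrN normrM (ger0_norm c0) /g.
  have h := cubic_lip (clamp_norm (x s) (K0 s)) (clamp_norm (y s) (K0 s))
     (clamp_norm (x' s) (K0 s)) (clamp_norm (y' s) (K0 s)).
  have -> : 4 * c * K T ^+ 2 * dist2 x y x' y' s =
    c * (4 * K T ^+ 2 * dist2 x y x' y' s) by ring.
  apply: ler_wpM2l => //; apply: le_trans h _.
  have KT : K s <= K T.
    by rewrite /K lerD2r lerD2l !ger0_norm//; [exact: le_trans st tT|exact: le_trans (le_trans s0 st) tT].
  apply: ler_pM.
  - by rewrite mulr_ge0// sqr_ge0.
  - by rewrite addr_ge0.
  - by rewrite ler_wpM2l// ler_sqr ?nnegrE.
  - by apply: lerD; exact: clamp_lip.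
have ld : locbd (fun s => a0 s - c * clamped_field x y s - (a0 s - c * clamped_field x' y' s)).
  by apply: locbd_sub; exact: locbd_sub.
apply/andP; split.
  rewrite -mulN1r -integ_scale//; apply: le_integ => //; first exact: locbd_scale.
  by move=> s s0 st; have := bnd s s0 st; rewrite ler_norml => /andP[]; rewrite mulN1r.
apply: le_integ => // s s0 st.
by have := bnd s s0 st; rewrite ler_norml => /andP[].
Qed.

Definition picard_step (p : (R -> R) * (R -> R)) : (R -> R) * (R -> R) :=
  (picard_map p.1 p.2 a x0, picard_map p.2 p.1 b y0).

Definition picard n := iter n picard_step (fun=> x0, fun=> y0).

Lemma picard_continuous n : continuous (picard n).1 /\ continuous (picard n).2.
Proof.
elim: n => [|n [c1 c2]]; first by split=> t; exact: cvg_cst.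
by split; apply: prim_continuous; apply: picard_map_prim.
Qed.

Lemma dist2C x y x' y' : dist2 y x y' x' = dist2 x y x' y'.
Proof. by apply/funext => s; rewrite /dist2 addrC. Qed.

Lemma picard_dist T : 0 <= T -> exists B, forall n t, 0 <= t -> t <= T ->
  dist2 (picard n.+1).1 (picard n.+1).2 (picard n).1 (picard n).2 t <= B / 2 ^+ n.
Proof.
move=> T0.
(* Twice the Lipschitz constant [8 * c * K T ^+ 2] of the two components together, so that each
   iteration halves the weighted distance; the [+ 1] keeps [L] positive when [c = 0]. *)
pose L := 16 * c * K T ^+ 2 + 1.
have L0 : 0 < L by rewrite /L ltr_wpDl// mulr_ge0 ?sqr_ge0// mulr_ge0.
pose d n := dist2 (picard n.+1).1 (picard n.+1).2 (picard n).1 (picard n).2.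
have ld n : locbd (d n).
  have [c1 c2] := picard_continuous n; have [c3 c4] := picard_continuous n.+1.
  exact: dist2_locbd.
have [C C0 dC] := locbd_bound T (ld 0%N).
have key n t : 0 <= t -> t <= T -> d n t <= C / 2 ^+ n * expR (L * t).
  elim: n t => [|n IH] t t0 tT.
    rewrite expr0 divr1; apply: (@le_trans _ _ C).
      by apply: le_trans (ler_norm _) _; apply: dC; rewrite ger0_norm.
    by rewrite ler_peMr ?(ltW C0)// -[leLHS]expR0 ler_expR mulr_ge0// ltW.
  have [c1 c2] := picard_continuous n; have [c3 c4] := picard_continuous n.+1.
  have h1 := picard_map_lip x0 la c3 c4 c1 c2 t0 tT.
  have h2 := picard_map_lip y0 lb c4 c3 c2 c1 t0 tT.
  rewrite dist2C in h2.
  have C1 : 0 <= C / 2 ^+ n by rewrite divr_ge0// ltW// expn2_gt0.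
  have h3 : integ (d n) t <= C / 2 ^+ n / L * expR (L * t).
    apply: integ_expR_le => // s s0 st; apply: IH => //; exact: le_trans st tT.
  apply: (@le_trans _ _ (8 * c * K T ^+ 2 * integ (d n) t)).
    by rewrite /d /dist2 /= -/(d n) in h1 h2 *; rewrite /d /dist2 /= in h1 h2; lra.
  apply: (@le_trans _ _ (8 * c * K T ^+ 2 * (C / 2 ^+ n / L * expR (L * t)))).
    by apply: ler_wpM2l => //; rewrite mulr_ge0 ?sqr_ge0// mulr_ge0.
  have -> : 8 * c * K T ^+ 2 * (C / 2 ^+ n / L * expR (L * t)) =
    (16 * c * K T ^+ 2 / L) * (C / 2 ^+ n.+1 * expR (L * t)).
    by apply: picard_const; rewrite lt0r_neq0// expn2_gt0.
  apply: ler_piMl; first by rewrite mulr_ge0 ?expR_ge0// divr_ge0// ltW// expn2_gt0.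
  by rewrite ler_pdivrMr// mul1r /L lerDl.
exists (C * expR (L * T)) => n t t0 tT; apply: le_trans (key n t t0 tT) _.
rewrite mulrAC ler_pM2r ?invr_gt0 ?expn2_gt0// ler_pM2l// ler_expR.
by rewrite ler_pM2l.
Qed.

Lemma picard_limit : exists x y, [/\ continuous x, continuous y &
  forall T, 0 <= T -> exists B, forall n t, 0 <= t -> t <= T ->
  dist2 (picard n).1 (picard n).2 x y t <= B / 2 ^+ n].
Proof.
have pic0 n t : t <= 0 -> (picard n).1 t = x0 /\ (picard n).2 t = y0.
  case: n => [|n] t0; first by [].
  by rewrite /= /picard_map !integ_le0// !addr0.
(* The limit is chosen pointwise, with an estimate valid for every admissible [B]; one and the same
   limit then serves all horizons [T]. *)
have ex t : exists l : R * R, 0 <= t -> forall n B,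
    (forall n, dist2 (picard n.+1).1 (picard n.+1).2 (picard n).1 (picard n).2 t <= B / 2 ^+ n) ->
    `|(picard n).1 t - l.1| <= 2 * B / 2 ^+ n /\ `|(picard n).2 t - l.2| <= 2 * B / 2 ^+ n.
  have [t0|t0] := ltP t 0; first by exists 0 => h; lra.
  have [B hB] := picard_dist t0.
  have h n : dist2 (picard n.+1).1 (picard n.+1).2 (picard n).1 (picard n).2 t <= B / 2 ^+ n.
    exact: hB.
  have g1 B' : (forall n, dist2 (picard n.+1).1 (picard n.+1).2 (picard n).1 (picard n).2 t <= B' / 2 ^+ n) ->
    exists l1, forall n, `|(picard n).1 t - l1| <= 2 * B' / 2 ^+ n.
    move=> hB'; apply: geometric_cvg => n; apply: le_trans (hB' n).
    by rewrite /dist2 lerDl.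
  have g2 B' : (forall n, dist2 (picard n.+1).1 (picard n.+1).2 (picard n).1 (picard n).2 t <= B' / 2 ^+ n) ->
    exists l2, forall n, `|(picard n).2 t - l2| <= 2 * B' / 2 ^+ n.
    move=> hB'; apply: geometric_cvg => n; apply: le_trans (hB' n).
    by rewrite /dist2 lerDr.
  have [l1 h1] := g1 _ h; have [l2 h2] := g2 _ h.
  have uniq (u : nat -> R) l l' C C' : (forall n, `|u n - l| <= C / 2 ^+ n) ->
      (forall n, `|u n - l'| <= C' / 2 ^+ n) -> l = l'.
    move=> hl hl'; apply/eqP; rewrite -subr_eq0; apply/eqP.
    apply: (@norm_le_geometric0 _ (C + C')) => n.
    have -> : l - l' = (u n - l') - (u n - l) by ring.
    by apply: le_trans (ler_normB _ _) _; rewrite addrC mulrDl; apply: lerD.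
  exists (l1, l2) => _ n B' hB' /=.
  have [l1' h1'] := g1 _ hB'; have [l2' h2'] := g2 _ hB'.
  by rewrite (uniq _ _ _ _ _ h1 h1') (uniq _ _ _ _ _ h2 h2').
have [l hl] := choice ex.
have conv T : 0 <= T -> exists2 B, 0 <= B & forall n t, t <= T ->
    `|(picard n).1 t - (l (Num.max t 0)).1| <= B / 2 ^+ n /\
    `|(picard n).2 t - (l (Num.max t 0)).2| <= B / 2 ^+ n.
  move=> T0; have [B hB] := picard_dist T0.
  have B0 : 0 <= B.
    have := hB 0%N 0 (lexx _) T0; rewrite expr0 divr1; apply: le_trans.
    by rewrite /dist2 addr_ge0.
  exists (2 * B); first by rewrite mulr_ge0.
  move=> n t tT; have m0 : 0 <= Num.max t 0 by rewrite le_max lexx orbT.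
  have mT : Num.max t 0 <= T by rewrite ge_max tT.
  have e1 : (picard n).1 t = (picard n).1 (Num.max t 0).
    by case: (leP t 0) => // t0; have [-> _] := pic0 n t t0; have [-> _] := pic0 n 0 (lexx 0).
  have e2 : (picard n).2 t = (picard n).2 (Num.max t 0).
    by case: (leP t 0) => // t0; have [_ ->] := pic0 n t t0; have [_ ->] := pic0 n 0 (lexx 0).
  by rewrite e1 e2; apply: hl => // k; exact: hB.
have cont (p : R * R -> R) (u : nat -> R -> R) : (forall n, continuous (u n)) ->
   (forall T, 0 <= T -> exists2 B, 0 <= B & forall n t, t <= T ->
    `|u n t - p (l (Num.max t 0))| <= B / 2 ^+ n) -> continuous (fun t => p (l (Num.max t 0))).
  move=> cu hu r; apply/cvgrPdist_le => e e0.
  have [B B0 hB] := hu (`|r| + 1) (addr_ge0 (normr_ge0 _) ler01).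
  have e3 : 0 < e / 3 by lra.
  have [n hn] := le_geometric_small B e3.
  have n1 : \forall t \near r, `|u n r - u n t| <= e / 3.
    by have /cvgrPdist_le := cu n r; apply.
  near=> t.
  have h1 : `|u n r - u n t| <= e / 3 by near: t.
  have hr : r <= `|r| + 1 by have := ler_norm r; lra.
  have ht : t <= `|r| + 1.
    have : `|t - r| < 1.
      by near: t; exact: near_dist.
    by rewrite ltr_norml => /andP[_ h]; have := ler_norm r; lra.
  have h2 := le_trans (hB n r hr) hn; have h3 := le_trans (hB n t ht) hn.
  set P := p _ in h2 *; set Q := p _ in h3 *.
  have -> : P - Q = (u n t - Q) - (u n r - P) + (u n r - u n t) by ring.
  apply: le_trans (ler_normD _ _) _.
  have := ler_normB (u n t - Q) (u n r - P); lra.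
exists (fun t => (l (Num.max t 0)).1), (fun t => (l (Num.max t 0)).2); split.
- apply: (cont fst (fun n => (picard n).1)) => [n|T T0].
    by case: (picard_continuous n).
  by have [B B0 hB] := conv T T0; exists B => // n t tT; case: (hB n t tT).
- apply: (cont snd (fun n => (picard n).2)) => [n|T T0].
    by case: (picard_continuous n).
  by have [B B0 hB] := conv T T0; exists B => // n t tT; case: (hB n t tT).
move=> T T0; have [B B0 hB] := conv T T0; exists (B + B) => n t _ tT.
by have [h1 h2] := hB n t tT; rewrite mulrDl; exact: lerD.
Unshelve. all: by end_near. Qed.

Lemma picard_exists : exists x y, [/\ x 0 = x0, y 0 = y0,
  prim x (fun s => a s - c * clamped_field x y s) &
  prim y (fun s => b s - c * clamped_field y x s)].
Proof.
have [x [y [cx cy hxy]]] := picard_limit.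
have fix1 u v a0 z0 (p q : nat -> R -> R) : locbd a0 -> continuous u -> continuous v ->
   (forall n, continuous (p n)) -> (forall n, continuous (q n)) ->
   (forall n, p n.+1 = picard_map (p n) (q n) a0 z0) ->
   (forall T, 0 <= T -> exists B, forall n t, 0 <= t -> t <= T ->
      dist2 (p n) (q n) u v t <= B / 2 ^+ n) ->
   forall t, 0 <= t -> u t = picard_map u v a0 z0 t.
  move=> l0 cu cv cp cq hp hd t t0; have [B hB] := hd t t0.
  apply/eqP; rewrite -subr_eq0; apply/eqP.
  apply: (@norm_le_geometric0 _ (B / 2 + 4 * c * K t ^+ 2 * (B * t))) => n.
  have -> : u t - picard_map u v a0 z0 t =
    (p n.+1 t - picard_map u v a0 z0 t) - (p n.+1 t - u t) by ring.
  apply: le_trans (ler_normB _ _) _.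
  rewrite addrC mulrDl; apply: lerD.
    have -> : B / 2 / 2 ^+ n = B / 2 ^+ n.+1.
      by rewrite exprS; field; rewrite lt0r_neq0// expn2_gt0.
    by apply: le_trans (hB n.+1 t t0 (lexx t)); rewrite /dist2 lerDl.
  rewrite hp; apply: le_trans (picard_map_lip z0 l0 (cp n) (cq n) cu cv t0 (lexx t)) _.
  rewrite -(mulrA (4 * c * K t ^+ 2)); apply: ler_wpM2l; first by rewrite mulr_ge0 ?sqr_ge0// mulr_ge0.
  have ld : locbd (dist2 (p n) (q n) u v) by exact: dist2_locbd.
  have := @integ_le_cst _ _ 0 t (B / 2 ^+ n) ld (lexx 0) t0.
  rewrite (integ_le0 _ (lexx 0)) !subr0 mulrAC; apply => s s0 st.
  by apply: hB => //; exact: ltW.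
have p1 n : continuous (picard n).1 by case: (picard_continuous n).
have p2 n : continuous (picard n).2 by case: (picard_continuous n).
have ex := fix1 x y a x0 (fun n => (picard n).1) (fun n => (picard n).2) la cx cy p1 p2
  (fun=> erefl) hxy.
have ey : forall t, 0 <= t -> y t = picard_map y x b y0 t.
  apply: (fix1 y x b y0 (fun n => (picard n).2) (fun n => (picard n).1)) => // T T0.
  have [B hB] := hxy T T0; exists B => n t t0 tT; rewrite dist2C; exact: hB.
have px := picard_map_prim x0 la cx cy; have py := picard_map_prim y0 lb cy cx.
have cpx := prim_continuous px; have cpy := prim_continuous py.
(* The image of the limit, rather than the limit, is the witness: it is a primitive by construction,
   and both agree at nonnegative times, the only ones that [integ] sees. *)
exists (picard_map x y a x0), (picard_map y x b y0).
have cl u v u' v' s : u s = u' s -> v s = v' s -> clamped_field u v s = clamped_field u' v' s.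
  by rewrite /clamped_field => -> ->.
split.
- by rewrite /picard_map integ_le0// addr0.
- by rewrite /picard_map integ_le0// addr0.
- apply: prim_eq px _ _.
    apply: locbd_sub => //; apply: locbd_scale.
    exact: clamped_field_locbd.
  by move=> s s0; congr (_ - _ * _); apply: cl; [exact: ex|exact: ey].
- apply: prim_eq py _ _.
    apply: locbd_sub => //; apply: locbd_scale.
    exact: clamped_field_locbd.
  by move=> s s0; congr (_ - _ * _); apply: cl; [exact: ey|exact: ex].
Qed.
End Existence.

(** * The penalised system in coordinates: growth, existence, uniqueness *)

Section Solutions.
Context {R : realType}.
Implicit Types (a b f g x y : R -> R) (c r s t T C : R).

(** Here [c] stands for [1 / eps]. The same system with [c = 1] and zero controls is the gradient
    flow that defines [phi_d], so both are treated together. *)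
Definition sol c a b x y :=
  prim x (fun s => a s - c * (2 * x s * y s ^+ 2)) /\
  prim y (fun s => b s - c * (2 * y s * x s ^+ 2)).

Lemma sol_sym c a b x y : sol c a b x y -> sol c b a y x.
Proof. by case. Qed.

Lemma locbd_cubic x y : continuous x -> continuous y ->
  locbd (fun s => 2 * x s * y s ^+ 2).
Proof.
move=> /locbd_continuous lx /locbd_continuous ly.
apply: (@locbd_mul _ (fun s => 2 * x s) (fun s => y s ^+ 2)).
  exact: locbd_scale.
have -> : (fun s => y s ^+ 2) = (fun s => y s * y s) by apply/funext => s; rewrite expr2.
exact: locbd_mul.
Qed.

(** Barrier for [x t - t] at the level [|x 0|]: above it [x] is nonnegative, hence so is [g], and
    [a - g - 1 <= 0]. *)
Lemma prim_growth_le x a g t : prim x (fun s => a s - g s) -> (forall s, a s <= 1) ->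
  (forall s, 0 <= s -> 0 <= x s -> 0 <= g s) -> 0 <= t -> x t <= `|x 0| + t.
Proof.
move=> px a1 xg t0.
have pz := prim_sub px prim_id.
have := @prim_barrier _ _ _ `|x 0| 0 t pz (lexx 0) t0.
rewrite (max_idPl t0) mul0r maxxx !subr0 => h.
suff: x t - t <= Num.max `|x 0| (x 0).
  by rewrite (max_idPl (ler_norm _)) lerBlDr.
apply: h => s s0 st; rewrite (max_idPl (ltW s0)) oppr0 => h.
have x0 : 0 <= x s by have := normr_ge0 (x 0); lra.
by have := xg s (ltW s0) x0; have := a1 s; lra.
Qed.

Lemma prim_growth x a g t : prim x (fun s => a s - g s) -> (forall s, `|a s| <= 1) ->
  (forall s, 0 <= s -> 0 <= x s -> 0 <= g s) ->
  (forall s, 0 <= s -> x s <= 0 -> g s <= 0) -> 0 <= t -> `|x t| <= `|x 0| + t.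
Proof.
move=> px a1 xg1 xg2 t0; rewrite ler_norml; apply/andP; split; last first.
  by apply: prim_growth_le px _ xg1 t0 => s; apply: le_trans (ler_norm _) (a1 s).
have pn : prim (fun s => - x s) (fun s => - a s - - g s).
  by apply: prim_ext (prim_scale (-1) px) _ _ => s; ring.
rewrite lerNl -[in leRHS]normrN.
apply: (prim_growth_le pn) => // [s|s s0].
  by apply: le_trans (ler_norm _) _; rewrite normrN.
by rewrite oppr_ge0 oppr_ge0 => /xg2; exact.
Qed.

Lemma sol_bound c a b x y t : sol c a b x y -> 0 <= c -> (forall s, `|a s| <= 1) ->
  (forall s, `|b s| <= 1) -> 0 <= t -> `|x t| <= `|x 0| + t /\ `|y t| <= `|y 0| + t.
Proof.
move=> [px py] c0 a1 b1 t0; split.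
  apply: prim_growth px a1 _ _ t0 => s s0 xs.
    by rewrite mulr_ge0 // mulr_ge0 ?sqr_ge0// mulr_ge0.
  by rewrite mulr_ge0_le0// mulr_le0_ge0 ?sqr_ge0// mulr_ge0_le0.
apply: prim_growth py b1 _ _ t0 => s s0 xs.
  by rewrite mulr_ge0 // mulr_ge0 ?sqr_ge0// mulr_ge0.
by rewrite mulr_ge0_le0// mulr_le0_ge0 ?sqr_ge0// mulr_ge0_le0.
Qed.

(** Clamping preserves signs, so the growth bound already holds for the solution of the clamped
    system, which therefore never feels the clamp. *)
Lemma sol_exists c a b (x0 y0 : R) : locbd a -> locbd b -> 0 <= c ->
  (forall s, `|a s| <= 1) -> (forall s, `|b s| <= 1) ->
  exists x y, [/\ sol c a b x y, x 0 = x0 & y 0 = y0].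
Proof.
move=> la lb c0 a1 b1.
have [x [y [xE yE px py]]] := picard_exists x0 y0 la lb c0.
have sgn u v s : 0 <= u s -> 0 <= c * clamped_field x0 y0 u v s.
  move=> us; rewrite mulr_ge0// mulr_ge0 ?sqr_ge0// mulr_ge0//.
  by rewrite clamp_sign// !addr_ge0.
have sgnN u v s : u s <= 0 -> c * clamped_field x0 y0 u v s <= 0.
  move=> us; rewrite mulr_ge0_le0// mulr_le0_ge0 ?sqr_ge0// mulr_ge0_le0//.
  by rewrite -oppr_ge0 -clampN ?clamp_sign ?oppr_ge0// !addr_ge0.
have bx t : 0 <= t -> `|x t| <= `|x0| + t.
  move=> t0; rewrite -xE.
  by apply: prim_growth px a1 _ _ t0 => s _; [exact: sgn|exact: sgnN].
have by_ t : 0 <= t -> `|y t| <= `|y0| + t.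
  move=> t0; rewrite -yE.
  by apply: prim_growth py b1 _ _ t0 => s _; [exact: sgn|exact: sgnN].
have cx := prim_continuous px; have cy := prim_continuous py.
have cl s : 0 <= s -> clamp (`|x0| + `|y0| + `|s| + 1) (x s) = x s /\
    clamp (`|x0| + `|y0| + `|s| + 1) (y s) = y s.
  move=> s0; have := bx s s0; have := by_ s s0.
  have := normr_ge0 x0; have := normr_ge0 y0 => h1 h2 h3 h4.
  by rewrite (ger0_norm s0); split; apply: clamp_id; lra.
exists x, y; split => //; split.
  apply: prim_eq px _ _; first exact/locbd_sub/locbd_scale/locbd_cubic.
  by move=> s s0; rewrite /clamped_field; have [-> ->] := cl s s0.
apply: prim_eq py _ _; first exact/locbd_sub/locbd_scale/locbd_cubic.
by move=> s s0; rewrite /clamped_field; have [-> ->] := cl s s0.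
Qed.

(** Gronwall's argument by iteration: on a bounded interval the field is Lipschitz along both
    solutions, and each use of the integral inequality halves the weighted bound on their
    distance. *)
Lemma sol_unique c a b x y x' y' : 0 <= c -> sol c a b x y -> sol c a b x' y' ->
  x 0 = x' 0 -> y 0 = y' 0 -> x =1 x' /\ y =1 y'.
Proof.
move=> c0 [px py] [px' py'] ex0 ey0.
have cx := prim_continuous px; have cy := prim_continuous py.
have cx' := prim_continuous px'; have cy' := prim_continuous py'.
have ld : locbd (dist2 x y x' y') by exact: dist2_locbd.
suff D0 t : 0 <= t -> dist2 x y x' y' t = 0.
  have key t : 0 <= t -> x t = x' t /\ y t = y' t.
    move=> /D0; rewrite /dist2 => /eqP; rewrite paddr_eq0// !normr_eq0 !subr_eq0.
    by move=> /andP[/eqP -> /eqP ->].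
  split=> t; case: (leP 0 t) => [/key[]//|/ltW t0].
    by rewrite (prim_le0 px t0) (prim_le0 px' t0).
  by rewrite (prim_le0 py t0) (prim_le0 py' t0).
move=> T0; move: t T0 => T T0.
have [K1 K10 h1] := locbd_bound T (locbd_continuous cx).
have [K2 K20 h2] := locbd_bound T (locbd_continuous cy).
have [K3 K30 h3] := locbd_bound T (locbd_continuous cx').
have [K4 K40 h4] := locbd_bound T (locbd_continuous cy').
pose K := K1 + K2 + K3 + K4.
have K0 : 0 <= K by rewrite /K; lra.
pose L := 16 * c * K ^+ 2 + 1.
have L0 : 0 < L by rewrite /L ltr_wpDl// mulr_ge0 ?sqr_ge0// mulr_ge0.
have step t : 0 <= t -> t <= T -> dist2 x y x' y' t <= 8 * c * K ^+ 2 * integ (dist2 x y x' y') t.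
  move=> t0 tT.
  have half u v u' v' a0 : u 0 = u' 0 -> dist2 u v u' v' = dist2 x y x' y' ->
    (forall s, `|s| <= T -> [/\ `|u s| <= K, `|v s| <= K, `|u' s| <= K & `|v' s| <= K]) ->
    prim u (fun s => a0 s - c * (2 * u s * v s ^+ 2)) ->
    prim u' (fun s => a0 s - c * (2 * u' s * v' s ^+ 2)) ->
    `|u t - u' t| <= 4 * c * K ^+ 2 * integ (dist2 x y x' y') t.
    move=> e0 ed bd pu pu'.
    have pd := prim_sub pu pu'.
    have := primE t pd; rewrite /= e0 subrr add0r => ->.
    have ls := locbd_scale (4 * c * K ^+ 2) ld.
    have bnd s : 0 <= s -> s <= t ->
        `|a0 s - c * (2 * u s * v s ^+ 2) - (a0 s - c * (2 * u' s * v' s ^+ 2))| <=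
        4 * c * K ^+ 2 * dist2 x y x' y' s.
      move=> s0 st.
      have -> : a0 s - c * (2 * u s * v s ^+ 2) - (a0 s - c * (2 * u' s * v' s ^+ 2)) =
        - (c * (2 * u s * v s ^+ 2 - 2 * u' s * v' s ^+ 2)) by ring.
      rewrite normrN normrM (ger0_norm c0).
      have -> : 4 * c * K ^+ 2 * dist2 x y x' y' s =
        c * (4 * K ^+ 2 * dist2 x y x' y' s) by ring.
      apply: ler_wpM2l => //; rewrite -ed.
      have [] := bd s; first by rewrite ger0_norm//; exact: le_trans tT.
      by move=> ? ? ? ?; exact: cubic_lip.
    rewrite -integ_scale// ler_norml; apply/andP; split.
      rewrite -mulN1r -integ_scale//; apply: le_integ => //.
      - exact: locbd_scale.
      - exact: prim_locbd pd.
      - by move=> s s0 st; have := bnd s s0 st; rewrite ler_norml => /andP[]; rewrite mulN1r.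
    apply: le_integ => //; first exact: prim_locbd pd.
    by move=> s s0 st; have := bnd s s0 st; rewrite ler_norml => /andP[].
  have bd s : `|s| <= T -> [/\ `|x s| <= K, `|y s| <= K, `|x' s| <= K & `|y' s| <= K].
    move=> sT; have := h1 s sT; have := h2 s sT; have := h3 s sT; have := h4 s sT.
    by rewrite /K => *; split; lra.
  have d1 := half x y x' y' a ex0 erefl bd px px'.
  have d2 := half y x y' x' b ey0 (dist2C _ _ _ _) (fun s h => let: And4 p q p' q' := bd s h in And4 q p q' p') py py'.
  rewrite /dist2 -/(dist2 x y x' y'); lra.
have [C C0 dC] := locbd_bound T ld.
have key n t : 0 <= t -> t <= T -> dist2 x y x' y' t <= C / 2 ^+ n * expR (L * t).
  elim: n t => [|n IH] t t0 tT.
    rewrite expr0 divr1; apply: (@le_trans _ _ C).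
      by apply: le_trans (ler_norm _) _; apply: dC; rewrite ger0_norm.
    by rewrite ler_peMr ?(ltW C0)// -[leLHS]expR0 ler_expR mulr_ge0// ltW.
  have h5 : integ (dist2 x y x' y') t <= C / 2 ^+ n / L * expR (L * t).
    apply: integ_expR_le => // [s s0 st|].
      by apply: IH => //; exact: le_trans st tT.
    by rewrite divr_ge0// ltW// expn2_gt0.
  apply: le_trans (step t t0 tT) _.
  apply: (@le_trans _ _ (8 * c * K ^+ 2 * (C / 2 ^+ n / L * expR (L * t)))).
    by apply: ler_wpM2l => //; rewrite mulr_ge0 ?sqr_ge0// mulr_ge0.
  rewrite picard_const ?lt0r_neq0// ?expn2_gt0//.
  apply: ler_piMl; first by rewrite mulr_ge0 ?expR_ge0// divr_ge0// ltW// expn2_gt0.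
  by rewrite ler_pdivrMr// mul1r /L lerDl.
apply: (@norm_le_geometric0 _ (C * expR (L * T))) => n.
rewrite ger0_norm ?addr_ge0// mulrAC; exact: key.
Qed.
End Solutions.

(** * Representatives of controls, and trajectories in coordinates *)

Section Trajectories.
Context {R : realType}.
Implicit Types (a X : R -> R * R) (b u v : R -> R) (r s t T C c eps : R).
Notation mu := (@lebesgue_measure R).

Lemma grad_dfun (p : R * R) : grad (@dfun R) p = (2 * p.1 * p.2 ^+ 2, 2 * p.2 * p.1 ^+ 2).
Proof.
have C (z k : R) : (h + 2 * z) * k @[h --> (0 : R)^'] --> 2 * z * k.
  apply: cvg_within_filter.
  have -> : 2 * z * k = (0 + 2 * z) * k by rewrite add0r.
  by apply: cvgM; [apply: cvgD; [exact: cvg_id|exact: cvg_cst]|exact: cvg_cst].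
rewrite /grad; congr (_, _); apply: cvg_lim => //.
  apply: cvg_trans (C p.1 (p.2 ^+ 2)); apply: near_eq_cvg; near=> h.
  have h0 : h != 0 by near: h; exact: nbhs_dnbhs_neq.
  by rewrite /dfun /= /GRing.scale /= mulr1 mulr0 add0r; field.
apply: cvg_trans (C p.2 (p.1 ^+ 2)); apply: near_eq_cvg; near=> h.
have h0 : h != 0 by near: h; exact: nbhs_dnbhs_neq.
by rewrite /dfun /= /GRing.scale /= mulr1 mulr0 add0r; field.
Unshelve. all: by end_near. Qed.

(** A representative bounded everywhere and measurable on the whole line. Null sets are dealt with
    once, in [control_repr] and [int0_repr], and every later estimate is pointwise. *)
Definition unit_control b1 b2 :=
  [/\ locbd b1, locbd b2 & forall s, b1 s ^+ 2 + b2 s ^+ 2 <= 1].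

Definition ae_repr a b1 b2 := {ae mu, forall s, halfline s -> a s = (b1 s, b2 s)}.

Lemma measurable_halfline : measurable (@halfline R).
Proof. exact: measurable_itv. Qed.

(** On the half-line, setting the control to 0 where its norm exceeds 1 changes it on a null set
    only. *)
Lemma control_repr a : controls a -> exists b1 b2, unit_control b1 b2 /\ ae_repr a b1 b2.
Proof.
move=> [ma na].
have m1 : measurable_fun (@halfline R) (fun s => (a s).1) by exact: measurableT_comp ma.
have m2 : measurable_fun (@halfline R) (fun s => (a s).2) by exact: measurableT_comp ma.
pose r1 := (fun s => (a s).1) \_ (@halfline R).
pose r2 := (fun s => (a s).2) \_ (@halfline R).
have [mr1 _] := measurable_restrictT (fun s => (a s).1) measurable_halfline; have {}mr1 : measurable_fun setT r1 := mr1 m1.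
have [mr2 _] := measurable_restrictT (fun s => (a s).2) measurable_halfline; have {}mr2 : measurable_fun setT r2 := mr2 m2.
pose p s := r1 s ^+ 2 + r2 s ^+ 2 <= 1.
have mp : measurable_fun setT p.
  apply: measurable_fun_ler; last exact: measurable_cst.
  by apply: measurable_funD; exact: measurable_funX.
pose b1 s := if p s then r1 s else 0; pose b2 s := if p s then r2 s else 0.
have mb1 : measurable_fun setT b1 by apply: measurable_fun_ifT => //; exact: measurable_cst.
have mb2 : measurable_fun setT b2 by apply: measurable_fun_ifT => //; exact: measurable_cst.
have nb s : b1 s ^+ 2 + b2 s ^+ 2 <= 1.
  by rewrite /b1 /b2; case: ifP => //; rewrite !expr0n/= addr0 ler01.
have nb1 s : `|b1 s| <= 1.
  have := nb s; have := sqr_ge0 (b2 s); have := normr_ge0 (b1 s).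
  by rewrite -(real_normK (num_real (b1 s))); nra.
have nb2 s : `|b2 s| <= 1.
  have := nb s; have := sqr_ge0 (b1 s); have := normr_ge0 (b2 s).
  by rewrite -(real_normK (num_real (b2 s))); nra.
exists b1, b2; split.
  by split=> //; split => // T; exists 1.
case: na => N [mN N0 subN]; exists N; split => // s /= h; apply: subN => /= h'.
apply: h => hs; have := h' hs; rewrite /enorm => h1.
have e1 : r1 s = (a s).1 by rewrite /r1 patchE mem_set.
have e2 : r2 s = (a s).2 by rewrite /r2 patchE mem_set.
have ps : p s.
  rewrite /p e1 e2.
  have S0 : 0 <= (a s).1 ^+ 2 + (a s).2 ^+ 2 by rewrite addr_ge0 ?sqr_ge0.
  by rewrite -(sqr_sqrtr S0) exprn_ile1// sqrtr_ge0.
by rewrite /b1 /b2 ps e1 e2; case: (a s).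
Qed.

Lemma unit_control_bound b1 b2 : unit_control b1 b2 ->
  (forall s, `|b1 s| <= 1) /\ (forall s, `|b2 s| <= 1).
Proof.
move=> [_ _ nb]; split=> s.
  have := nb s; have := sqr_ge0 (b2 s); have := normr_ge0 (b1 s).
  by rewrite -(real_normK (num_real (b1 s))); nra.
have := nb s; have := sqr_ge0 (b1 s); have := normr_ge0 (b2 s).
by rewrite -(real_normK (num_real (b2 s))); nra.
Qed.

Lemma unit_control_controls b1 b2 : unit_control b1 b2 ->
  controls (fun s => (b1 s, b2 s)).
Proof.
move=> [[m1 _] [m2 _] nb]; split.
  by apply: measurable_funTS; exact: measurable_fun_pair.
apply: aeW => s _; rewrite /enorm /= -sqrtr1; exact: ler_wsqrtr.
Qed.

Lemma int0_repr a b1 b2 t (g : R -> R * R) : measurable_fun (@halfline R) a ->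
  unit_control b1 b2 -> ae_repr a b1 b2 ->
  locbd (fun s => (g s).1) -> locbd (fun s => (g s).2) ->
  int0 t (fun s => a s - g s) = (integ (fun s => b1 s - (g s).1) t, integ (fun s => b2 s - (g s).2) t).
Proof.
move=> ma [l1 l2 _] ab lg1 lg2.
have m1 : measurable_fun (@halfline R) (fun s => (a s).1) by exact: measurableT_comp ma.
have m2 : measurable_fun (@halfline R) (fun s => (a s).2) by exact: measurableT_comp ma.
rewrite /int0; congr pair.
  apply: (@eq_integ_ae R (fun s => (a s - g s).1)).
  - by apply: measurable_funB => //; apply: measurable_funTS; case: lg1.
  - by apply: measurable_funTS; case: (locbd_sub l1 lg1).
  - case: ab => N [mN N0 subN]; exists N; split => // s /= h; apply: subN => /= h'.
    by apply: h => /h' ->.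
apply: (@eq_integ_ae R (fun s => (a s - g s).2)).
- by apply: measurable_funB => //; apply: measurable_funTS; case: lg2.
- by apply: measurable_funTS; case: (locbd_sub l2 lg2).
- case: ab => N [mN N0 subN]; exists N; split => // s /= h; apply: subN => /= h'.
  by apply: h => /h' ->.
Qed.

Lemma eq_int0 t (g h : R -> R * R) : (forall s, 0 <= s -> s <= t -> g s = h s) ->
  int0 t g = int0 t h.
Proof.
move=> gh; rewrite /int0; congr pair; apply: eq_Rintegral => s;
  by rewrite inE/= in_itv/= => /andP[s0 st]; rewrite gh.
Qed.

Lemma int0_field a b1 b2 t c u v : measurable_fun (@halfline R) a ->
  unit_control b1 b2 -> ae_repr a b1 b2 -> continuous u -> continuous v ->
  int0 t (fun s => a s - c *: grad (@dfun R) (u s, v s)) =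
  (integ (fun s => b1 s - c * (2 * u s * v s ^+ 2)) t,
   integ (fun s => b2 s - c * (2 * v s * u s ^+ 2)) t).
Proof.
move=> ma ub ab cu cv; have lf1 := locbd_scale c (locbd_cubic cu cv).
have lf2 := locbd_scale c (locbd_cubic cv cu).
rewrite (eq_int0 (h := fun s => a s - (c * (2 * u s * v s ^+ 2), c * (2 * v s * u s ^+ 2)))).
  exact: (int0_repr t (g := fun s => (c * (2 * u s * v s ^+ 2), c * (2 * v s * u s ^+ 2)))).
by move=> s _ _; rewrite grad_dfun.
Qed.

(** Composition with [Num.max t 0] turns continuity on the closed half-line into global continuity,
    and gives the constant extension to negative times that [prim] demands. *)
Lemma within_extend X : {within `[0, +oo[, continuous X} ->
  continuous (fun t => X (Num.max t 0)).
Proof.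
move=> /subspace_continuousP cX t.
have m0 : 0 <= Num.max t 0 by rewrite le_max lexx orbT.
have cmax : (fun s => Num.max s 0) s @[s --> t] --> within `[0, +oo[ (nbhs (Num.max t 0)).
  move=> B; rewrite /within /= => nB.
  have cm : {for t, continuous (fun s : R => Num.max s 0)}.
    by apply: (@continuous_max _ _ id (fun=> 0)); [exact: cvg_id|exact: cvg_cst].
  have h := cm _ nB; change (nbhs t (fun s : R => B (Num.max s 0))).
  change (nbhs t (fun s : R => `[0, +oo[%classic (Num.max s 0) -> B (Num.max s 0))) in h.
  apply: filterS h => s; apply.
  by rewrite /= in_itv/= andbT le_max lexx orbT.
by apply: cvg_comp cmax _; apply: cX; rewrite /= in_itv/= andbT.
Qed.

Lemma is_traj_sol eps x a X b1 b2 : controls a -> unit_control b1 b2 -> ae_repr a b1 b2 ->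
  is_traj eps x a X ->
  exists u v, [/\ sol eps^-1 b1 b2 u v, u 0 = x.1, v 0 = x.2 &
    forall t, 0 <= t -> X t = (u t, v t)].
Proof.
move=> [ma _] ub ab [cX XE].
have cX' := within_extend cX.
pose u t := (X (Num.max t 0)).1; pose v t := (X (Num.max t 0)).2.
have cu : continuous u.
  by move=> t; apply: (@continuous_comp _ _ _ (fun t => X (Num.max t 0)) fst);
    [exact: cX'|exact: cvg_fst].
have cv : continuous v.
  by move=> t; apply: (@continuous_comp _ _ _ (fun t => X (Num.max t 0)) snd);
    [exact: cX'|exact: cvg_snd].
have key t : 0 <= t -> X t = x + (integ (fun s => b1 s - eps^-1 * (2 * u s * v s ^+ 2)) t,
   integ (fun s => b2 s - eps^-1 * (2 * v s * u s ^+ 2)) t).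
  move=> t0; rewrite -(int0_field t eps^-1 ma ub ab cu cv) (XE t t0).
  have e s : 0 <= s -> s <= t -> a s - eps^-1 *: grad (@dfun R) (X s) =
      a s - eps^-1 *: grad (@dfun R) (u s, v s).
    by move=> s0 _; rewrite /u /v (max_idPl s0) -surjective_pairing.
  by rewrite (eq_int0 e).
have X0 : X 0 = x by rewrite key// !integ_le0// addr0.
have [l1 l2 _] := ub.
exists u, v; split; rewrite /u /v ?maxxx ?X0//; last first.
  by move=> t t0; rewrite (max_idPl t0); case: (X t).
split; split.
- exact/locbd_sub/locbd_scale/locbd_cubic.
- move=> t; rewrite -integ_max -/u maxxx X0.
  by rewrite key//; rewrite le_max lexx orbT.
- exact/locbd_sub/locbd_scale/locbd_cubic.
- move=> t; rewrite -integ_max -/u maxxx X0.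
  by rewrite key//; rewrite le_max lexx orbT.
Qed.

Lemma sol_is_traj eps a b1 b2 u v : controls a -> unit_control b1 b2 -> ae_repr a b1 b2 ->
  sol eps^-1 b1 b2 u v -> is_traj eps (u 0, v 0) a (fun t => (u t, v t)).
Proof.
move=> [ma _] ub ab [pu pv].
have cu := prim_continuous pu; have cv := prim_continuous pv.
split.
  apply: continuous_subspaceT => t; exact: cvg_pair (cu t) (cv t).
move=> t t0; rewrite (int0_field t eps^-1 ma ub ab cu cv).
by rewrite (primE t pu) (primE t pv).
Qed.

(** Existence ensures that the [xget] in [traj] returns a genuine trajectory and not its default
    value. *)
Lemma traj_sol eps x a b1 b2 : 0 <= eps -> controls a -> unit_control b1 b2 ->
  ae_repr a b1 b2 -> exists u v, [/\ sol eps^-1 b1 b2 u v, u 0 = x.1, v 0 = x.2 &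
    forall t, 0 <= t -> traj eps x a t = (u t, v t)].
Proof.
move=> e0 ca ub ab; have [h1 h2] := unit_control_bound ub.
have c0 : 0 <= eps^-1 by rewrite invr_ge0.
have [l1 l2 _] := ub.
have [u [v [huv ux vx]]] := sol_exists x.1 x.2 l1 l2 c0 h1 h2.
have ex : is_traj eps x a (fun t => (u t, v t)).
  by have := sol_is_traj ca ub ab huv; rewrite ux vx; case: (x).
have T : is_traj eps x a (traj eps x a) by apply: xgetPex; exists (fun t => (u t, v t)).
exact: is_traj_sol T.
Qed.

Lemma sol_traj eps a b1 b2 u v t : 0 <= eps -> controls a -> unit_control b1 b2 ->
  ae_repr a b1 b2 -> sol eps^-1 b1 b2 u v -> 0 <= t ->
  traj eps (u 0, v 0) a t = (u t, v t).
Proof.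
move=> e0 ca ub ab huv t0.
have [u' [v' [huv' ux vx ->//]]] := traj_sol (u 0, v 0) e0 ca ub ab.
have c0 : 0 <= eps^-1 by rewrite invr_ge0.
by have [-> ->] := sol_unique c0 huv' huv ux vx.
Qed.

Lemma free_trajE x a b1 b2 t : controls a -> unit_control b1 b2 -> ae_repr a b1 b2 ->
  free_traj x a t = (x.1 + integ b1 t, x.2 + integ b2 t).
Proof.
move=> [ma _] ub ab; rewrite /free_traj.
have e0 : int0 t a = int0 t (fun s => a s - 0) by apply: eq_int0 => s _ _; rewrite subr0.
rewrite e0 (@int0_repr a b1 b2 t (fun=> 0) ma ub ab (locbd_cst 0) (locbd_cst 0)).
have e b : integ (fun s => b s - 0) t = integ b t by apply: eq_integ => s _ _; rewrite subr0.
by rewrite /= !e; case: (x).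
Qed.
End Trajectories.

(** * Estimates along penalised trajectories *)

Section Estimates.
Context {R : realType}.
Implicit Types (a b f g x y : R -> R) (c r s t T C sigma nu : R).

Lemma sol_hyp c a b x y : sol c a b x y ->
  prim (fun t => x t ^+ 2 - y t ^+ 2) (fun s => 2 * (x s * a s - y s * b s)).
Proof.
move=> [px py]; apply: prim_ext (prim_sub (prim_sq px) (prim_sq py)) _ _ => s //=.
by ring.
Qed.

Lemma sol_prod c a b x y : sol c a b x y ->
  prim (fun t => x t ^+ 2 * y t ^+ 2) (fun s => 2 * (x s * y s) * (a s * y s + b s * x s) -
    4 * c * (x s * y s) ^+ 2 * (x s ^+ 2 + y s ^+ 2)).
Proof.
move=> [px py]; apply: prim_ext (prim_mul (prim_sq px) (prim_sq py)) _ _ => s //=.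
by ring.
Qed.

(** Put [p = |x y|] and [S = |x| + |y|]. The control contributes at most [2 p nu S] and the
    penalisation at least [2 c p^2 S^2], so the rate is at most [2 (p S) (nu - c p S)]. Since
    [S^2 >= 4 p], one has [p S >= 2 sigma^3], and [nu <= c sigma^3] gives the claim. *)
Lemma prod_rate c sigma nu (a b x y : R) : 0 <= c -> 0 < sigma -> nu <= c * sigma ^+ 3 ->
  `|a| <= nu -> `|b| <= nu -> sigma ^+ 4 < x ^+ 2 * y ^+ 2 ->
  2 * (x * y) * (a * y + b * x) - 4 * c * (x * y) ^+ 2 * (x ^+ 2 + y ^+ 2) <=
    - (4 * c * sigma ^+ 6).
Proof.
move=> c0 s0 nuc a1 b1 q.
have nu0 : 0 <= nu := le_trans (normr_ge0 _) a1.
pose p := `|x| * `|y|; pose S := `|x| + `|y|.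
have p0 : 0 <= p by rewrite /p mulr_ge0.
have p2 : p ^+ 2 = x ^+ 2 * y ^+ 2 by rewrite /p exprMn !real_normK ?num_real.
have psig : sigma ^+ 2 < p.
  rewrite -(@ltr_pXn2r _ 2) ?nnegrE ?sqr_ge0// p2.
  by apply: le_lt_trans q; rewrite -exprM.
have S0 : 0 <= S by rewrite /S addr_ge0.
have S4 : 4 * p <= S ^+ 2.
  by have := sqr_ge0 (`|x| - `|y|); rewrite /p /S; nra.
have Ssig : 2 * sigma <= S.
  rewrite -(@ler_pXn2r _ 2) ?nnegrE ?mulr_ge0 ?(ltW s0)//.
  by apply: le_trans S4; rewrite exprMn; nra.
have S2 : S ^+ 2 <= 2 * (x ^+ 2 + y ^+ 2).
  have := sqr_ge0 (`|x| - `|y|); rewrite /S -(real_normK (num_real x)) -(real_normK (num_real y)); nra.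
have lin : 2 * (x * y) * (a * y + b * x) <= 2 * p * (nu * S).
  apply: le_trans (ler_norm _) _; rewrite !normrM (ger0_norm (_ : 0 <= 2))//.
  rewrite -/p -mulrA -[leRHS]mulrA; apply: ler_wpM2l => //; apply: ler_wpM2l => //.
  apply: le_trans (ler_normD _ _) _; rewrite !normrM /S mulrDr addrC.
  by apply: lerD; apply: ler_wpM2r.
have quad : 2 * c * p ^+ 2 * S ^+ 2 <= 4 * c * (x * y) ^+ 2 * (x ^+ 2 + y ^+ 2).
  rewrite [(x * y) ^+ 2]exprMn -p2.
  have -> : 4 * c * p ^+ 2 * (x ^+ 2 + y ^+ 2) = 2 * c * p ^+ 2 * (2 * (x ^+ 2 + y ^+ 2)) by ring.
  by apply: ler_wpM2l => //; rewrite !mulr_ge0 ?sqr_ge0.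
have pS : 2 * sigma ^+ 3 <= p * S.
  have -> : 2 * sigma ^+ 3 = sigma ^+ 2 * (2 * sigma) by ring.
  by apply: ler_pM => //; rewrite ?mulr_ge0 ?sqr_ge0 ?ltW.
have s3 : 0 < sigma ^+ 3 by rewrite exprn_gt0.
have key : 2 * p * (nu * S) - 2 * c * p ^+ 2 * S ^+ 2 <= - (4 * c * sigma ^+ 6).
  have -> : 2 * p * (nu * S) - 2 * c * p ^+ 2 * S ^+ 2 = 2 * (p * S) * (nu - c * (p * S)) by ring.
  have -> : 4 * c * sigma ^+ 6 = 4 * c * (sigma ^+ 3 * sigma ^+ 3) by ring.
  move: (p * S) (sigma ^+ 3) pS s3 nuc => z w h1 h2 h3.
  have h4 : nu - c * z <= - (c * w) by have : c * (2 * w) <= c * z by [apply: ler_wpM2l]; lra.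
  have h5 : 0 <= c * w by rewrite mulr_ge0// ltW.
  have : 4 * w * (c * w) <= 2 * z * (c * z - nu) by apply: ler_pM; lra.
  lra.
lra.
Qed.

(** [nu] is 1 for controlled trajectories and 0 for the gradient flow; in the latter case [sigma]
    may be any positive number, however small. *)
Lemma sol_prod_decay c sigma nu a b x y t : 0 <= c -> 0 < sigma ->
  nu <= c * sigma ^+ 3 -> (forall s, `|a s| <= nu) -> (forall s, `|b s| <= nu) ->
  sol c a b x y -> 0 <= t ->
  x t ^+ 2 * y t ^+ 2 <= Num.max (sigma ^+ 4) (x 0 ^+ 2 * y 0 ^+ 2 - 4 * c * sigma ^+ 6 * t).
Proof.
move=> c0 s0 nuc a1 b1 h t0.
apply: (prim_barrier (sol_prod h)) => //.
  by apply: mulr_ge0; [exact: mulr_ge0|rewrite exprn_ge0// ltW].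
by move=> s _ _ /=; exact: (prod_rate c0 s0 nuc (a1 s) (b1 s)).
Qed.

(** [Num.sqrt] is 0 on negative numbers, so each root is that of a positive part. *)
Definition proj (p : R * R) : R * R :=
  (Num.sg p.1 * Num.sqrt (p.1 ^+ 2 - p.2 ^+ 2), Num.sg p.2 * Num.sqrt (p.2 ^+ 2 - p.1 ^+ 2)).

Lemma proj_Gamma p : Gamma (proj p).
Proof.
rewrite /Gamma /proj /=; have [h|h] := leP (p.1 ^+ 2) (p.2 ^+ 2).
  by rewrite ler0_sqrtr ?subr_le0// mulr0 mul0r.
by rewrite (@ler0_sqrtr _ (p.2 ^+ 2 - _)) ?mulr0// subr_le0 ltW.
Qed.

Lemma proj_id p : Gamma p -> proj p = p.
Proof.
rewrite /Gamma /= /proj => /eqP; rewrite mulf_eq0.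
case: p => x y /= /orP[] /eqP ->; rewrite ?sgr0 expr0n/= ?mul0r ?subr0 sqrtr_sqr.
  by rewrite -numEsg.
by rewrite -numEsg.
Qed.

Lemma sqrt_sub_close (x y : R) : 0 <= y -> y <= x -> `|x - Num.sqrt (x ^+ 2 - y ^+ 2)| <= y.
Proof.
move=> y0 yx; have S0 : 0 <= x ^+ 2 - y ^+ 2 by nra.
have := sqr_sqrtr S0; have := sqrtr_ge0 (x ^+ 2 - y ^+ 2).
move: (Num.sqrt _) => w w0 wE; rewrite ler_norml; apply/andP; split; last by nra.
by nra.
Qed.

(** The smaller of [|x|] and [|y|] is at most [sigma]. If it is [|x|], the root vanishes; otherwise
    the root differs from [|x|] by at most [|y|]. *)
Lemma sg_sqrt_close (sigma x y : R) : 0 <= sigma -> x ^+ 2 * y ^+ 2 <= sigma ^+ 4 ->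
  `|x - Num.sg x * Num.sqrt (x ^+ 2 - y ^+ 2)| <= sigma.
Proof.
move=> s0 xy.
have E : `|x| * `|y| <= sigma ^+ 2.
  rewrite -(@ler_pXn2r _ 2) ?nnegrE ?mulr_ge0 ?sqr_ge0//.
  by rewrite exprMn !real_normK ?num_real// -exprM.
have small (z w : R) : 0 <= z -> z <= w -> z * w <= sigma ^+ 2 -> z <= sigma.
  move=> z0 zw zws; rewrite -(@ler_pXn2r _ 2) ?nnegrE//.
  by apply: le_trans zws; rewrite expr2; apply: ler_wpM2l.
rewrite -(real_normK (num_real x)) -(real_normK (num_real y)).
have [h|h] := leP (`|x|) (`|y|).
  rewrite ler0_sqrtr ?mulr0 ?subr0; last by rewrite subr_le0 ler_sqr ?nnegrE.
  exact: (small _ _ (normr_ge0 x) h E).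
have x0 : x != 0 by rewrite -normr_gt0; exact: le_lt_trans h.
have -> : x - Num.sg x * Num.sqrt (`|x| ^+ 2 - `|y| ^+ 2) =
    Num.sg x * (`|x| - Num.sqrt (`|x| ^+ 2 - `|y| ^+ 2)).
  by rewrite mulrBr -numEsg.
rewrite normrM normr_sg x0 mul1r; apply: le_trans (sqrt_sub_close (normr_ge0 y) (ltW h)) _.
by apply: (small _ _ (normr_ge0 y) (ltW h)); rewrite mulrC.
Qed.

(* A C^1 substitute for the square root of the positive part. The constant absorbs
   the last term of [(x^2 + y^2)^2 = (x^2 - y^2)^2 + 4 x^2 y^2], which bounds the
   speed of [hfun sigma (x^2 - y^2)] by 1 where [|x y| <= sigma^2]. *)
Definition hfun (sigma r : R) : R := Num.sqrt (Num.sqrt (pos2 r + 16 * sigma ^+ 4)) - 2 * sigma.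

Definition hfun' (sigma r : R) : R :=
  (2 * Num.sqrt (Num.sqrt (pos2 r + 16 * sigma ^+ 4)))^-1 *
  ((2 * Num.sqrt (pos2 r + 16 * sigma ^+ 4))^-1 * (2 * Num.max r 0)).

Lemma hfun_arg_gt0 sigma r : 0 < sigma -> 0 < pos2 r + 16 * sigma ^+ 4.
Proof. by move=> s0; rewrite ltr_wpDl ?sqr_ge0// mulr_gt0// exprn_gt0. Qed.

Lemma is_derive_hfun sigma r : 0 < sigma -> is_derive r 1 (hfun sigma) (hfun' sigma r).
Proof.
move=> s0; have N0 := hfun_arg_gt0 r s0.
have w0 : 0 < Num.sqrt (pos2 r + 16 * sigma ^+ 4) by rewrite sqrtr_gt0.
pose N : R -> R := fun r => pos2 r + 16 * sigma ^+ 4.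
have d1 : is_derive r (1 : R) N (2 * Num.max r 0 + 0).
  exact: (is_deriveD (is_derive_pos2 r) (is_derive_cst (16 * sigma ^+ 4) r 1)).
have d2 := @is_derive1_comp _ Num.sqrt N r _ _ (is_derive1_sqrt N0) d1.
have d3 := @is_derive1_comp _ Num.sqrt (Num.sqrt \o N) r _ _ (is_derive1_sqrt w0) d2.
have d4 := is_deriveB d3 (is_derive_cst (2 * sigma) r 1).
by apply: (is_derive_eq d4); rewrite addr0 subr0.
Qed.

Lemma continuous_hfun' sigma : 0 < sigma -> continuous (hfun' sigma).
Proof.
move=> s0 r.
have cp : continuous (fun r : R => pos2 r + 16 * sigma ^+ 4).
  move=> t; apply: cvgD; last exact: cvg_cst.
  by apply: differentiable_continuous; apply/derivable1_diffP; have [] := is_derive_pos2 t.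
have cs : continuous (fun r : R => Num.sqrt (pos2 r + 16 * sigma ^+ 4)).
  by move=> t; apply: (@continuous_comp _ _ _ (fun r : R => pos2 r + 16 * sigma ^+ 4) Num.sqrt);
    [exact: cp|exact: sqrt_continuous].
have css : continuous (fun r : R => Num.sqrt (Num.sqrt (pos2 r + 16 * sigma ^+ 4))).
  by move=> t; apply: (@continuous_comp _ _ _ (fun r : R => Num.sqrt (pos2 r + 16 * sigma ^+ 4)) Num.sqrt);
    [exact: cs|exact: sqrt_continuous].
have w0 : 0 < Num.sqrt (pos2 r + 16 * sigma ^+ 4) by rewrite sqrtr_gt0 hfun_arg_gt0.
apply: cvgM.
  apply: cvgV; first by rewrite lt0r_neq0// mulr_gt0// sqrtr_gt0.
  by apply: cvgM; [exact: cvg_cst|exact: css].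
apply: cvgM; last exact: continuous_pos2'.
apply: cvgV; first by rewrite lt0r_neq0// mulr_gt0.
by apply: cvgM; [exact: cvg_cst|exact: cs].
Qed.

Lemma hfun_le0 sigma r : 0 < sigma -> r <= 0 -> hfun sigma r = 0 /\ hfun' sigma r = 0.
Proof.
move=> s0 r0; rewrite /hfun /hfun' /pos2 (max_idPr r0) expr0n/= add0r !mulr0; split=> //.
have -> : 16 * sigma ^+ 4 = (4 * sigma ^+ 2) ^+ 2 by ring.
rewrite sqrtr_sqr ger0_norm; last by rewrite mulr_ge0 ?sqr_ge0.
have -> : 4 * sigma ^+ 2 = (2 * sigma) ^+ 2 by ring.
by rewrite sqrtr_sqr ger0_norm ?subrr// mulr_ge0// ltW.
Qed.

(** For [r > 0], with [q = sqrt r] and [d = 2 sigma], the nested root is the 4-norm of [(q, d)],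
    which lies between [max q d] and [q + d]. *)
Lemma hfun_bounds sigma r : 0 < sigma ->
  0 <= hfun sigma r /\ Num.sqrt r - 2 * sigma <= hfun sigma r <= Num.sqrt r.
Proof.
move=> s0; have [r0|r0] := leP r 0.
  have [-> _] := hfun_le0 s0 r0; rewrite ler0_sqrtr// lexx sub0r oppr_le0.
  by rewrite mulr_ge0// ltW.
rewrite /hfun /pos2 (max_idPl (ltW r0)).
have q0 : 0 < Num.sqrt r by rewrite sqrtr_gt0.
have E : r = Num.sqrt r ^+ 2 by rewrite sqr_sqrtr// ltW.
have d0 : 0 < 2 * sigma by rewrite mulr_gt0.
have -> : 16 * sigma ^+ 4 = (2 * sigma) ^+ 4 by ring.
move: (Num.sqrt r) (2 * sigma) E q0 d0 => q d -> q0 d0.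
have fourth (z : R) : 0 <= z -> Num.sqrt (Num.sqrt (z ^+ 4)) = z.
  move=> z0; have -> : z ^+ 4 = (z ^+ 2) ^+ 2 by ring.
  by rewrite sqrtr_sqr ger0_norm ?sqr_ge0// sqrtr_sqr ger0_norm.
have -> : (q ^+ 2) ^+ 2 = q ^+ 4 by ring.
have h1 : q <= Num.sqrt (Num.sqrt (q ^+ 4 + d ^+ 4)).
  rewrite -[leLHS](fourth q (ltW q0)); do 2 apply: ler_wsqrtr.
  by rewrite lerDl exprn_ge0// ltW.
have h2 : d <= Num.sqrt (Num.sqrt (q ^+ 4 + d ^+ 4)).
  rewrite -[leLHS](fourth d (ltW d0)); do 2 apply: ler_wsqrtr.
  by rewrite lerDr exprn_ge0// ltW.
have h3 : Num.sqrt (Num.sqrt (q ^+ 4 + d ^+ 4)) <= q + d.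
  have qd : 0 <= q + d by lra.
  rewrite -[leRHS](fourth _ qd); do 2 apply: ler_wsqrtr.
  have -> : (q + d) ^+ 4 = q ^+ 4 + d ^+ 4 + 2 * (q * d) * (2 * q ^+ 2 + 3 * (q * d) + 2 * d ^+ 2) by ring.
  have qd0 : 0 <= q * d by rewrite mulr_ge0// ltW.
  rewrite lerDl; apply: mulr_ge0; first exact: mulr_ge0.
  by have := sqr_ge0 q; have := sqr_ge0 d; lra.
split; first lra.
by apply/andP; split; lra.
Qed.

(** With [u = x^2 - y^2 > 0] and [w], [z] the inner and outer roots, the left side is
    [u^2 (x a - y b)^2 / (z^2 w^2)]. Here [z^2 = w], [u^2 <= w^2], and Cauchy-Schwarz gives
    [(x a - y b)^2 <= x^2 + y^2 <= w]. *)
Lemma hfun'_speed sigma (a b x y : R) : 0 < sigma -> a ^+ 2 + b ^+ 2 <= 1 ->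
  x ^+ 2 * y ^+ 2 <= sigma ^+ 4 ->
  (hfun' sigma (x ^+ 2 - y ^+ 2) * (2 * (x * a - y * b))) ^+ 2 <= 1.
Proof.
move=> s0 ab xy.
have [u0|u0] := leP (x ^+ 2 - y ^+ 2) 0.
  by have [_ ->] := hfun_le0 s0 u0; rewrite mul0r expr0n/=.
rewrite /hfun' /pos2 (max_idPl (ltW u0)).
set u := x ^+ 2 - y ^+ 2.
have S4 : 0 < sigma ^+ 4 by rewrite exprn_gt0.
have N0 : 0 < u ^+ 2 + 16 * sigma ^+ 4 by rewrite ltr_wpDl ?sqr_ge0// mulr_gt0.
have w0 : 0 < Num.sqrt (u ^+ 2 + 16 * sigma ^+ 4) by rewrite sqrtr_gt0.
have wE := sqr_sqrtr (ltW N0).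
have z0 : 0 < Num.sqrt (Num.sqrt (u ^+ 2 + 16 * sigma ^+ 4)) by rewrite sqrtr_gt0.
have zE := sqr_sqrtr (ltW w0).
have S2 : 0 <= x ^+ 2 + y ^+ 2 by rewrite addr_ge0 ?sqr_ge0.
have Sw : x ^+ 2 + y ^+ 2 <= Num.sqrt (u ^+ 2 + 16 * sigma ^+ 4).
  rewrite -(@ler_pXn2r _ 2) ?nnegrE ?(ltW w0)// wE.
  have -> : (x ^+ 2 + y ^+ 2) ^+ 2 = u ^+ 2 + 4 * (x ^+ 2 * y ^+ 2) by rewrite /u; ring.
  by rewrite lerD2l; lra.
move: (Num.sqrt (Num.sqrt _)) z0 zE => z z0.
move: (Num.sqrt _) w0 wE Sw => w w0 wE Sw zE.
have CS : (x * a - y * b) ^+ 2 <= w.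
  have h1 : (x * a - y * b) ^+ 2 <= (x ^+ 2 + y ^+ 2) * (a ^+ 2 + b ^+ 2).
    by have := sqr_ge0 (x * b + y * a); nra.
  apply: le_trans h1 _; apply: le_trans Sw; apply: ler_piMr => //.
have -> : ((2 * z)^-1 * ((2 * w)^-1 * (2 * u)) * (2 * (x * a - y * b))) ^+ 2 =
    u ^+ 2 * (x * a - y * b) ^+ 2 / (z ^+ 2 * w ^+ 2).
  by field; rewrite !lt0r_neq0.
rewrite zE ler_pdivrMr ?mul1r; last by rewrite mulr_gt0// exprn_gt0.
rewrite mulrC; apply: ler_pM => //; rewrite ?sqr_ge0//.
by rewrite wE lerDl mulr_ge0// ltW.
Qed.
End Estimates.

(** * Shadows, motion of the projection, and identification of [phi_d] *)

Section Paths.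
Context {R : realType}.
Implicit Types (a b f g u x y : R -> R) (c r s t T C sigma rho : R) (z w : R * R).

(** Supplies the second-order vanishing required by [prim_sg]: where [x] is 0 the hyperbolic
    coordinate is nonpositive, and there the continuous function [hfun'] is 0. *)
Lemma hfun'_diff_cvg0 sigma g u r : 0 < sigma -> locbd g -> continuous u ->
  u r <= 0 -> forall e, 0 < e -> \forall s \near r, `|hfun' sigma (u s) * g s| <= e.
Proof.
move=> s0 lg cu ur e e0.
have [C C0 gC] := locbd_bound (`|r| + 1) lg.
have c1 : {for r, continuous (fun s => hfun' sigma (u s))}.
  by apply: (@continuous_comp _ _ _ u (hfun' sigma)); [exact: cu|exact: continuous_hfun'].
have eC : 0 < e / C by rewrite divr_gt0.
have /cvgrPdist_le/(_ _ eC) := c1; have [_ ->] := hfun_le0 s0 ur => n1.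
near=> s.
have h1 : `|0 - hfun' sigma (u s)| <= e / C by near: s.
have h2 : `|g s| <= C.
  apply: gC; have : `|s - r| < 1.
    by near: s; exact: near_dist.
  by have := ler_normD (s - r) r; rewrite subrK; lra.
rewrite sub0r normrN in h1; rewrite normrM.
have -> : e = e / C * C by rewrite divfK// lt0r_neq0.
exact: ler_pM.
Unshelve. all: by end_near. Qed.

Lemma shadow_half sigma g x y : 0 < sigma -> continuous x -> continuous y ->
  prim (fun t => x t ^+ 2 - y t ^+ 2) g ->
  prim (fun t => Num.sg (x t) * hfun sigma (x t ^+ 2 - y t ^+ 2))
       (fun t => Num.sg (x t) * (hfun' sigma (x t ^+ 2 - y t ^+ 2) * g t)).
Proof.
move=> s0 cx cy pU.
have pH := prim_comp (fun r => is_derive_hfun r s0) (continuous_hfun' s0) pU.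
apply: prim_sg pH cx _ => r xr.
have ur : x r ^+ 2 - y r ^+ 2 <= 0 by rewrite xr expr0n/= sub0r oppr_le0 sqr_ge0.
split; first by have [] := hfun_le0 s0 ur.
apply: (@hfun'_diff_cvg0 sigma g (fun t => x t ^+ 2 - y t ^+ 2)) => //.
  exact: prim_locbd pU.
exact: prim_continuous pU.
Qed.

Lemma sg_sq_le1 (x : R) : Num.sg x ^+ 2 <= 1.
Proof. by rewrite sqr_sg; case: (_ != _). Qed.

(* The shadow of a penalised trajectory on the axes is admissible: both factors
   of its speed depend only on the hyperbolic coordinate [x^2 - y^2], which the
   penalisation does not move. *)
Lemma shadow sigma a b x y : 0 < sigma -> continuous x -> continuous y ->
  unit_control a b ->
  prim (fun t => x t ^+ 2 - y t ^+ 2) (fun s => 2 * (x s * a s - y s * b s)) ->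
  (forall s, x s ^+ 2 * y s ^+ 2 <= sigma ^+ 4) ->
  exists a' b', [/\ unit_control a' b',
    prim (fun t => Num.sg (x t) * hfun sigma (x t ^+ 2 - y t ^+ 2)) a' &
    prim (fun t => Num.sg (y t) * hfun sigma (y t ^+ 2 - x t ^+ 2)) b'].
Proof.
move=> s0 cx cy [la lb ab] pU xy.
have pV : prim (fun t => y t ^+ 2 - x t ^+ 2) (fun s => 2 * (y s * b s - x s * a s)).
  by apply: prim_ext (prim_scale (-1) pU) _ _ => s; ring.
have p1 := shadow_half s0 cx cy pU; have p2 := shadow_half s0 cy cx pV.
eexists; eexists; split; [|exact: p1|exact: p2].
split; [exact: prim_locbd p1|exact: prim_locbd p2|move=> s].
have h1 := hfun'_speed s0 (ab s) (xy s).
have h2 := @hfun'_speed _ sigma (b s) (a s) (y s) (x s) s0.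
rewrite addrC (mulrC (y s ^+ 2)) in h2; have {}h2 := h2 (ab s) (xy s).
have small (k q : R) : k ^+ 2 <= 1 -> q ^+ 2 <= 1 -> (k * q) ^+ 2 <= 1.
  by move=> k1 q1; rewrite exprMn mulr_ile1// sqr_ge0.
(* At each time one of the two components of the velocity vanishes, so a bound by 1 on each of them
   bounds the Euclidean norm by 1. *)
have [u0|u0] := leP (x s ^+ 2 - y s ^+ 2) 0.
  have [_ ->] := hfun_le0 s0 u0; rewrite mul0r mulr0 expr0n/= add0r.
  by apply: small h2; exact: sg_sq_le1.
have v0 : y s ^+ 2 - x s ^+ 2 <= 0 by lra.
have [_ ->] := hfun_le0 s0 v0; rewrite mul0r mulr0 expr0n/= addr0.
by apply: small h1; exact: sg_sq_le1.
Qed.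

Lemma sg_constant x t : continuous x -> 0 <= t ->
  (forall s, 0 <= s -> s <= t -> x s != 0) -> Num.sg (x t) = Num.sg (x 0).
Proof.
move=> cx t0 xn0.
have cw : {within `[0, t], continuous x} by apply: continuous_subspaceT.
have x0 := xn0 0 (lexx 0) t0; have xt := xn0 t t0 (lexx t).
have no : ~~ (Num.min (x 0) (x t) <= 0 <= Num.max (x 0) (x t)).
  apply/negP => h; have [s] := IVT t0 cw h; rewrite in_itv/= => /andP[s0 st] xs.
  by have := xn0 s s0 st; rewrite xs eqxx.
move: no; rewrite ge_min le_max.
have [h1|h1|h1] := ltgtP (x 0) 0; have [h2|h2|h2] := ltgtP (x t) 0 => //=; try by [].
all: try by rewrite h1 eqxx in x0.
all: try by rewrite h2 eqxx in xt.
- by rewrite !ltr0_sg.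
- by rewrite !gtr0_sg.
Qed.

Definition same_axis z w := (z.1 = 0 /\ w.1 = 0) \/ (z.2 = 0 /\ w.2 = 0).

Lemma pairB (p q p' q' : R) : (p, q) - (p', q') = (p - p', q - q') :> R * R.
Proof. by []. Qed.

Lemma enorm_axis (k : R) : enorm (k, 0) = `|k| /\ enorm (0, k) = `|k|.
Proof. by rewrite /enorm /= expr0n/= addr0 add0r sqrtr_sqr. Qed.

Lemma enormE2 z : enorm z ^+ 2 = z.1 ^+ 2 + z.2 ^+ 2.
Proof. by rewrite /enorm sqr_sqrtr// addr_ge0 ?sqr_ge0. Qed.

Lemma enorm_ge0 z : 0 <= enorm z. Proof. exact: sqrtr_ge0. Qed.

Lemma enorm_le z : enorm z <= `|z.1| + `|z.2|.
Proof.
rewrite -(@ler_pXn2r _ 2) ?nnegrE ?enorm_ge0 ?addr_ge0// enormE2.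
rewrite -(real_normK (num_real z.1)) -(real_normK (num_real z.2)).
by have := normr_ge0 z.1; have := normr_ge0 z.2; nra.
Qed.

Lemma sqrt_diff (p q : R) : 0 <= p -> 0 <= q -> `|Num.sqrt p - Num.sqrt q| ^+ 2 <= `|p - q|.
Proof.
move=> p0 q0; have := sqr_sqrtr p0; have := sqr_sqrtr q0.
have := sqrtr_ge0 p; have := sqrtr_ge0 q.
move: (Num.sqrt p) (Num.sqrt q) => k m m0 k0 mE kE.
rewrite -mE -kE subr_sqr normrM expr2 -[`|k - m| * `|k + m|]mulrC; apply: ler_wpM2r => //.
by rewrite [leRHS]ger0_norm ?addr_ge0// ler_norml; apply/andP; split; lra.
Qed.

(** As long as [x^2 - y^2] is positive, [x] cannot vanish, so its sign is frozen and only the root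
    moves, by at most [sqrt rho]. *)
Lemma proj_path_half x y rho t : continuous x -> 0 <= t -> 0 <= rho ->
  (forall s, 0 <= s -> s <= t -> `|(x s ^+ 2 - y s ^+ 2) - (x 0 ^+ 2 - y 0 ^+ 2)| <= rho) ->
  rho < x 0 ^+ 2 - y 0 ^+ 2 ->
  exists2 k, `|k| <= Num.sqrt rho & proj (x t, y t) = (k + (proj (x 0, y 0)).1, 0) /\
   (proj (x 0, y 0)).2 = 0.
Proof.
move=> cx t0 rho0 H U0.
have Us s : 0 <= s -> s <= t -> 0 < x s ^+ 2 - y s ^+ 2.
  by move=> s0 st; have := H s s0 st; rewrite ler_norml => /andP[]; lra.
have sgE : Num.sg (x t) = Num.sg (x 0).
  apply: sg_constant => // s s0 st; apply/eqP => xs.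
  by have := Us s s0 st; rewrite xs expr0n/= sub0r oppr_gt0 ltNge sqr_ge0.
have Ut := Us t t0 (lexx t); have U00 := Us 0 (lexx 0) t0.
exists (Num.sg (x 0) * (Num.sqrt (x t ^+ 2 - y t ^+ 2) - Num.sqrt (x 0 ^+ 2 - y 0 ^+ 2))).
  rewrite normrM.
  apply: (@le_trans _ _ `|Num.sqrt (x t ^+ 2 - y t ^+ 2) - Num.sqrt (x 0 ^+ 2 - y 0 ^+ 2)|).
    by rewrite ler_piMl// normr_sg; case: (_ != _).
  rewrite -(@ler_pXn2r _ 2) ?nnegrE ?sqrtr_ge0// sqr_sqrtr//.
  apply: le_trans (sqrt_diff (ltW Ut) (ltW U00)) _; exact: H.
rewrite /proj /= sgE (@ler0_sqrtr _ (y t ^+ 2 - _)) ?mulr0; last lra.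
rewrite (@ler0_sqrtr _ (y 0 ^+ 2 - _)) ?mulr0; last lra.
by split => //; congr (_, _); ring.
Qed.

Lemma enorm_proj z : enorm (proj z) ^+ 2 <= `|z.1 ^+ 2 - z.2 ^+ 2|.
Proof.
rewrite enormE2 /proj /=.
have [h|h] := leP (z.1 ^+ 2 - z.2 ^+ 2) 0.
  have -> : `|z.1 ^+ 2 - z.2 ^+ 2| = z.2 ^+ 2 - z.1 ^+ 2 by rewrite ler0_norm// opprB.
  have h' : 0 <= z.2 ^+ 2 - z.1 ^+ 2 by lra.
  rewrite (ler0_sqrtr h) mulr0 expr0n/= add0r exprMn sqr_sqrtr//.
  by apply: ler_piMl => //; exact: sg_sq_le1.
rewrite (@ler0_sqrtr _ (z.2 ^+ 2 - _)) ?mulr0 ?expr0n/= ?addr0 ?exprMn; last lra.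
rewrite (sqr_sqrtr (ltW h)) (gtr0_norm h).
by apply: ler_piMl; [exact: ltW|exact: sg_sq_le1].
Qed.

(** The alternative comes from the change of axis at [x^2 - y^2 = 0]. If this quantity starts
    farther than [rho] from 0, its sign is kept and the projection stays on one axis; otherwise it
    remains within [2 * rho] of 0 and both projections are near the origin. *)
Lemma proj_path x y rho t : continuous x -> continuous y -> 0 <= t -> 0 <= rho ->
  (forall s, 0 <= s -> s <= t -> `|(x s ^+ 2 - y s ^+ 2) - (x 0 ^+ 2 - y 0 ^+ 2)| <= rho) ->
  (enorm (proj (x 0, y 0)) <= Num.sqrt (2 * rho) /\
   enorm (proj (x t, y t)) <= Num.sqrt (2 * rho)) \/
  (same_axis (proj (x 0, y 0)) (proj (x t, y t)) /\
   enorm (proj (x 0, y 0) - proj (x t, y t)) <= Num.sqrt (2 * rho)).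
Proof.
move=> cx cy t0 rho0 H.
have sq2 : Num.sqrt rho <= Num.sqrt (2 * rho) by apply: ler_wsqrtr; lra.
have [h1|h1] := ltP rho (x 0 ^+ 2 - y 0 ^+ 2).
  right; have [k kr [-> E]] := proj_path_half cx t0 rho0 H h1.
  split; first by right.
  move: E; case: (proj (x 0, y 0)) => p q /= ->; rewrite pairB.
  rewrite subrr (_ : p - (k + p) = - k); last by ring.
  by have [-> _] := enorm_axis (- k); rewrite normrN; exact: le_trans sq2.
have [h2|h2] := ltP rho (y 0 ^+ 2 - x 0 ^+ 2).
  have H' s : 0 <= s -> s <= t -> `|(y s ^+ 2 - x s ^+ 2) - (y 0 ^+ 2 - x 0 ^+ 2)| <= rho.
    move=> s0 st; have := H s s0 st; rewrite -normrN.
    by have -> : - (x s ^+ 2 - y s ^+ 2 - (x 0 ^+ 2 - y 0 ^+ 2)) =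
      (y s ^+ 2 - x s ^+ 2) - (y 0 ^+ 2 - x 0 ^+ 2) by ring.
  right; have [k kr [Et E0]] := proj_path_half cy t0 rho0 H' h2.
  have projS (p q : R) : proj (p, q) = ((proj (q, p)).2, (proj (q, p)).1) by [].
  rewrite !(projS (x _) (y _)) Et; move: (proj (y 0, x 0)) E0 => [p q] /= ->.
  split; first by left.
  rewrite pairB subrr (_ : p - (k + p) = - k); last by ring.
  by have [_ ->] := enorm_axis (- k); rewrite normrN; exact: le_trans sq2.
left; have R0 : 0 <= 2 * rho by lra.
have aux z : `|z.1 ^+ 2 - z.2 ^+ 2| <= 2 * rho -> enorm (proj z) <= Num.sqrt (2 * rho).
  move=> hz; rewrite -(@ler_pXn2r _ 2) ?nnegrE ?sqrtr_ge0 ?enorm_ge0// (sqr_sqrtr R0).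
  exact: le_trans (enorm_proj z) hz.
split; apply: aux => /=.
  by rewrite ler_norml; apply/andP; split; lra.
have := H t t0 (lexx t); rewrite !ler_norml => /andP[h3 h4].
by apply/andP; split; lra.
Qed.

(** The control pushes [y] towards 0 at unit speed and the penalisation can only help; the barrier
    lemma and the intermediate value theorem give the hitting time. *)
Lemma sol_hits_axis c x y (b0 : R) : 0 <= c -> b0 = - Num.sg (y 0) ->
  sol c (fun=> 0) (fun=> b0) x y -> exists t, [/\ 0 <= t, t <= `|y 0| & y t = 0].
Proof.
move=> c0 bE [_ py]; set k := Num.sg (y 0).
have [y0|y0] := eqVneq (y 0) 0; first by exists 0; rewrite lexx normr_ge0.
have k2 : k * k = 1 by rewrite -expr2 /k sqr_sg y0.
have ky0 : k * y 0 = `|y 0| by rewrite /k -normrEsg.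
have pk := prim_scale k py.
have := @prim_barrier _ _ _ 0 1 `|y 0| pk ler01 (normr_ge0 _).
rewrite mul1r ky0 subrr maxxx => h.
have kyt : k * y `|y 0| <= 0.
  apply: h => s s0 st kys; rewrite bE -/k.
  have -> : k * (- k - c * (2 * y s * x s ^+ 2)) = - (k * k) - 2 * c * (k * y s * x s ^+ 2) by ring.
  rewrite k2 gerBl; apply: mulr_ge0; first exact: mulr_ge0.
  by apply: mulr_ge0; [exact: ltW|exact: sqr_ge0].
have cw : {within `[0, `|y 0|], continuous (fun t => k * y t)}.
  by apply: continuous_subspaceT; exact: prim_continuous pk.
have iv : Num.min (k * y 0) (k * y `|y 0|) <= 0 <= Num.max (k * y 0) (k * y `|y 0|).
  by rewrite ge_min kyt orbT le_max ky0 normr_ge0.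
have [t] := IVT (normr_ge0 (y 0)) cw iv; rewrite in_itv/= => /andP[t0 ty] kt.
exists t; split => //; apply/eqP; move/eqP: kt; rewrite mulf_eq0 => /orP[|//].
by move=> /eqP k0; move: k2; rewrite k0 mul0r => /eqP; rewrite eq_sym oner_eq0.
Qed.

Lemma prim_is_derive F f r : prim F f -> continuous f -> 0 < r -> is_derive r (1 : R) F (f r).
Proof.
move=> pF cf r0; apply/is_derive_slope => e e0.
have lf := prim_locbd pF.
have l2 : locbd (fun s => f s - f r) by apply: locbd_sub => //; exact: locbd_cst.
have n1 : \forall s \near r, `|f s - f r| <= e.
  have /cvgrPdist_le/(_ _ e0) := cf r.
  by apply: filterS => s; rewrite distrC.
have n2 := integ_near l2 n1.
near=> t.
have t0 : 0 <= t by near: t; apply: filterS (lt_nbhsr r0) => t; exact: ltW.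
have : `|integ (fun s => f s - f r) t - integ (fun s => f s - f r) r| <= e * `|t - r| by near: t.
rewrite !integ_sub//; try exact: locbd_cst.
rewrite !integ_cst ?(ltW r0)// (primB r t pF); apply: le_trans.
by rewrite le_eqVlt; apply/orP; left; apply/eqP; congr (`|_|); ring.
Unshelve. all: by end_near. Qed.

Lemma is_derive_pair F f x y r : is_derive r (1 : R) x (F r) -> is_derive r (1 : R) y (f r) ->
  is_derive r (1 : R) (fun t => (x t, y t)) (F r, f r).
Proof.
move=> [dx ex] [dy ey].
have C : (h^-1 *: ((x (h *: 1 + r), y (h *: 1 + r)) - (x r, y r))) @[h --> (0 : R)^'] --> (F r, f r).
  have cx : (h^-1 *: (x (h *: 1 + r) - x r)) @[h --> (0 : R)^'] --> F r by rewrite -ex; exact: dx.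
  have cy : (h^-1 *: (y (h *: 1 + r) - y r)) @[h --> (0 : R)^'] --> f r by rewrite -ey; exact: dy.
  exact: cvg_pair cx cy.
by apply: DeriveDef; [apply/cvg_ex; exists (F r, f r)|apply/cvg_lim].
Qed.

Lemma is_derive_components (Z : R -> R * R) r z : is_derive r (1 : R) Z z ->
  is_derive r (1 : R) (fun t => (Z t).1) z.1 /\ is_derive r (1 : R) (fun t => (Z t).2) z.2.
Proof.
move=> [dZ eZ].
have C : (h^-1 *: (Z (h *: 1 + r) - Z r)) @[h --> (0 : R)^'] --> z by rewrite -eZ; exact: dZ.
have C1 : (h^-1 *: ((Z (h *: 1 + r)).1 - (Z r).1)) @[h --> (0 : R)^'] --> z.1.
  exact: (cvg_comp _ _ C cvg_fst).
have C2 : (h^-1 *: ((Z (h *: 1 + r)).2 - (Z r).2)) @[h --> (0 : R)^'] --> z.2.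
  exact: (cvg_comp _ _ C cvg_snd).
split; apply: DeriveDef.
- by apply/cvg_ex; exists z.1.
- exact/cvg_lim.
- by apply/cvg_ex; exists z.2.
- exact/cvg_lim.
Qed.

Lemma prim_FTC F f : continuous F -> continuous f ->
  (forall r, 0 < r -> is_derive r (1 : R) F (f r)) -> (forall t, t <= 0 -> F t = F 0) ->
  prim F f.
Proof.
move=> cF cf dF F0; split; first exact: locbd_continuous.
move=> t; have [t0|t0] := leP t 0; first by rewrite integ_le0// addr0 F0.
have := @continuous_FTC2 R f F 0 t t0; rewrite /integ /Rintegral => ->.
- by rewrite -EFinB /= addrC subrK.
- exact: continuous_subspaceT.
- split.
  + by move=> s; rewrite in_itv/= => /andP[s0 _]; have [] := dF s s0.
  + exact/cvg_at_right_filter/cF.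
  + exact/cvg_at_left_filter/cF.
- move=> s; rewrite in_itv/= => /andP[s0 _]; rewrite derive1E.
  by have [_] := dF s s0.
Qed.

(** Existence makes the [xget] in [gradflow] meaningful. Whichever flow it returns has continuous
    derivative for positive times and is continuous at 0, so the fundamental theorem of calculus
    puts it in integrated form. *)
Lemma gradflow_sol (p : R * R) : exists u v, [/\ sol 1 (fun=> 0) (fun=> 0) u v,
  u 0 = p.1, v 0 = p.2 & forall t, 0 <= t -> gradflow p t = (u t, v t)].
Proof.
have n0 : forall s : R, `|(fun=> 0 : R) s| <= 1 by move=> s; rewrite normr0.
have [u [v [huv u0 v0]]] := sol_exists p.1 p.2 (locbd_cst 0) (locbd_cst 0) ler01 n0 n0.
have [pu pv] := huv.
have cu := prim_continuous pu; have cv := prim_continuous pv.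
have cc x y : continuous x -> continuous y ->
    continuous (fun s => 0 - 1 * (2 * x s * y s ^+ 2)).
  move=> cx cy r; apply: cvgB; first exact: cvg_cst.
  apply: cvgM; first exact: cvg_cst.
  apply: cvgM; first by apply: cvgM; [exact: cvg_cst|exact: cx].
  have cy2 : continuous (fun s => y s ^+ 2).
    by move=> t; apply: (@continuous_comp _ _ _ y (fun w : R => w ^+ 2)); [exact: cy|exact: exprn_continuous].
  exact: cy2.
have E : is_gradflow p (fun t => (u t, v t)).
  split; first by rewrite u0 v0; case: (p).
    by apply: continuous_subspaceT => t; exact: cvg_pair (cu t) (cv t).
  move=> t t0; rewrite grad_dfun.
  have -> : - (2 * u t * v t ^+ 2, 2 * v t * u t ^+ 2) =
    (0 - 1 * (2 * u t * v t ^+ 2), 0 - 1 * (2 * v t * u t ^+ 2)) :> R * R.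
    by rewrite !mul1r !sub0r.
  apply: (@is_derive_pair (fun t => 0 - 1 * (2 * u t * v t ^+ 2))
     (fun t => 0 - 1 * (2 * v t * u t ^+ 2))).
    exact: prim_is_derive pu (cc _ _ cu cv) t0.
  exact: prim_is_derive pv (cc _ _ cv cu) t0.
have : is_gradflow p (gradflow p) by apply: xgetPex; exists (fun t => (u t, v t)).
move: (gradflow p) => Z [Z0 cZ dZ].
have cZ' := within_extend cZ.
pose x t := (Z (Num.max t 0)).1; pose y t := (Z (Num.max t 0)).2.
have cx : continuous x.
  by move=> t; apply: (@continuous_comp _ _ _ (fun t => Z (Num.max t 0)) fst);
    [exact: cZ'|exact: cvg_fst].
have cy : continuous y.
  by move=> t; apply: (@continuous_comp _ _ _ (fun t => Z (Num.max t 0)) snd);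
    [exact: cZ'|exact: cvg_snd].
have loc (F G : R -> R) r d : 0 < r -> (forall s, 0 < s -> F s = G s) ->
    is_derive r (1 : R) F d -> is_derive r (1 : R) G d.
  move=> r0 FG; apply: near_eq_is_derive.
  by near=> s; apply: FG; near: s; exact: lt_nbhsr.
have gx : sol 1 (fun=> 0) (fun=> 0) x y.
  split; apply: prim_FTC => //; try exact: cc.
  - move=> r r0; have [+ _] := is_derive_components (dZ r r0).
    rewrite grad_dfun /= => h; have -> : 0 - 1 * (2 * x r * y r ^+ 2) = - (2 * (Z r).1 * (Z r).2 ^+ 2).
      by rewrite /x /y max_l ?(ltW r0)// sub0r mul1r.
    by apply: loc h => // s s0; rewrite /x max_l// ltW.
  - by move=> t t0; rewrite /x maxxx max_r.
  - move=> r r0; have [_] := is_derive_components (dZ r r0).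
    rewrite grad_dfun /= => h; have -> : 0 - 1 * (2 * y r * x r ^+ 2) = - (2 * (Z r).2 * (Z r).1 ^+ 2).
      by rewrite /x /y max_l ?(ltW r0)// sub0r mul1r.
    by apply: loc h => // s s0; rewrite /y max_l// ltW.
  - by move=> t t0; rewrite /y maxxx max_r.
exists x, y; split => //; rewrite /x /y ?maxxx ?Z0//.
by move=> t t0; rewrite max_l//; case: (Z t).
Unshelve. all: by end_near. Qed.

Lemma prim_const F f t : prim F f -> (forall s, f s = 0) -> F t = F 0.
Proof.
move=> pF f0; rewrite (primE t pF) (@eq_integ _ _ (fun=> 0)) => [|s _ _]; last exact: f0.
by have := primE t (prim_cst (0 : R)); lra.
Qed.

(** Along the flow [x^2 - y^2] is conserved, and a coordinate whose root is nonzero keeps its sign: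
    [proj] is constant. Since [x y] tends to 0, the flow approaches its own projection. *)
Lemma phi_d_proj (p : R * R) : phi_d p = proj p.
Proof.
have [u [v [huv u0 v0 gE]]] := gradflow_sol p.
have [pu pv] := huv.
have cu := prim_continuous pu; have cv := prim_continuous pv.
have UE t : u t ^+ 2 - v t ^+ 2 = p.1 ^+ 2 - p.2 ^+ 2.
  by rewrite (prim_const t (sol_hyp huv)) ?u0 ?v0// => s; rewrite !mulr0 subrr mulr0.
have half x y t : continuous x -> (forall t, x t ^+ 2 - y t ^+ 2 = x 0 ^+ 2 - y 0 ^+ 2) ->
    0 <= t -> Num.sg (x t) * Num.sqrt (x t ^+ 2 - y t ^+ 2) =
    Num.sg (x 0) * Num.sqrt (x 0 ^+ 2 - y 0 ^+ 2).
  move=> cx E t0; rewrite E; have [h|h] := leP (x 0 ^+ 2 - y 0 ^+ 2) 0.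
    by rewrite ler0_sqrtr// !mulr0.
  congr (_ * _); apply: sg_constant => // s s0 st; apply/eqP => xs.
  by have := E s; have := sqr_ge0 (y s); rewrite xs expr0n/=; lra.
have h1 t : 0 <= t -> Num.sg (u t) * Num.sqrt (u t ^+ 2 - v t ^+ 2) = (proj p).1.
  by move=> t0; rewrite (half _ _ t cu) ?u0 ?v0// => s; rewrite !UE.
have h2 t : 0 <= t -> Num.sg (v t) * Num.sqrt (v t ^+ 2 - u t ^+ 2) = (proj p).2.
  move=> t0; rewrite (half _ _ t cv) ?u0 ?v0// => s.
  by have := UE s; have := UE 0; lra.
have n0 s : `|(fun=> 0 : R) s| <= 0 by rewrite normr0.
have close e : 0 < e -> \forall t \near +oo, `|u t - (proj p).1| <= e /\ `|v t - (proj p).2| <= e.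
  move=> e0; near=> t.
  have t0 : 0 <= t by near: t; apply: nbhs_pinfty_ge; exact: num_real.
  (* By this time the linear bound in [sol_prod_decay], with [c = 1] and [sigma = e], has dropped to
     0. *)
  have tb : u 0 ^+ 2 * v 0 ^+ 2 / (4 * e ^+ 6) <= t by near: t; apply: nbhs_pinfty_ge; exact: num_real.
  have e6 : 0 < 4 * e ^+ 6 by rewrite mulr_gt0// exprn_gt0.
  have nu0 : 0 <= 1 * e ^+ 3 by rewrite mul1r exprn_ge0// ltW.
  have := sol_prod_decay ler01 e0 nu0 n0 n0 huv t0.
  rewrite mulr1 (max_idPl _); last first.
    rewrite ler_pdivrMr// (mulrC t) in tb; apply: (@le_trans _ _ 0); last by rewrite exprn_ge0// ltW.
    by rewrite subr_le0.
  move=> q; split; first by rewrite -(h1 t t0); apply: sg_sqrt_close => //; exact: ltW.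
  by rewrite -(h2 t t0); apply: sg_sqrt_close; [exact: ltW|rewrite mulrC].
have lim : gradflow p t @[t --> +oo] --> proj p.
  have c1 : u t @[t --> +oo] --> (proj p).1.
    apply/cvgrPdist_le => e e0; near=> t; rewrite distrC.
    by apply: (@proj1 _ (`|v t - (proj p).2| <= e)); near: t; exact: close.
  have c2 : v t @[t --> +oo] --> (proj p).2.
    apply/cvgrPdist_le => e e0; near=> t; rewrite distrC.
    by apply: (@proj2 (`|u t - (proj p).1| <= e)); near: t; exact: close.
  have c3 : (u t, v t) @[t --> +oo] --> ((proj p).1, (proj p).2) by exact: cvg_pair c1 c2.
  rewrite -surjective_pairing in c3; apply: cvg_trans c3; apply: near_eq_cvg.
  near=> t; have t0 : 0 <= t by near: t; apply: nbhs_pinfty_ge; exact: num_real.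
  by rewrite gE.
have L : gradflow p t @[t --> +oo] --> phi_d p.
  exact: (@xgetPex _ 0 [set z : R * R | gradflow p t @[t --> +oo] --> z] (ex_intro _ (proj p) lim)).
have e1 : (phi_d p).1 = (proj p).1.
  have k1 : (gradflow p t).1 @[t --> +oo] --> (phi_d p).1 by exact: (cvg_comp _ _ L cvg_fst).
  have k2 : (gradflow p t).1 @[t --> +oo] --> (proj p).1 by exact: (cvg_comp _ _ lim cvg_fst).
  by rewrite -(cvg_lim _ k1)// -(cvg_lim _ k2).
have e2 : (phi_d p).2 = (proj p).2.
  have k1 : (gradflow p t).2 @[t --> +oo] --> (phi_d p).2 by exact: (cvg_comp _ _ L cvg_snd).
  have k2 : (gradflow p t).2 @[t --> +oo] --> (proj p).2 by exact: (cvg_comp _ _ lim cvg_snd).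
  by rewrite -(cvg_lim _ k1)// -(cvg_lim _ k2).
by rewrite (surjective_pairing (phi_d p)) e1 e2 -surjective_pairing.
Unshelve. all: by end_near. Qed.
End Paths.

(** * Discounted costs and value functions *)

Section Discount.
Context {R : realType}.
Variable lambda : R.
Hypothesis lambda_gt0 : 0 < lambda.
Implicit Types (f g : R -> R) (r s t T C M e eta delta tau : R).
Notation mu := (@lebesgue_measure R).

Let w t := expR (- (lambda * t)).

Let w_ge0 t : 0 <= w t. Proof. exact: expR_ge0. Qed.

Let w_le1 t : 0 <= t -> w t <= 1.
Proof. by move=> t0; rewrite /w -expR0 ler_expR oppr_le0 mulr_ge0// ltW. Qed.

Let w_measurable : measurable_fun setT w.
Proof.
apply: measurableT_comp; first exact: measurable_expR.
by apply: measurableT_comp => //; apply: measurable_funM => //; exact: measurable_cst.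
Qed.

(** The integrability and the mass of the discount weight are borrowed from the exponential
    distribution. *)
Let w_pdf : {in @halfline R, w =1 (fun t => lambda^-1 * exponential_pdf lambda t)}.
Proof.
move=> t; rewrite inE /halfline/= in_itv/= andbT => t0.
rewrite exponential_pdfE ?ltW// mulrA mulVf ?mul1r ?lt0r_neq0//.
by rewrite /w mulNr.
Qed.

Let w_integrable : mu.-integrable (@halfline R) (EFin \o w).
Proof.
apply: (@eq_integrable _ _ _ mu _ measurable_halfline
   (EFin \o (fun t => lambda^-1 * exponential_pdf lambda t))).
  by move=> t th /=; rewrite w_pdf.
apply: (@integrableS _ _ _ mu setT) => //; first exact: measurable_halfline.
exact: integrableZl (integrable_exponential_pdf lambda_gt0).
Qed.

Let w_int : \int[mu]_(t in @halfline R) w t <= lambda^-1.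
Proof.
have ipdf := integrable_exponential_pdf lambda_gt0.
rewrite (eq_Rintegral mu w_pdf) RintegralZl//; last 2 first.
- exact: measurable_halfline.
- by apply: integrableS ipdf => //; exact: measurable_halfline.
rewrite -[leRHS]mulr1; apply: ler_wpM2l; first by rewrite invr_ge0 ltW.
rewrite -lee_fin /Rintegral fineK; last first.
  apply: integrable_fin_num; first exact: measurable_halfline.
  by apply: integrableS ipdf => //; exact: measurable_halfline.
rewrite -(integral_exponential_pdf lambda_gt0); apply: ge0_subset_integral => //.
- exact: measurable_halfline.
- by apply/measurable_EFinP; exact: measurable_exponential_pdf.
- by move=> t _; rewrite lee_fin exponential_pdf_ge0// ltW.
Qed.

Definition bounded_meas M g := measurable_fun setT g /\ forall t, `|g t| <= M.

Definition discounted g := \int[mu]_(t in halfline) (w t * g t).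

Lemma discounted_integrable M g (D : set R) : measurable D -> D `<=` halfline ->
  bounded_meas M g -> mu.-integrable D (EFin \o (fun t => w t * g t)).
Proof.
move=> mD Dh [mg gM]; apply: (@integrableS _ _ _ mu halfline) => //.
  exact: measurable_halfline.
have iM : mu.-integrable (@halfline R) (fun t => M%:E * (EFin \o w) t)%E.
  by apply: integrableZl => //; exact: measurable_halfline.
apply: le_integrable iM; first exact: measurable_halfline.
  by apply/measurable_EFinP; apply: measurable_funTS; exact: measurable_funM.
move=> t _ /=; rewrite lee_fin !normrM (mulrC `|M|); apply: ler_wpM2l => //.
exact: le_trans (gM t) (ler_norm M).
Qed.

Lemma discounted_norm_le M M' g (D : set R) : measurable D -> D `<=` halfline ->
  bounded_meas M g -> (forall t, D t -> `|g t| <= M') -> 0 <= M' ->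
  `|\int[mu]_(t in D) (w t * g t)| <= M' * lambda^-1.
Proof.
move=> mD Dh bg gM M'0; have ig := discounted_integrable mD Dh bg.
apply: le_trans (@le_normr_Rintegral _ _ R mu D _ mD ig) _.
have iw : mu.-integrable D (EFin \o w).
  by apply: integrableS w_integrable => //; exact: measurable_halfline.
apply: (@le_trans _ _ (\int[mu]_(t in D) (M' * w t))).
  apply: le_Rintegral => //.
  - exact: (integrable_norm ig).
  - exact: (@integrableZl _ _ R mu D mD M' _ iw).
  - by move=> t Dt; rewrite normrM (ger0_norm (w_ge0 t)) mulrC; apply: ler_wpM2r; rewrite ?gM.
rewrite RintegralZl//; apply: ler_wpM2l => //; apply: le_trans w_int.
rewrite -lee_fin /Rintegral !fineK.
- apply: ge0_subset_integral => //; first exact: measurable_halfline.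
    by apply/measurable_EFinP; exact: measurable_funTS.
  by move=> t _; rewrite lee_fin.
- by apply: integrable_fin_num => //; exact: measurable_halfline.
- exact: integrable_fin_num.
Qed.

Lemma discounted_bound M g : bounded_meas M g -> `|discounted g| <= M / lambda.
Proof.
move=> bg; apply: (discounted_norm_le measurable_halfline _ bg) => //.
  by move=> t _; case: bg.
by case: bg => _ /(_ 0); exact: le_trans.
Qed.

Lemma halfline_split tau : 0 <= tau ->
  @halfline R = `]0, tau]%classic `|` `]tau, +oo[%classic /\
  [disjoint `]0, tau]%classic & `]tau, +oo[%classic].
Proof.
move=> t0; split.
  by rewrite /halfline (@itv_bndbnd_setU _ _ _ (BRight tau))// bnd_simp.
apply/disj_setPS => x /=; rewrite !in_itv/= andbT => -[/andP[_ h] h2].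
by move: (lt_le_trans h2 h); rewrite ltxx.
Qed.

Lemma discounted_split M g tau : 0 <= tau -> bounded_meas M g ->
  discounted g = \int[mu]_(t in `]0, tau]) (w t * g t) +
                 \int[mu]_(t in `]tau, +oo[) (w t * g t).
Proof.
move=> t0 bg; have [E dis] := halfline_split t0.
rewrite /discounted E Rintegral_setU//.
by rewrite -E; apply: (discounted_integrable measurable_halfline _ bg).
Qed.

Lemma discounted_head M M' g tau : 0 <= tau -> bounded_meas M g ->
  (forall t, `|g t| <= M') ->
  `|\int[mu]_(t in `]0, tau]) (w t * g t)| <= M' * tau.
Proof.
move=> t0 bg gM'.
have sub : `]0, tau]%classic `<=` @halfline R.
  by move=> x; rewrite /halfline/= !in_itv/= => /andP[-> _].
have ig := discounted_integrable (measurable_itv `]0, tau]) sub bg.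
apply: le_trans (@le_normr_Rintegral _ _ R mu _ _ (measurable_itv _) ig) _.
have -> : M' * tau = \int[mu]_(t in `]0, tau]) M'.
  rewrite Rintegral_cst//= lebesgue_measure_itv/= lte_fin.
  case: ltP => [_|ts]; first by rewrite /= subr0.
  by have -> : tau = 0 by apply/eqP; rewrite eq_le ts.
apply: le_Rintegral => //.
- exact: (integrable_norm ig).
- exact/locbd_integrable_oc/locbd_cst.
- move=> t /=; rewrite in_itv/= => /andP[s0 _].
  rewrite normrM (ger0_norm (w_ge0 t)); apply: le_trans (gM' t).
  by rewrite ler_piMl// w_le1// ltW.
Qed.

Lemma discounted_diff M f g eta delta : bounded_meas M f -> bounded_meas M g ->
  0 <= eta -> 0 <= delta -> (forall t, eta <= t -> `|f t - g t| <= delta) ->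
  `|discounted f - discounted g| <= 2 * M * eta + delta / lambda.
Proof.
move=> bf bg e0 d0 fg.
have bd : bounded_meas (2 * M) (fun t => f t - g t).
  case: bf => mf fM; case: bg => mg gM; split; first exact: measurable_funB.
  by move=> t; apply: le_trans (ler_normB _ _) _; have := fM t; have := gM t; lra.
have -> : discounted f - discounted g = discounted (fun t => f t - g t).
  rewrite /discounted -RintegralB.
  - by apply: eq_Rintegral => t _; rewrite mulrBr.
  - exact: measurable_halfline.
  - exact: (discounted_integrable measurable_halfline _ bf).
  - exact: (discounted_integrable measurable_halfline _ bg).
rewrite (discounted_split e0 bd); apply: le_trans (ler_normD _ _) _; apply: lerD.
  by apply: (discounted_head e0 bd); case: bd.
have sub : `]eta, +oo[%classic `<=` @halfline R.
  by move=> x; rewrite /halfline/= !in_itv/= !andbT; exact: le_lt_trans.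
apply: (discounted_norm_le _ sub bd) => //.
by move=> t /=; rewrite in_itv/= andbT => h; apply: fg; exact: ltW.
Qed.

(** The head costs at most [M * tau]. Delaying the tail multiplies its cost by
    [w tau >= 1 - lambda * tau], and as that cost is at most [M / lambda] this again loses at most
    [M * tau]. *)
Lemma discounted_concat M f g tau : bounded_meas M f -> bounded_meas M g -> 0 <= tau ->
  `|discounted (fun t => if t <= tau then f t else g (t - tau)) - discounted g| <= 2 * M * tau.
Proof.
move=> [mf fM] [mg gM] t0.
have bh : bounded_meas M (fun t => if t <= tau then f t else g (t - tau)).
  split; last by move=> t; case: ifP.
  apply: (@measurable_fun_ifT _ _ _ _ _ _ (fun t => t <= tau)) => //.
    by apply: measurable_fun_ler => //; exact: measurable_cst.
  exact: measurableT_comp mg (measurable_translate (- tau)).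
have bg : bounded_meas M g by [].
have M0 : 0 <= M := le_trans (normr_ge0 _) (gM 0).
have tail : \int[mu]_(t in `]tau, +oo[) (w t * (if t <= tau then f t else g (t - tau))) =
    w tau * discounted g.
  have E : (fun x => x + - tau) @^-1` @halfline R = `]tau, +oo[%classic.
    by apply/seteqP; split => x /=; rewrite /halfline/= !in_itv/= !andbT subr_gt0.
  have ig := discounted_integrable measurable_halfline (@subset_refl _ _) bg.
  have e1 : {in `]tau, +oo[%classic, (fun t => w t * (if t <= tau then f t else g (t - tau)))
     =1 (fun t => w tau * (w (t - tau) * g (t - tau)))}.
    move=> t; rewrite inE/= in_itv/= andbT => ht; rewrite leNgt ht /= mulrA.
    by congr (_ * _); rewrite /w -expRD; congr expR; ring.
  have mwg : measurable_fun setT (fun t => w t * g t) by exact: measurable_funM.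
  have i1 : mu.-integrable `]tau, +oo[ (EFin \o (fun t => w (t - tau) * g (t - tau))).
    have sub : `]tau, +oo[%classic `<=` @halfline R.
      by move=> x; rewrite /halfline/= !in_itv/= !andbT; exact: le_lt_trans.
    have bgt : bounded_meas M (fun t => g (t - tau)).
      by split => //; exact: measurableT_comp mg (measurable_translate (- tau)).
    have i2 := discounted_integrable (measurable_itv `]tau, +oo[) sub bgt.
    have i3 := @integrableZl _ _ R mu _ (measurable_itv `]tau, +oo[) (w tau)^-1 _ i2.
    apply: eq_integrable i3 => // t _ /=; rewrite -EFinM; congr EFin.
    rewrite mulrA; congr (_ * _); rewrite /w -expRN -expRD; congr expR; ring.
  rewrite (eq_Rintegral mu e1) RintegralZl//; congr (_ * _).
  rewrite /discounted (@Rintegral_translate R (- tau) halfline (fun t => w t * g t)) ?E//.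
  exact: measurable_halfline.
rewrite (discounted_split t0 bh) tail.
have h1 := @discounted_head M M _ tau t0 bh (proj2 bh).
have h2 := discounted_bound bg.
have -> : forall A, A + w tau * discounted g - discounted g = A - (1 - w tau) * discounted g.
  by move=> A; ring.
apply: le_trans (ler_normB _ _) _.
have -> : 2 * M * tau = M * tau + M * tau by ring.
apply: lerD => //; rewrite normrM.
have w1 : 0 <= 1 - w tau by rewrite subr_ge0 w_le1.
rewrite (ger0_norm w1).
have w2 : 1 - w tau <= lambda * tau.
  by have := expR_ge1Dx (- (lambda * tau)); rewrite /w; lra.
apply: (@le_trans _ _ (lambda * tau * (M / lambda))); first exact: ler_pM.
by rewrite le_eqVlt; apply/orP; left; apply/eqP; field; exact: lt0r_neq0.
Qed.

Lemma discounted_cvg M (f : nat -> R -> R) g : (forall n, bounded_meas M (f n)) ->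
  (forall t, 0 < t -> f n t @[n --> \oo] --> g t) ->
  discounted (f n) @[n --> \oo] --> discounted g.
Proof.
move=> bf fg.
have mh : measurable (@halfline R) := measurable_halfline.
have mf n : measurable_fun (@halfline R) (EFin \o (fun t => w t * f n t)).
  by apply/measurable_EFinP/measurable_funTS; apply: measurable_funM => //; case: (bf n).
have cv t : halfline t -> w t * f n t @[n --> \oo] --> w t * g t.
  rewrite /halfline/= in_itv/= andbT => t0.
  by apply: cvgM; [exact: cvg_cst|exact: fg].
have mg : measurable_fun (@halfline R) (EFin \o (fun t => w t * g t)).
  apply/measurable_EFinP; apply: (measurable_fun_cvg (h := fun n t => w t * f n t)) => //.
  by move=> n; apply/measurable_EFinP; exact: mf.
have iM : mu.-integrable (@halfline R) (fun t => M%:E * (EFin \o w) t)%E.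
  by apply: integrableZl.
have cvE : {ae mu, forall t, @halfline R t ->
    (EFin \o (fun t => w t * f n t)) t @[n --> \oo] --> (EFin \o (fun t => w t * g t)) t}.
  by apply: aeW => t /cv h; apply: cvg_EFin => //; exact: nearW.
have dom : {ae mu, forall t (n : nat), @halfline R t ->
    (`|(w t * f n t)%R%:E| <= M%:E * (w t)%:E)%E}.
  apply: aeW => t n _ /=; rewrite lee_fin normrM (ger0_norm (w_ge0 t)) mulrC.
  by apply: ler_wpM2r => //; case: (bf n).
have [i1 _ C] := @dominated_convergence _ _ R mu halfline mh (fun n => EFin \o (fun t => w t * f n t))
  (EFin \o (fun t => w t * g t)) (fun t => M%:E * (EFin \o w) t)%E mf mg cvE iM dom.
apply: fine_cvg; rewrite fineK; last exact: integrable_fin_num.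
exact: C.
Qed.
End Discount.

(** * Value functions: dynamic programming and regularity along the axes *)

Section Values.
Context {R : realType}.
Variables (l : R * R -> R) (M : R) (m_l : R -> R) (lambda : R).
Hypotheses (M_gt0 : 0 < M) (m_l_modulus : is_modulus m_l)
  (l_bounded : forall x, `|l x| <= M)
  (l_cont : forall x y, `|l x - l y| <= m_l (enorm (x - y)))
  (lambda_gt0 : 0 < lambda).
Implicit Types (a b u v x y : R -> R) (c r s t e eps delta tau sigma rho : R) (p q z w : R * R).

Lemma normB_le (A B C D : R) : A <= B + D -> B <= A + D -> D <= C -> `|A - B| <= C.
Proof. by move=> h1 h2 h3; rewrite ler_norml; apply/andP; split; lra. Qed.

Lemma le_add_trans (A B C D E : R) : A <= B -> B <= C + D -> C <= E -> A <= E + D.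
Proof. by move=> h1 h2 h3; lra. Qed.

Lemma modulus_small e : 0 < e -> exists2 d, 0 < d & forall r, 0 <= r -> r < d -> m_l r <= e.
Proof.
move=> e0; case: m_l_modulus => _ _ m0 /cvgrPdist_le/(_ _ e0) [d /= d0 hd].
exists d => // r; rewrite le_eqVlt => /orP[/eqP <- _|r0 rd]; first by rewrite m0 ltW.
have := hd r; rewrite /ball_ /= sub0r normrN (gtr0_norm r0) sub0r normrN => /(_ rd r0).
exact: le_trans (ler_norm _).
Qed.

Lemma l_path_continuous u v : continuous u -> continuous v -> continuous (fun t => l (u t, v t)).
Proof.
move=> cu cv r; apply/cvgrPdist_le => e e0; have [d d0 hd] := modulus_small e0.
have d2 : 0 < d / 2 by rewrite divr_gt0.
have /cvgrPdist_lt/(_ _ d2) n1 := cu r; have /cvgrPdist_lt/(_ _ d2) n2 := cv r.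
near=> t; apply: le_trans (l_cont _ _) (hd _ (enorm_ge0 _) _).
apply: le_lt_trans (enorm_le _) _; rewrite pairB /=.
have h1 : `|u r - u t| < d / 2 by near: t.
have h2 : `|v r - v t| < d / 2 by near: t.
lra.
Unshelve. all: by end_near. Qed.

Definition path_cost u v := discounted lambda (fun t => l (u t, v t)).

Lemma path_bounded_meas u v : continuous u -> continuous v ->
  bounded_meas M (fun t => l (u t, v t)).
Proof.
by move=> cu cv; split => //; apply: continuous_measurable_fun; exact: l_path_continuous.
Qed.

Lemma costE (X : R -> R * R) u v : (forall t, 0 <= t -> X t = (u t, v t)) ->
  cost lambda l X = path_cost u v.
Proof.
move=> XE; apply: eq_Rintegral => t; rewrite inE /halfline/= in_itv/= andbT => t0.
by rewrite XE// ltW.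
Qed.

Lemma path_cost_bound u v : continuous u -> continuous v ->
  - (M / lambda) <= path_cost u v.
Proof.
move=> cu cv; have := discounted_bound lambda_gt0 (path_bounded_meas cu cv).
by rewrite ler_norml => /andP[].
Qed.

Lemma sol_continuous c a b x y : sol c a b x y -> continuous x /\ continuous y.
Proof. by case=> /prim_continuous cx /prim_continuous cy. Qed.

Lemma unit_control0 : unit_control (fun=> 0 : R) (fun=> 0 : R).
Proof. by split; [exact: locbd_cst|exact: locbd_cst|move=> s; rewrite expr0n/= addr0 ler01]. Qed.

Lemma ae_repr_pair a b : ae_repr (fun s => (a s, b s)) a b.
Proof. exact: aeW. Qed.

Lemma Veps_has_inf eps p : 0 <= eps ->
  has_inf [set cost lambda l (traj eps p a) | a in controls].
Proof.
move=> e0; split.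
  exists (cost lambda l (traj eps p (fun=> (0, 0)))), (fun=> (0, 0)) => //.
  exact: unit_control_controls unit_control0.
exists (- (M / lambda)) => _ [a ca <-].
have [b1 [b2 [ub ab]]] := control_repr ca.
have [u [v [huv _ _ uE]]] := traj_sol p e0 ca ub ab.
have [cu cv] := sol_continuous huv.
by rewrite (costE uE); exact: path_cost_bound.
Qed.

Lemma Veps_le eps a b x y : 0 <= eps -> unit_control a b -> sol eps^-1 a b x y ->
  Veps lambda l eps (x 0, y 0) <= path_cost x y.
Proof.
move=> e0 ub h; apply: ge_inf; first by have [] := Veps_has_inf (x 0, y 0) e0.
exists (fun s => (a s, b s)); first exact: unit_control_controls.
apply: costE => t t0.
exact: sol_traj e0 (unit_control_controls ub) ub (ae_repr_pair a b) h t0.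
Qed.

Lemma Veps_approx eps p e : 0 <= eps -> 0 < e -> exists a b x y,
  [/\ unit_control a b, sol eps^-1 a b x y, p = (x 0, y 0) &
      path_cost x y <= Veps lambda l eps p + e].
Proof.
move=> eps0 e0; have [_ [a ca <-] h] := inf_adherent e0 (Veps_has_inf p eps0).
have [b1 [b2 [ub ab]]] := control_repr ca.
have [u [v [huv u0 v0 uE]]] := traj_sol p eps0 ca ub ab.
exists b1, b2, u, v; split => //; first by rewrite u0 v0 -surjective_pairing.
by rewrite -(costE uE) ltW.
Qed.

Lemma free_path a b p (X : R -> R * R) : unit_control a b ->
  (forall t, X t = (p.1 + integ a t, p.2 + integ b t)) ->
  exists u v, [/\ prim u a, prim v b, p = (u 0, v 0) & forall t, X t = (u t, v t)].
Proof.
move=> [la lb _] XE; exists (fun t => p.1 + integ a t), (fun t => p.2 + integ b t).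
by split; rewrite ?integ_le0 ?addr0 -?surjective_pairing//; exact: prim_integ.
Qed.

Lemma VGamma_has_inf p : Gamma p ->
  has_inf [set cost lambda l (free_traj p a) | a in controls_at p].
Proof.
move=> Gp; split.
  exists (cost lambda l (free_traj p (fun=> (0, 0)))), (fun=> (0, 0)) => //.
  split; first exact: unit_control_controls unit_control0.
  move=> t t0; rewrite (free_trajE p t (unit_control_controls unit_control0) unit_control0);
    last exact: ae_repr_pair.
  by rewrite !integ_cst// mul0r !addr0 -surjective_pairing.
exists (- (M / lambda)) => _ [a [ca _] <-].
have [b1 [b2 [ub ab]]] := control_repr ca.
have [u [v [pu pv _ uE]]] := free_path ub (fun t => free_trajE p t ca ub ab).
rewrite (@costE _ u v) => [|t _]; last exact: uE.
by apply: path_cost_bound; [exact: prim_continuous pu|exact: prim_continuous pv].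
Qed.

Lemma VGamma_le a b x y : unit_control a b -> prim x a -> prim y b ->
  (forall t, 0 <= t -> x t * y t = 0) -> VGamma lambda l (x 0, y 0) <= path_cost x y.
Proof.
move=> ub px py xy; have cab := unit_control_controls ub.
have E t : free_traj (x 0, y 0) (fun s => (a s, b s)) t = (x t, y t).
  by rewrite (free_trajE _ t cab ub (ae_repr_pair a b)) (primE t px) (primE t py).
apply: ge_inf.
  by have [] := @VGamma_has_inf (x 0, y 0) (xy 0 (lexx 0)).
exists (fun s => (a s, b s)); last by apply: costE => t _.
by split => // t t0; rewrite E; exact: xy.
Qed.

Lemma VGamma_approx p e : Gamma p -> 0 < e -> exists a b x y,
  [/\ unit_control a b, prim x a, prim y b, p = (x 0, y 0) &
     (forall t, 0 <= t -> x t * y t = 0) /\ path_cost x y <= VGamma lambda l p + e].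
Proof.
move=> Gp e0; have [_ [a [ca Ga] <-] h] := inf_adherent e0 (VGamma_has_inf Gp).
have [b1 [b2 [ub ab]]] := control_repr ca.
have [u [v [pu pv pE uE]]] := free_path ub (fun t => free_trajE p t ca ub ab).
exists b1, b2, u, v; split => //; split.
  by move=> t t0; have := Ga t t0; rewrite uE.
by rewrite -(@costE (free_traj p a)) ?ltW// => t _.
Qed.

Lemma le_epsilon r s : (forall e, 0 < e -> r <= s + e) -> r <= s.
Proof. by move=> h; apply/ler_addgt0Pr => e /h. Qed.

Lemma prim_sol c a b x y : unit_control a b -> prim x a -> prim y b ->
  (forall t, 0 <= t -> x t * y t = 0) -> sol c a b x y.
Proof.
move=> [la lb _] px py xy; have cx := prim_continuous px; have cy := prim_continuous py.
split.
  apply: prim_eq px _ _; first exact/locbd_sub/locbd_scale/locbd_cubic.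
  move=> s s0; have -> : 2 * x s * y s ^+ 2 = 2 * (x s * y s) * y s by ring.
  by rewrite xy// mulr0 mul0r mulr0 subr0.
apply: prim_eq py _ _; first exact/locbd_sub/locbd_scale/locbd_cubic.
move=> s s0; have -> : 2 * y s * x s ^+ 2 = 2 * (x s * y s) * x s by ring.
by rewrite xy// mulr0 mul0r mulr0 subr0.
Qed.

Lemma Veps_le_VGamma eps p : 0 <= eps -> Gamma p ->
  Veps lambda l eps p <= VGamma lambda l p.
Proof.
move=> eps0 Gp; apply: le_epsilon => e /(VGamma_approx Gp)[a [b [x [y [ub px py -> [xy]]]]]].
by apply: le_trans; apply: Veps_le (prim_sol _ ub px py xy).
Qed.

Lemma unit_control_concat a b a' b' tau : unit_control a b -> unit_control a' b' ->
  unit_control (fun t => if t <= tau then a t else a' (t - tau))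
               (fun t => if t <= tau then b t else b' (t - tau)).
Proof.
move=> [la lb ab] [la' lb' ab']; split.
- by apply: locbd_if_le => //; exact: locbd_translate.
- by apply: locbd_if_le => //; exact: locbd_translate.
- by move=> s; case: ifP.
Qed.

Lemma path_cost_concat x y x' y' tau : continuous x -> continuous y ->
  continuous x' -> continuous y' -> 0 <= tau ->
  path_cost (fun t => if t <= tau then x t else x' (t - tau))
            (fun t => if t <= tau then y t else y' (t - tau)) <= path_cost x' y' + 2 * M * tau.
Proof.
move=> cx cy cx' cy' t0.
have := discounted_concat lambda_gt0 (path_bounded_meas cx cy) (path_bounded_meas cx' cy') t0.
rewrite ler_norml => /andP[_]; rewrite lerBlDl addrC; apply: le_trans.
rewrite le_eqVlt; apply/orP; left; apply/eqP; apply: eq_Rintegral => t _.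
by case: ifP.
Qed.

(** One half of dynamic programming: follow the given path until [tau], then a nearly optimal
    one. *)
Lemma Veps_step eps a b x y tau : 0 <= eps -> unit_control a b -> sol eps^-1 a b x y ->
  0 <= tau -> Veps lambda l eps (x 0, y 0) <= Veps lambda l eps (x tau, y tau) + 2 * M * tau.
Proof.
move=> eps0 ub h t0; apply: le_epsilon => e e0.
have [a' [b' [x' [y' [ub' h' [ex ey] cst']]]]] := Veps_approx (x tau, y tau) eps0 e0.
have [px py] := h; have [px' py'] := h'.
have [cx cy] := sol_continuous h; have [cx' cy'] := sol_continuous h'.
have hc : sol eps^-1 (fun t => if t <= tau then a t else a' (t - tau))
   (fun t => if t <= tau then b t else b' (t - tau))
   (fun t => if t <= tau then x t else x' (t - tau))
   (fun t => if t <= tau then y t else y' (t - tau)).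
  split.
    by apply: prim_ext (prim_concat px px' t0 (esym ex)) _ _ => // s; case: ifP.
  by apply: prim_ext (prim_concat py py' t0 (esym ey)) _ _ => // s; case: ifP.
have := Veps_le eps0 (unit_control_concat tau ub ub') hc; rewrite t0 => h1.
have h2 := path_cost_concat cx cy cx' cy' t0; rewrite addrAC.
exact: le_add_trans h1 h2 cst'.
Qed.

Lemma VGamma_step a b x y tau : unit_control a b -> prim x a -> prim y b ->
  (forall t, 0 <= t -> t <= tau -> x t * y t = 0) -> 0 <= tau ->
  VGamma lambda l (x 0, y 0) <= VGamma lambda l (x tau, y tau) + 2 * M * tau.
Proof.
move=> ub px py xy t0; apply: le_epsilon => e e0.
have [a' [b' [x' [y' [ub' px' py' [ex ey] [xy' cst']]]]]] :=
  @VGamma_approx (x tau, y tau) e (xy tau t0 (lexx _)) e0.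
have cx := prim_continuous px; have cy := prim_continuous py.
have cx' := prim_continuous px'; have cy' := prim_continuous py'.
have p1 := prim_concat px px' t0 (esym ex); have p2 := prim_concat py py' t0 (esym ey).
have := VGamma_le (unit_control_concat tau ub ub') p1 p2; rewrite t0 => /(_ _).
have := path_cost_concat cx cy cx' cy' t0 => h1 h2.
rewrite addrAC; apply: le_add_trans (h2 _) h1 cst' => t tt; case: (leP t tau) => ttau; first exact: xy.
by apply: xy'; rewrite subr_ge0 ltW.
Qed.

(** The segment from [z] to [w] stays on the axes and is travelled at unit speed in time
    [enorm (z - w)]. *)
Lemma VGamma_segment z w : same_axis z w ->
  VGamma lambda l z <= VGamma lambda l w + 2 * M * enorm (z - w).
Proof.
move=> zw; have [->|zw'] := eqVneq z w.
  by rewrite lerDl mulr_ge0 ?enorm_ge0// mulr_ge0// ltW.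
set tau := enorm (z - w).
have tau2 : tau ^+ 2 = (z.1 - w.1) ^+ 2 + (z.2 - w.2) ^+ 2 by rewrite enormE2.
have tau0 : 0 < tau.
  rewrite lt_neqAle enorm_ge0 andbT eq_sym; apply/eqP => tau0.
  move: tau2; rewrite tau0 expr0n/= => /esym/eqP.
  rewrite paddr_eq0 ?sqr_ge0// !sqrf_eq0 !subr_eq0 => /andP[/eqP e1 /eqP e2].
  by move/eqP: zw'; apply; rewrite (surjective_pairing z) e1 e2 -surjective_pairing.
pose k1 := (w.1 - z.1) / tau; pose k2 := (w.2 - z.2) / tau.
have ub : unit_control (fun=> k1) (fun=> k2).
  split; [exact: locbd_cst|exact: locbd_cst|move=> _].
  rewrite /k1 /k2 !expr_div_n -mulrDl -(sqrrN (w.1 - _)) -(sqrrN (w.2 - _)) !opprB -tau2.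
  by rewrite divff// expf_neq0// lt0r_neq0.
have p1 := prim_integ z.1 (locbd_cst k1); have p2 := prim_integ z.2 (locbd_cst k2).
have := VGamma_step ub p1 p2 _ (ltW tau0).
rewrite !(integ_le0 _ (lexx 0)) !addr0 -surjective_pairing !integ_cst ?(ltW tau0)//.
rewrite /k1 /k2 !divfK ?lt0r_neq0// !(addrC _ (_ - _)) !subrK -surjective_pairing; apply.
move=> t t0 _; rewrite !integ_cst//.
by case: zw => -[-> ->]; rewrite subrr !mul0r addr0 ?mul0r ?mulr0.
Qed.

Lemma same_axis_sym z w : same_axis z w -> same_axis w z.
Proof. by case=> -[]; [left|right]. Qed.

Lemma enormC z w : enorm (z - w) = enorm (w - z).
Proof. by rewrite /enorm /= -(sqrrN (z.1 - _)) -(sqrrN (z.2 - _)) !opprB. Qed.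

(** Points on different axes are joined inside [Gamma] through the origin, by two segments of length
    at most [r]. *)
Lemma VGamma_via_origin z w r : Gamma z -> Gamma w -> enorm z <= r -> enorm w <= r ->
  VGamma lambda l z <= VGamma lambda l w + 4 * M * r.
Proof.
move=> Gz Gw zr wr.
have ax q : Gamma q -> same_axis q 0.
  by rewrite /Gamma/= => /eqP; rewrite mulf_eq0 => /orP[] /eqP; [left|right].
have h1 := VGamma_segment (ax _ Gz); have h2 := VGamma_segment (same_axis_sym (ax _ Gw)).
rewrite subr0 in h1; rewrite enormC subr0 in h2.
have h3 : 2 * M * enorm z <= 2 * M * r by apply: ler_wpM2l => //; rewrite mulr_ge0// ltW.
have h4 : 2 * M * enorm w <= 2 * M * r by apply: ler_wpM2l => //; rewrite mulr_ge0// ltW.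
have -> : 4 * M * r = 2 * M * r + 2 * M * r by ring.
rewrite addrA; apply: le_trans h1 _; apply: lerD => //.
by apply: le_trans h2 _; rewrite lerD2l.
Qed.

(** Transfers the base point along a path: only the drift of the hyperbolic coordinate matters,
    however fast the path moves towards the axes. *)
Lemma VGamma_proj_path x y rho t : continuous x -> continuous y -> 0 <= t -> 0 <= rho ->
  (forall s, 0 <= s -> s <= t -> `|(x s ^+ 2 - y s ^+ 2) - (x 0 ^+ 2 - y 0 ^+ 2)| <= rho) ->
  `|VGamma lambda l (proj (x t, y t)) - VGamma lambda l (proj (x 0, y 0))| <=
    4 * M * Num.sqrt (2 * rho).
Proof.
move=> cx cy t0 rho0 H; have M0 := ltW M_gt0; have G q : Gamma (proj q) by exact: proj_Gamma.
have [[h1 h2]|[h1 h2]] := proj_path cx cy t0 rho0 H.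
  have h3 := VGamma_via_origin (G (x 0, y 0)) (G (x t, y t)) h1 h2.
  have h4 := VGamma_via_origin (G (x t, y t)) (G (x 0, y 0)) h2 h1.
  exact: normB_le h4 h3 (lexx _).
have h3 := VGamma_segment h1; have h4 := VGamma_segment (same_axis_sym h1).
rewrite enormC in h4.
have h5 : 2 * M * enorm (proj (x 0, y 0) - proj (x t, y t)) <= 4 * M * Num.sqrt (2 * rho).
  apply: ler_pM => //; rewrite ?mulr_ge0 ?enorm_ge0//.
  by rewrite ler_pM2r// ler_nat.
exact: normB_le h4 h3 h5.
Qed.
End Values.

(** * Quantitative comparison of the penalised and constrained values *)

Section Estimate.
Context {R : realType}.
Variables (l : R * R -> R) (M : R) (m_l : R -> R) (lambda : R).
Hypotheses (M_gt0 : 0 < M) (m_l_modulus : is_modulus m_l)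
  (l_bounded : forall x, `|l x| <= M)
  (l_cont : forall x y, `|l x - l y| <= m_l (enorm (x - y)))
  (lambda_gt0 : 0 < lambda).
Implicit Types (a b u v x y : R -> R) (c r s t e eps eta delta tau sigma rho C : R)
  (p q z w : R * R).

(** Each coordinate grows by at most 1 up to time 1, whence [C + 2]. The essential point is that the
    bound is independent of [c]. *)
Lemma hyp_drift c a b x y C t : 0 <= c -> unit_control a b -> sol c a b x y ->
  `|x 0| + `|y 0| <= C -> 0 <= t -> t <= 1 ->
  `|(x t ^+ 2 - y t ^+ 2) - (x 0 ^+ 2 - y 0 ^+ 2)| <= 2 * (C + 2) * t.
Proof.
move=> c0 ub h xyC t0 t1; have [a1 b1] := unit_control_bound ub.
have := @prim_norm _ _ _ 0 t (2 * (C + 2)) (sol_hyp h) (lexx _) t0.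
rewrite subr0; apply => s s0 st.
have [bx by_] := sol_bound h c0 a1 b1 (ltW s0).
rewrite normrM (ger0_norm (_ : 0 <= 2))//; apply: ler_wpM2l => //.
apply: le_trans (ler_normB _ _) _; rewrite !normrM.
have h1 : `|x s| * `|a s| <= `|x s| by rewrite ler_piMr.
have h2 : `|y s| * `|b s| <= `|y s| by rewrite ler_piMr.
lra.
Qed.

(** Above [sigma^4] the product decreases at rate at least [4 * c * sigma ^+ 6]; the hypothesis on
    the initial value says that time [eta] is enough to exhaust it. *)
Lemma sol_prod_small c a b x y sigma eta t : 0 <= c -> unit_control a b -> sol c a b x y ->
  0 < sigma -> 1 <= c * sigma ^+ 3 -> x 0 ^+ 2 * y 0 ^+ 2 <= 4 * c * sigma ^+ 6 * eta ->
  0 <= eta -> eta <= t -> x t ^+ 2 * y t ^+ 2 <= sigma ^+ 4.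
Proof.
move=> c0 ub h s0 cs q0 e0 et; have [a1 b1] := unit_control_bound ub.
have t0 : 0 <= t by exact: le_trans et.
have := sol_prod_decay c0 s0 cs a1 b1 h t0; rewrite max_l//.
have k0 : 0 <= 4 * c * sigma ^+ 6.
  by apply: mulr_ge0; [exact: mulr_ge0|rewrite exprn_ge0// ltW].
have : 4 * c * sigma ^+ 6 * eta <= 4 * c * sigma ^+ 6 * t by exact: ler_wpM2l.
have : 0 <= sigma ^+ 4 by rewrite exprn_ge0// ltW.
lra.
Qed.

Lemma shadow_close sigma (x y : R) : 0 < sigma -> x ^+ 2 * y ^+ 2 <= sigma ^+ 4 ->
  `|x - Num.sg x * hfun sigma (x ^+ 2 - y ^+ 2)| <= 3 * sigma /\
  `|Num.sg x * Num.sqrt (x ^+ 2 - y ^+ 2) - Num.sg x * hfun sigma (x ^+ 2 - y ^+ 2)| <= 2 * sigma.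
Proof.
move=> s0 xy; have h1 := sg_sqrt_close (ltW s0) xy.
have h2 : `|Num.sg x * Num.sqrt (x ^+ 2 - y ^+ 2) - Num.sg x * hfun sigma (x ^+ 2 - y ^+ 2)|
    <= 2 * sigma.
  rewrite -mulrBr normrM; have [_ /andP[h3 h4]] := hfun_bounds (x ^+ 2 - y ^+ 2) s0.
  apply: (@le_trans _ _ `|Num.sqrt (x ^+ 2 - y ^+ 2) - hfun sigma (x ^+ 2 - y ^+ 2)|).
    by rewrite ler_piMl// normr_sg; case: (_ != _).
  by rewrite ler_norml; apply/andP; split; lra.
split=> //; move: h1 h2.
move: (Num.sg x * Num.sqrt _) (Num.sg x * hfun _ _) => k m h1 h2.
have -> : x - m = (x - k) + (k - m) by ring.
by apply: le_trans (ler_normD _ _) _; lra.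
Qed.

Let chain (A B C D e1 e2 e3 e4 e5 : R) : `|B - A| <= e5 -> B <= C + e1 -> C <= D ->
  `|e2 - D| <= e3 -> e1 + e3 + e5 <= e4 -> A <= e2 + e4.
Proof. by rewrite !ler_norml => /andP[h1 h2] h3 h4 /andP[h5 h6] h7; lra. Qed.

(* Before [eta] the trajectory may be far from the axes: its shadow is frozen there. *)
Lemma path_cost_lower c a b x y sigma eta delta C : 0 <= c -> unit_control a b ->
  sol c a b x y -> 0 < sigma -> 1 <= c * sigma ^+ 3 ->
  x 0 ^+ 2 * y 0 ^+ 2 <= 4 * c * sigma ^+ 6 * eta -> 0 <= eta -> eta <= 1 ->
  `|x 0| + `|y 0| <= C -> 0 <= delta ->
  (forall r, 0 <= r -> r <= 6 * sigma -> m_l r <= delta) ->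
  VGamma lambda l (proj (x 0, y 0)) <= path_cost l lambda x y +
    (8 * M * sigma + (2 * M * eta + delta / lambda) + 4 * M * Num.sqrt (4 * (C + 2) * eta)).
Proof.
move=> c0 ub h s0 cs q0 e0 e1 xyC d0 md.
have [px py] := h.
have pX := prim_freeze px e0; have pY := prim_freeze py e0.
pose X t := x (Num.max t eta); pose Y t := y (Num.max t eta).
have cX : continuous X := prim_continuous pX.
have cY : continuous Y := prim_continuous pY.
have [la lb ab] := ub.
have ub' : unit_control (fun s => if s <= eta then 0 else a s) (fun s => if s <= eta then 0 else b s).
  split; [by apply: locbd_if_le => //; exact: locbd_cst|by apply: locbd_if_le => //; exact: locbd_cst|].
  by move=> s; case: ifP => // _; rewrite expr0n/= addr0 ler01.
have pU : prim (fun t => X t ^+ 2 - Y t ^+ 2)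
    (fun s => 2 * (X s * (if s <= eta then 0 else a s) - Y s * (if s <= eta then 0 else b s))).
  apply: prim_ext (prim_freeze (sol_hyp h) e0) _ _ => // s.
  case: (leP s eta) => se; first by rewrite !mulr0 subrr mulr0.
  by rewrite /X /Y max_l// ltW.
have small s : X s ^+ 2 * Y s ^+ 2 <= sigma ^+ 4.
  by apply: (sol_prod_small c0 ub h s0 cs q0 e0); rewrite le_max lexx orbT.
have [a' [b' [ub2 p1 p2]]] := shadow s0 cX cY ub' pU small.
pose Y1 t := Num.sg (X t) * hfun sigma (X t ^+ 2 - Y t ^+ 2).
pose Y2 t := Num.sg (Y t) * hfun sigma (Y t ^+ 2 - X t ^+ 2).
have G t : 0 <= t -> Y1 t * Y2 t = 0.
  move=> _; rewrite /Y1 /Y2; have [u0|u0] := leP (X t ^+ 2 - Y t ^+ 2) 0.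
    by have [-> _] := hfun_le0 s0 u0; rewrite mulr0 mul0r.
  have v0 : Y t ^+ 2 - X t ^+ 2 <= 0 by lra.
  by have [-> _] := hfun_le0 s0 v0; rewrite !mulr0.
have small' s : Y s ^+ 2 * X s ^+ 2 <= sigma ^+ 4 by rewrite mulrC.
have cost1 := VGamma_le m_l_modulus l_bounded l_cont lambda_gt0 ub2 p1 p2 G.
have D : `|path_cost l lambda x y - path_cost l lambda Y1 Y2| <= 2 * M * eta + delta / lambda.
  have bm u v : continuous u -> continuous v -> bounded_meas M (fun t => l (u t, v t)).
    move=> cu cv. exact: (path_bounded_meas m_l_modulus l_bounded l_cont cu cv).
  have b1 := bm x y (prim_continuous px) (prim_continuous py).
  have b2 := bm Y1 Y2 (prim_continuous p1) (prim_continuous p2).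
  apply: (discounted_diff lambda_gt0 b1 b2 e0 d0) => t et; apply: le_trans (l_cont _ _) (md _ (enorm_ge0 _) _).
  apply: le_trans (enorm_le _) _; rewrite pairB /=.
  have [h1 _] := shadow_close s0 (small t); have [h2 _] := shadow_close s0 (small' t).
  rewrite -/(Y1 t) in h1; rewrite -/(Y2 t) in h2.
  rewrite {1}/X (max_idPl et) in h1; rewrite {1}/Y (max_idPl et) in h2.
  by move: h1 h2; move: `|_ - Y1 t| `|_ - Y2 t| => k m; lra.
have X0 : X 0 = x eta by rewrite /X max_r.
have Y0 : Y 0 = y eta by rewrite /Y max_r.
have seg : VGamma lambda l (proj (x eta, y eta)) <= VGamma lambda l (Y1 0, Y2 0) + 8 * M * sigma.
  have ax : same_axis (proj (x eta, y eta)) (Y1 0, Y2 0).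
    rewrite /same_axis /proj /Y1 /Y2 /= X0 Y0.
    have [u0|u0] := leP (x eta ^+ 2 - y eta ^+ 2) 0.
      by left; have [-> _] := hfun_le0 s0 u0; rewrite ler0_sqrtr// !mulr0.
    have v0 : y eta ^+ 2 - x eta ^+ 2 <= 0 by lra.
    by right; have [-> _] := hfun_le0 s0 v0; rewrite ler0_sqrtr// !mulr0.
  apply: le_trans (VGamma_segment M_gt0 m_l_modulus l_bounded l_cont lambda_gt0 ax) _.
  rewrite lerD2l; have -> : 8 * M * sigma = 2 * M * (4 * sigma) by ring.
  apply: ler_wpM2l; first by rewrite mulr_ge0// ltW.
  apply: le_trans (enorm_le _) _.
  have [_ h1] := shadow_close s0 (small 0); have [_ h2] := shadow_close s0 (small' 0).
  rewrite /proj pairB /= /Y1 /Y2 -X0 -Y0.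
  by move: h1 h2; move: `|_ - _| => k; move: `|_ - _| => m; lra.
(* It remains to bring the base point back from time [eta] to time 0. *)
have drift : `|VGamma lambda l (proj (x eta, y eta)) - VGamma lambda l (proj (x 0, y 0))| <=
    4 * M * Num.sqrt (4 * (C + 2) * eta).
  have C0 : 0 <= C by apply: le_trans xyC; rewrite addr_ge0.
  have rho0 : 0 <= 2 * (C + 2) * eta by rewrite mulr_ge0// mulr_ge0// addr_ge0.
  have -> : 4 * (C + 2) * eta = 2 * (2 * (C + 2) * eta) by ring.
  apply: (VGamma_proj_path M_gt0 m_l_modulus l_bounded l_cont lambda_gt0
    (prim_continuous px) (prim_continuous py) e0 rho0) => s s0' se.
  apply: le_trans (hyp_drift c0 ub h xyC s0' (le_trans se e1)) _.
  by apply: ler_wpM2l => //; rewrite mulr_ge0// addr_ge0.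
exact: chain drift seg cost1 D (lexx _).
Qed.

(** One coordinate has absolute value at most [sigma]; it is steered to 0 at unit speed while the
    other control is 0. *)
Lemma sol_to_axis c sigma p : 0 <= c -> 0 < sigma -> p.1 ^+ 2 * p.2 ^+ 2 <= sigma ^+ 4 ->
  exists a b x y tau, [/\ unit_control a b, sol c a b x y, p = (x 0, y 0),
    0 <= tau <= sigma & x tau * y tau = 0].
Proof.
move=> c0 s0 q0.
have n1 (k : R) : `|- Num.sg k| <= 1 by rewrite normrN normr_sg; case: (_ != _).
have n0 : `|0 : R| <= 1 by rewrite normr0.
have sq (k : R) : `|- Num.sg k| <= 1 -> (- Num.sg k) ^+ 2 <= 1.
  by rewrite sqrrN => _; exact: sg_sq_le1.
have uc (k m : R) : k ^+ 2 + m ^+ 2 <= 1 -> unit_control (fun=> k) (fun=> m).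
  by move=> h; split=> //; exact: locbd_cst.
have [h|h] := leP `|p.2| sigma.
  have [x [y [hxy x0 y0]]] := sol_exists p.1 p.2 (locbd_cst 0) (locbd_cst (- Num.sg p.2)) c0
    (fun=> n0) (fun=> n1 p.2).
  have [t [t0 ty yt]] : exists t, [/\ 0 <= t, t <= `|y 0| & y t = 0].
    by apply: sol_hits_axis c0 _ hxy; rewrite y0.
  exists (fun=> 0), (fun=> - Num.sg p.2), x, y, t; split => //.
  - by apply: uc; rewrite expr0n/= add0r; exact: sq.
  - by rewrite x0 y0 -surjective_pairing.
  - by rewrite t0; apply: le_trans ty _; rewrite y0.
  - by rewrite yt mulr0.
have h1 : `|p.1| <= sigma.
  rewrite leNgt; apply/negP => h1.
  have k1 : sigma ^+ 2 < p.1 ^+ 2 by rewrite -(real_normK (num_real p.1)) ltr_sqr ?nnegrE// ltW.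
  have k2 : sigma ^+ 2 < p.2 ^+ 2 by rewrite -(real_normK (num_real p.2)) ltr_sqr ?nnegrE// ltW.
  have : sigma ^+ 2 * sigma ^+ 2 < p.1 ^+ 2 * p.2 ^+ 2 by apply: ltr_pM => //; exact: sqr_ge0.
  by rewrite -exprD ltNge q0.
have [x [y [hxy x0 y0]]] := sol_exists p.1 p.2 (locbd_cst (- Num.sg p.1)) (locbd_cst 0) c0
  (fun=> n1 p.1) (fun=> n0).
have [t [t0 ty yt]] : exists t, [/\ 0 <= t, t <= `|x 0| & x t = 0].
  by apply: sol_hits_axis c0 _ (sol_sym hxy); rewrite x0.
exists (fun=> - Num.sg p.1), (fun=> 0), x, y, t; split => //.
- by apply: uc; rewrite expr0n/= addr0; exact: sq.
- by rewrite x0 y0 -surjective_pairing.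
- by rewrite t0; apply: le_trans ty _; rewrite x0.
- by rewrite yt mul0r.
Qed.

Let chain_up (A B C D E F e1 e2 e3 e4 e5 : R) : A <= B + e1 -> B <= C + e2 -> C <= D ->
  `|D - E| <= e3 -> `|E - F| <= e4 -> e1 + e2 + e3 + e4 <= e5 -> A <= F + e5.
Proof. by rewrite !ler_norml => ? ? ? /andP[? ?] /andP[? ?] ?; lra. Qed.

(** The four error terms are, in order, the cost of the layer, the cost of the steering, and the
    displacement of the projection during the steering and during the layer. *)
Lemma Veps_upper eps p sigma eta C : 0 <= eps -> 0 < sigma -> sigma <= 1 ->
  1 <= eps^-1 * sigma ^+ 3 -> p.1 ^+ 2 * p.2 ^+ 2 <= 4 * eps^-1 * sigma ^+ 6 * eta ->
  0 <= eta -> eta <= 1 -> `|p.1| + `|p.2| <= C ->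
  Veps lambda l eps p <= VGamma lambda l (proj p) +
    (2 * M * eta + 2 * M * sigma + 4 * M * Num.sqrt (4 * (C + 4) * sigma) +
     4 * M * Num.sqrt (4 * (C + 2) * eta)).
Proof.
move=> eps0 s0 s1 cs q0 e0 e1 pC.
have c0 : 0 <= eps^-1 by rewrite invr_ge0.
have C0 : 0 <= C by apply: le_trans pC; rewrite addr_ge0.
have n0 : forall s : R, `|(fun=> 0 : R) s| <= 1 by move=> s; rewrite normr0.
have [u [v [huv u0 v0]]] := sol_exists p.1 p.2 (locbd_cst 0) (locbd_cst 0) c0 n0 n0.
have pE : p = (u 0, v 0) by rewrite u0 v0 -surjective_pairing.
rewrite -u0 -v0 in q0 pC.
have small := sol_prod_small c0 unit_control0 huv s0 cs q0 e0 (lexx eta).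
have [bu bv] := sol_bound huv c0 n0 n0 e0.
have [a [b [x [y [tau [ub hxy wE /andP[t0 ts] G]]]]]] := sol_to_axis (p := (u eta, v eta)) c0 s0 small.
have [wE1 wE2] : u eta = x 0 /\ v eta = y 0 by case: wE.
(* After the layer the sum has grown by at most [2 * eta <= 2]; applied from there, [hyp_drift]
   yields the constant [C + 4]. *)
have wC : `|x 0| + `|y 0| <= C + 2 by rewrite -wE1 -wE2; clear n0; lra.
have step1 := Veps_step m_l_modulus l_bounded l_cont lambda_gt0 eps0 unit_control0 huv e0.
have step2 := Veps_step m_l_modulus l_bounded l_cont lambda_gt0 eps0 ub hxy t0.
have step3 := Veps_le_VGamma m_l_modulus l_bounded l_cont lambda_gt0 (p := (x tau, y tau)) eps0 G.
have cu := prim_continuous huv.1; have cv := prim_continuous huv.2.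
have cx := prim_continuous hxy.1; have cy := prim_continuous hxy.2.
have d1 : `|VGamma lambda l (proj (u eta, v eta)) - VGamma lambda l (proj (u 0, v 0))| <=
    4 * M * Num.sqrt (4 * (C + 2) * eta).
  have rho0 : 0 <= 2 * (C + 2) * eta by rewrite mulr_ge0// mulr_ge0// addr_ge0.
  have -> : 4 * (C + 2) * eta = 2 * (2 * (C + 2) * eta) by ring.
  apply: (VGamma_proj_path M_gt0 m_l_modulus l_bounded l_cont lambda_gt0 cu cv e0 rho0) => s s0' se.
  apply: le_trans (hyp_drift c0 unit_control0 huv pC s0' (le_trans se e1)) _.
  by apply: ler_wpM2l => //; rewrite mulr_ge0// addr_ge0.
have d2 : `|VGamma lambda l (proj (x tau, y tau)) - VGamma lambda l (proj (x 0, y 0))| <=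
    4 * M * Num.sqrt (4 * (C + 4) * sigma).
  have rho0 : 0 <= 2 * (C + 4) * sigma by rewrite mulr_ge0 ?(ltW s0)// mulr_ge0// addr_ge0.
  have -> : 4 * (C + 4) * sigma = 2 * (2 * (C + 4) * sigma) by ring.
  apply: (VGamma_proj_path M_gt0 m_l_modulus l_bounded l_cont lambda_gt0 cx cy t0 rho0) => s s0' st.
  apply: le_trans (hyp_drift c0 ub hxy wC s0' _) _.
    exact: le_trans st (le_trans ts s1).
  have -> : C + 2 + 2 = C + 4 by ring.
  by apply: ler_wpM2l; [rewrite mulr_ge0// addr_ge0|exact: le_trans st ts].
have GG : Gamma (x tau, y tau) := G.
(* The endpoint of the steering is exactly on the axes, so it is its own projection and [d2] speaks
   of the value reached by [step3]. *)
rewrite (proj_id GG) in d2; rewrite wE in step1 d1; rewrite pE.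
have e2 : 2 * M * tau <= 2 * M * sigma by apply: ler_wpM2l => //; rewrite mulr_ge0// ltW.
apply: (chain_up step1 step2 step3 d2 d1).
by rewrite !lerD2r lerD2l.
Qed.

Lemma pos_min_exists (k1 k2 k3 k4 : R) : 0 < k1 -> 0 < k2 -> 0 < k3 -> 0 < k4 ->
  exists2 s : R, 0 < s & [/\ s <= k1, s <= k2, s <= k3 & s <= k4].
Proof.
move=> h1 h2 h3 h4; exists (Num.min (Num.min k1 k2) (Num.min k3 k4)).
  by rewrite !lt_min h1 h2 h3 h4.
by rewrite !ge_min !lexx !orbT.
Qed.

Let err_lower (theta s1 s2 s3 d e M0 : R) : 0 <= M0 -> s1 <= theta -> s2 <= theta -> s3 <= theta ->
  d <= e / 8 -> M0 * theta = e / 40 -> 0 < e -> 8 * M0 * s1 + (2 * M0 * s2 + d) + 4 * M0 * s3 <= e / 2.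
Proof.
move=> m0 h1 h2 h3 h4 h5 h6.
have := ler_wpM2l m0 h1; have := ler_wpM2l m0 h2; have := ler_wpM2l m0 h3; lra.
Qed.

Let err_upper (theta s1 s2 s3 s4 e M0 : R) : 0 <= M0 -> s1 <= theta -> s2 <= theta ->
  s3 <= theta -> s4 <= theta -> M0 * theta = e / 40 -> 0 < e ->
  2 * M0 * s2 + 2 * M0 * s1 + 4 * M0 * s4 + 4 * M0 * s3 <= e.
Proof.
move=> m0 h1 h2 h3 h4 h5 h6.
have := ler_wpM2l m0 h1; have := ler_wpM2l m0 h2; have := ler_wpM2l m0 h3.
have := ler_wpM2l m0 h4; lra.
Qed.

Let two_sided (A B e : R) : A <= B + e -> B <= A + e -> `|A - B| <= e.
Proof. by move=> h1 h2; rewrite ler_norml; apply/andP; split; lra. Qed.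

Let lower_eps (A B e1 e2 k e : R) : A <= B + k -> B <= e1 + e2 -> k <= e / 2 -> e2 <= e / 2 ->
  A <= e1 + e.
Proof. by move=> *; lra. Qed.

Lemma value_estimate C e : 0 < e -> exists2 eps0, 0 < eps0 &
  forall eps p, 0 < eps -> eps < eps0 -> `|p.1| + `|p.2| <= C ->
  `|Veps lambda l eps p - VGamma lambda l (proj p)| <= e.
Proof.
move=> e0; pose C1 := Num.max C 1; pose C2 := C1 ^+ 4.
have C11 : 1 <= C1 by rewrite /C1 le_max lexx orbT.
have C21 : 1 <= C2 by rewrite /C2 exprn_ege1.
(* All lengths in the error terms are made at most [theta], each contributing [e / 40] times its
   coefficient: these sum to 14 in the lower bound, which also has [e / 8] from [m_l], and to 12 in
   the upper bound. [B * sigma] dominates the expressions under both roots. *)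
pose theta := e / (40 * M); pose B := 4 * (C1 + 4) * C2.
have th0 : 0 < theta by rewrite divr_gt0// mulr_gt0.
have thE : M * theta = e / 40 by rewrite /theta; field; exact: lt0r_neq0.
have B0 : 0 < B by rewrite /B !mulr_gt0//; lra.
have [d d0 hd] : exists2 d, 0 < d & forall r, 0 <= r -> r < d -> m_l r <= lambda * (e / 8).
  by apply: (modulus_small m_l_modulus); rewrite mulr_gt0// divr_gt0.
(* With [eta = C2 * sigma], the first three bounds on [sigma] ensure in turn [eta <= theta], both
   roots at most [theta], and [eta <= 1]. *)
have [k2 k20 [k2a k2b k2c k2d]] := @pos_min_exists (theta / C2) (theta ^+ 2 / B) (C2^-1) 1
  (divr_gt0 th0 (lt_le_trans ltr01 C21)) (divr_gt0 (exprn_gt0 2 th0) B0)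
  (ltac:(rewrite invr_gt0; exact: lt_le_trans ltr01 C21)) ltr01.
(* [d / 7], because [6 * sigma] has to be strictly less than [d]. *)
have [sigma s0 [sa sb sc sd]] := @pos_min_exists k2 (d / 7) theta 1 k20
  (ltac:(by rewrite divr_gt0)) th0 ltr01.
(* The initial product is at most [C2], and [4 * eps^-1 * sigma ^+ 6 * eta] is
   [4 * C2 * (eps^-1 * sigma ^+ 7)]: hence the seventh power. As [sigma <= 1], it also gives the
   weaker condition with [sigma ^+ 3]. *)
exists (sigma ^+ 7); first by rewrite exprn_gt0.
move=> eps p eps0 epss pC.
have C20 : 0 < C2 by exact: lt_le_trans ltr01 C21.
pose eta := C2 * sigma.
have eta0 : 0 <= eta by rewrite /eta mulr_ge0// ltW.
have etath : eta <= theta.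
  by have := le_trans sa k2a; rewrite ler_pdivlMr// mulrC.
have eta1 : eta <= 1.
  by have := le_trans sa k2c; rewrite -[C2^-1]mul1r ler_pdivlMr// mulrC.
have Beta : B * sigma <= theta ^+ 2.
  by have := le_trans sa k2b; rewrite ler_pdivlMr// mulrC.
have c0 : 0 < eps^-1 by rewrite invr_gt0.
have cs7 : 1 <= eps^-1 * sigma ^+ 7.
  by rewrite mulrC ler_pdivlMr// mul1r ltW.
have cs3 : 1 <= eps^-1 * sigma ^+ 3.
  apply: le_trans cs7 _; apply: ler_wpM2l; first exact: ltW.
  by apply: ler_wiXn2l => //; exact: ltW.
have pC1 : `|p.1| + `|p.2| <= C1 by rewrite /C1 le_max pC.
have q0 : p.1 ^+ 2 * p.2 ^+ 2 <= 4 * eps^-1 * sigma ^+ 6 * eta.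
  have -> : 4 * eps^-1 * sigma ^+ 6 * eta = 4 * C2 * (eps^-1 * sigma ^+ 7) by rewrite /eta; ring.
  apply: (@le_trans _ _ C2); last first.
    have C4 : C2 <= 4 * C2 by lra.
    have C40 : 0 <= 4 * C2 by lra.
    by apply: (le_trans C4); rewrite -[leLHS]mulr1; exact: ler_wpM2l.
  rewrite /C2 (_ : 4 = 2 + 2)%N// exprD -(real_normK (num_real p.1)) -(real_normK (num_real p.2)).
  have := normr_ge0 p.1; have := normr_ge0 p.2 => h1 h2.
  by apply: ler_pM; rewrite ?sqr_ge0// ler_sqr ?nnegrE; lra.
have sqr_le (z : R) : z <= B * sigma -> Num.sqrt z <= theta.
  move=> zB; rewrite -[leRHS]ger0_norm ?(ltW th0)// -sqrtr_sqr.
  by apply: ler_wsqrtr; exact: le_trans Beta.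
have sq1 : Num.sqrt (4 * (C1 + 2) * eta) <= theta.
  apply: sqr_le; have -> : 4 * (C1 + 2) * eta = 4 * (C1 + 2) * C2 * sigma by rewrite /eta; ring.
  by rewrite /B ler_pM2r// ler_pM2r//; lra.
have sq2 : Num.sqrt (4 * (C1 + 4) * sigma) <= theta.
  apply: sqr_le; rewrite /B ler_pM2r// -[leLHS]mulr1.
  by apply: ler_wpM2l => //; rewrite mulr_ge0//; lra.
have M0 := ltW M_gt0.
have up := Veps_upper (ltW eps0) s0 sd cs3 q0 eta0 eta1 pC1.
have md r : 0 <= r -> r <= 6 * sigma -> m_l r <= lambda * (e / 8).
  move=> r0 rs; apply: hd => //; apply: le_lt_trans rs _.
  by move: sb; rewrite ler_pdivlMr//; lra.
apply: two_sided.
  by apply: le_trans up _; rewrite lerD2l; apply: (@err_upper theta).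
have e2 : 0 < e / 2 by lra.
have [a [b [x [y [ub hxy pE cst]]]]] := Veps_approx m_l_modulus l_bounded l_cont lambda_gt0 p (ltW eps0) e2.
rewrite pE /= in pC1 q0.
have d0' : 0 <= lambda * (e / 8) by rewrite mulr_ge0 ?(ltW lambda_gt0)//; lra.
have low := path_cost_lower (ltW c0) ub hxy s0 cs3 q0 eta0 eta1 pC1 d0' md.
rewrite -pE in low; apply: (lower_eps low cst _ (lexx _)).
apply: (@err_lower theta) => //.
by rewrite le_eqVlt; apply/orP; left; apply/eqP; field; exact: lt0r_neq0.
Qed.
End Estimate.

(** * Uniform convergence, weak derivatives and membership in [omega] *)

Section Limits.
Context {R : realType}.
Implicit Types (f g u v x y : R -> R) (c r s t e eps tau C T : R) (p q z w : R * R).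
Notation mu := (@lebesgue_measure R).

Lemma uniform_cvg_eq (T U : uniformType) (A : set T) (F : set_system (T -> U)) (f : T -> U) :
  Filter F -> (\forall g \near F, forall t : T, A t -> f t = g t) -> {uniform A, F --> f}.
Proof.
move=> FF H P /uniform_nbhs[E [entE EP]].
apply: filterS H => g fg; apply: EP => t At; rewrite fg//; exact: entourage_refl.
Qed.

Lemma uniform_cvg_at (T U : uniformType) (A : set T) (F : set_system (T -> U)) (f : T -> U) (t : T) :
  Filter F -> {uniform A, F --> f} -> A t -> g t @[g --> F] --> f t.
Proof.
move=> FF H At B; rewrite -nbhs_entourageE => -[E entE EB].
apply: (H [set g | B (g t)]); apply/uniform_nbhs; exists E; split => // g Eg.
by apply: EB; apply/xsectionP; exact: Eg.
Qed.

Lemma uniform_cvg_norm (T : uniformType) (A : set T) (F : set_system (T -> R)) (f : T -> R) :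
  Filter F -> (forall e, 0 < e -> \forall g \near F, forall t : T, A t -> `|f t - g t| < e) ->
  {uniform A, F --> f}.
Proof.
move=> FF H P /uniform_nbhs[E [entE EP]].
have [e /= e0 eE] : exists2 e : R, 0 < e & [set xy : R * R | ball xy.1 e xy.2] `<=` E.
  by move: entE; rewrite -entourage_ballE => -[e /= e0 eE]; exists e.
by apply: filterS (H e e0) => g fg; apply: EP => t At; apply: eE; exact: fg.
Qed.

Lemma L2loc_locbd f : locbd f -> L2loc f.
Proof.
move=> lf; split; first by apply: measurable_funTS; case: lf.
move=> K cK _; have l2 := locbd_mul lf lf.
have [T KT] : exists T, K `<=` `[- T, T].
  have [C [_ KC]] := compact_bounded cK.
  exists (C + 1) => t Kt /=; rewrite in_itv/= -ler_norml; apply: (KC (C + 1)) => //.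
  by rewrite ltrDl.
have iK : mu.-integrable K (EFin \o (fun s => f s * f s)).
  apply: integrableS (@locbd_integrable _ _ `[- T, T] T l2 _) => //.
  exact: compact_measurable.
have -> : (fun t => (f t ^+ 2)%:E) = EFin \o (fun s => f s * f s).
  by apply/funext => t /=; rewrite expr2.
have mK : measurable K by exact: compact_measurable.
by have := @integrable_fin_num _ _ R mu K mK _ iK; rewrite fin_numElt => /andP[].
Qed.

(** The support is a compact subset of the open half-line, so [p] vanishes for [t <= 0], as [prim]
    requires, and beyond some [T]. *)
Lemma test_fun_prim (p : R -> R) : test_fun p -> prim p (derive1 p) /\
  exists2 T, 0 < T & forall t, T < t -> p t = 0 /\ derive1 p t = 0.
Proof.
move=> [dp cdp cs sh].
have p0 t : ~ closure [set t | p t != 0] t -> p t = 0.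
  by move=> h; apply/eqP/negPn/negP => pt; apply: h; exact: subset_closure.
have cp : continuous p.
  by move=> t; apply: differentiable_continuous; exact/derivable1_diffP.
have neg t : t <= 0 -> p t = 0.
  move=> t0; apply: p0 => /sh; rewrite /halfline/= in_itv/= andbT.
  by rewrite ltNge t0.
have [C [_ KC]] := compact_bounded cs.
pose T := Num.max (C + 1) 1.
have far t : T < t -> p t = 0.
  move=> Tt; apply: p0 => /(KC T); rewrite /= => h.
  have CT : C < T by rewrite lt_max ltrDl ltr01.
  by have := lt_le_trans Tt (le_trans (ler_norm t) (h CT)); rewrite ltxx.
split.
  apply: prim_FTC => //; last by move=> t t0; rewrite !neg.
  by move=> r _; rewrite derive1E; exact: derivableP.
exists T; first by rewrite lt_max ltr01 orbT.
move=> t Tt; split; first exact: far.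
rewrite derive1E; have : is_derive t (1 : R) p 0.
  apply/is_derive_slope => e e0; near=> s.
  have Ts : T < s by near: s; exact: lt_nbhsr.
  by rewrite !far// subrr mul0r subr0 normr0 mulr_ge0// ltW.
by move=> [_].
Unshelve. all: by end_near. Qed.

Lemma Rintegral_halfline_integ f T : 0 < T -> locbd f -> (forall t, T < t -> f t = 0) ->
  \int[mu]_(t in halfline) f t = integ f T.
Proof.
move=> T0 lf f0; rewrite /integ -Rintegral_itv_obnd_cbnd; last exact: locbd_integrable_oc.
rewrite Rintegral_mkcond [RHS]Rintegral_mkcond; congr (Rintegral _ _ _).
apply/funext => t; rewrite !patchE; case: ifPn; case: ifPn => //;
  rewrite /halfline ?inE ?notin_setE/= !in_itv/= ?andbT => h1 h2.
  by apply: f0; rewrite ltNge; apply/negP => h3; apply: h1; rewrite h2.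
by case: h2; case/andP: h1.
Qed.

(** Integration by parts is the product rule for [F * p], whose boundary values vanish. *)
Lemma H1loc_prim F f : prim F f -> H1loc F.
Proof.
move=> pF; have lf := prim_locbd pF; have cF := prim_continuous pF.
split; first exact/L2loc_locbd/locbd_continuous.
exists f; first exact: L2loc_locbd.
move=> p tp; have [pp [T T0 pT]] := test_fun_prim tp.
have lp := locbd_continuous (prim_continuous pp); have ldp := prim_locbd pp.
have lF := locbd_continuous cF.
have l1 := locbd_mul lF ldp; have l2 := locbd_mul lf lp.
(* [p] is known to vanish only strictly beyond [T], hence the endpoint [T + 1]. *)
have T1 : 0 < T + 1 by lra.
have pT' t : T + 1 < t -> p t = 0 /\ derive1 p t = 0 by move=> h; apply: pT; lra.
rewrite (Rintegral_halfline_integ T1 l1); last by move=> t /pT'[_ ->]; rewrite mulr0.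
rewrite (Rintegral_halfline_integ T1 l2); last by move=> t /pT'[-> _]; rewrite mulr0.
have := primE (T + 1) (prim_mul pF pp); rewrite integ_add//.
have TT : T < T + 1 by rewrite ltrDl.
have [-> _] := pT _ TT; have -> : p 0 = 0.
  have [_ _ _ sh] := tp; apply/eqP/negPn/negP => p0.
  have /sh : closure [set t | p t != 0] 0 by exact: subset_closure.
  by rewrite /halfline/= in_itv/= ltxx.
by rewrite !mulr0 add0r => /eqP; rewrite eq_sym addrC addr_eq0 => /eqP.
Qed.

(** For such a control every penalised trajectory equals the free one and every [ktraj] is 0, so
    both sequences are constant at the times considered. *)
Lemma free_traj_omega p a : controls_at p a -> omega p a (free_traj p a).
Proof.
move=> [ca Ga]; have [b1 [b2 [ub ab]]] := control_repr ca.
have [u [v [pu pv pE uE]]] := free_path ub (fun t => free_trajE p t ca ub ab).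
have uv t : 0 <= t -> u t * v t = 0 by move=> t0; have := Ga t t0; rewrite uE.
have trajE eps t : 0 <= eps -> 0 <= t -> traj eps p a t = (u t, v t).
  by move=> e0 t0; rewrite pE; exact: sol_traj e0 ca ub ab (prim_sol _ ub pu pv uv) t0.
have kE eps t : 0 <= eps -> ktraj eps p a t = 0.
  move=> e0; rewrite /ktraj (@eq_int0 _ _ _ (fun=> 0)) => [|s s0 st].
    by rewrite /int0 /= !Rintegral_cst//= !mul0r; exact: scaler0.
  rewrite trajE// grad_dfun /=.
  have -> : 2 * u s * v s ^+ 2 = 2 * (u s * v s) * v s by ring.
  have -> : 2 * v s * u s ^+ 2 = 2 * (u s * v s) * u s by ring.
  by rewrite uv// mulr0 !mul0r.
have z0 : @H1loc R (fun=> 0) by exact: H1loc_prim (prim_cst 0).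
split.
  split.
    by have -> : (fun t => (free_traj p a t).1) = u;
      [apply/funext => t; rewrite uE|exact: H1loc_prim pu].
  by have -> : (fun t => (free_traj p a t).2) = v;
    [apply/funext => t; rewrite uE|exact: H1loc_prim pv].
exists (fun=> 0); first by split.
have h0 n : 0 < (n.+1%:R : R)^-1 by rewrite invr_gt0 ltr0n.
(* Any positive sequence tending to 0 would do, as the trajectory does not depend on [eps]. *)
exists (fun n => n.+1%:R^-1); split.
- exact: h0.
- exact: cvg_harmonic.
- move=> K _ Kh; apply: uniform_cvg_eq; exists 0%N => // n _ t /Kh.
  rewrite /halfline/= in_itv/= andbT => t0.
  by have := trajE _ t (ltW (h0 n)) (ltW t0); rewrite uE => ->.
- move=> K _ Kh; apply: uniform_cvg_eq; exists 0%N => // n _ t _.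
  by rewrite (kE _ t (ltW (h0 n))).
Qed.

Lemma cvg_seq_pair (p : nat -> R * R) q : p n @[n --> \oo] --> q ->
  forall e, 0 < e -> \forall n \near \oo, enorm (q - p n) < e.
Proof.
move=> pq e e0; have e2 : 0 < e / 2 by lra.
have /cvgrPdist_lt/(_ _ e2) n1 : (p n).1 @[n --> \oo] --> q.1 by exact: (cvg_comp _ _ pq cvg_fst).
have /cvgrPdist_lt/(_ _ e2) n2 : (p n).2 @[n --> \oo] --> q.2 by exact: (cvg_comp _ _ pq cvg_snd).
near=> n; apply: le_lt_trans (enorm_le _) _ => /=.
have h1 : `|q.1 - (p n).1| < e / 2 by near: n.
have h2 : `|q.2 - (p n).2| < e / 2 by near: n.
by rewrite (_ : e = e / 2 + e / 2); [exact: ltrD|lra].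
Unshelve. all: by end_near. Qed.
End Limits.

(** * Equality on the axes and locally uniform convergence *)

Section Main.
Context {R : realType}.
Variables (l : R * R -> R) (M : R) (m_l : R -> R) (lambda : R).
Hypotheses (M_gt0 : 0 < M) (m_l_modulus : is_modulus m_l)
  (l_bounded : forall x, `|l x| <= M)
  (l_cont : forall x y, `|l x - l y| <= m_l (enorm (x - y)))
  (lambda_gt0 : 0 < lambda).

Lemma cost_omega_ge (p : R * R) a X : Gamma p -> controls a -> omega p a X ->
  VGamma lambda l p <= cost lambda l X.
Proof.
move=> Gp ca [_ [k _ [e [e0 ec Xc _]]]].
have [b1 [b2 [ub ab]]] := control_repr ca.
(* [traj] is unspecified at negative times, whereas [bounded_meas] asks for measurability on the
   whole line. *)
pose f n t := l (traj (e n) p a (Num.max t 0)).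
have fE n : exists u v, [/\ continuous u, continuous v, (u 0, v 0) = p,
    sol (e n)^-1 b1 b2 u v & f n = fun t => l (u t, v t)].
  have [u [v [huv u0 v0 uE]]] := traj_sol p (ltW (e0 n)) ca ub ab.
  have [pu pv] := huv.
  exists u, v; split => //; [exact: prim_continuous pu|exact: prim_continuous pv| |].
    by rewrite u0 v0 -surjective_pairing.
  apply/funext => t; rewrite /f uE; last by rewrite le_max lexx orbT.
  by case: (leP t 0) => // t0; rewrite (prim_le0 pu t0) (prim_le0 pv t0).
have bf n : bounded_meas M (f n).
  have [u [v [cu cv _ _ ->]]] := fE n.
  exact: (path_bounded_meas m_l_modulus l_bounded l_cont cu cv).
have cf t : 0 < t -> f n t @[n --> \oo] --> l (X t).
  move=> t0; have th : halfline t by rewrite /halfline/= in_itv/= andbT.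
  (* Singletons are compact, so locally uniform convergence gives the pointwise convergence needed
     for dominated convergence. *)
  have h : traj (e n) p a t @[n --> \oo] --> X t.
    apply: (@uniform_cvg_at _ _ [set t] ((fun n => traj (e n) p a) @ \oo) X t) => //.
    by apply: Xc; [exact: compact_set1|move=> s ->].
  apply/cvgrPdist_le => eps eps0.
  have [d d0 hd] := modulus_small m_l_modulus eps0.
  have := cvg_seq_pair h d0; apply: filterS => n hn.
  rewrite /f (max_idPl (ltW t0)); apply: le_trans (l_cont _ _) _.
  by apply: hd => //; exact: enorm_ge0.
have D := discounted_cvg lambda_gt0 bf cf.
have costE' : cost lambda l X = discounted lambda (fun t => l (X t)) by [].
rewrite costE'; apply: le_epsilon => e1 e10; have e2 : 0 < e1 / 2 by lra.
have [eps0 eps00 est] := value_estimate M_gt0 m_l_modulus l_bounded l_cont lambda_gt0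
  (`|p.1| + `|p.2|) e2.
have /cvgrPdist_lt/(_ _ e2) n1 := D.
have /cvgrPdist_lt/(_ _ eps00) n2 := ec.
near \oo => n.
have h1 : `|discounted lambda (fun t => l (X t)) - discounted lambda (f n)| < e1 / 2 by near: n.
have h2 : `|0 - e n| < eps0 by near: n.
rewrite sub0r normrN gtr0_norm// in h2.
have := est (e n) p (e0 n) h2 (lexx _); rewrite (proj_id Gp).
have [u [v [cu cv pE huv fn]]] := fE n.
have := Veps_le m_l_modulus l_bounded l_cont lambda_gt0 (ltW (e0 n)) ub huv.
rewrite pE /path_cost -fn.
move: h1; move: (discounted lambda _) (discounted lambda (f n)) => A B.
move: (Veps _ _ _ _) (VGamma _ _ _) => V W h1 h3 h4.
move: h1 h4; rewrite ltr_norml ler_norml => /andP[h1 h5] /andP[h6 h7].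
by clear - h3 h5 h1 h6 h7; lra.
Unshelve. all: by end_near. Qed.

Lemma Vbar_VGamma (p : R * R) : Gamma p -> Vbar lambda l p = VGamma lambda l p.
Proof.
move=> Gp.
have [ne _] := VGamma_has_inf m_l_modulus l_bounded l_cont lambda_gt0 Gp.
have lb : lbound [set c | exists a X, [/\ controls a, omega p a X & c = cost lambda l X]]
    (VGamma lambda l p).
  by move=> _ [a [X [ca oX ->]]]; exact: cost_omega_ge oX.
have mem a : controls_at p a -> exists a' X,
    [/\ controls a', omega p a' X & cost lambda l (free_traj p a) = cost lambda l X].
  move=> ca; exists a, (free_traj p a); split => //; first by case: ca.
  exact: free_traj_omega.
apply/eqP; rewrite eq_le; apply/andP; split.
  apply: lb_le_inf => // _ [a ca <-].
  apply: ge_inf; first by exists (VGamma lambda l p).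
  exact: mem.
apply: lb_le_inf => //.
by have [_ [a ca _]] := ne; exists (cost lambda l (free_traj p a)); exact: mem.
Qed.

Lemma Veps_cvg : cvg_locally_uniformly [set: R * R]
  (Veps lambda l eps @[eps --> 0^'+]) (Vbar lambda l \o @phi_d R).
Proof.
move=> K cK _; apply: uniform_cvg_norm => e e0.
have [C [_ KC]] := compact_bounded cK.
have e2 : 0 < e / 2 by lra.
(* On [K] the sup norm is bounded by any number exceeding [C], here [C + 1], and [value_estimate]
   bounds the sum of the two coordinates: hence the factor 2. *)
have [eps0 eps00 est] := value_estimate M_gt0 m_l_modulus l_bounded l_cont lambda_gt0
  (2 * (C + 1)) e2.
have C1 : C < C + 1 by rewrite ltrDl.
change (\forall eps \near (0 : R)^'+, forall p : R * R, K p ->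
  `|(Vbar lambda l \o @phi_d R) p - Veps lambda l eps p| < e).
near=> eps => p Kp.
have pn := KC _ C1 p Kp.
have p1 : `|p.1| <= C + 1 by apply: le_trans pn; rewrite /Num.norm /= le_max lexx.
have p2 : `|p.2| <= C + 1 by apply: le_trans pn; rewrite /Num.norm /= le_max lexx orbT.
rewrite /= phi_d_proj Vbar_VGamma; last exact: proj_Gamma.
rewrite distrC; apply: (@le_lt_trans _ _ (e / 2)); last lra.
apply: est; [by near: eps; exact: nbhs_right_gt|by near: eps; exact: nbhs_right_lt|lra].
Unshelve. all: by end_near. Qed.
End Main.

Unset Implicit Arguments.

Theorem theorem2p3 (R : realType) (l : R * R -> R) (M : R) (m_l : R -> R)
    (lambda : R)
    (M_gt0 : 0 < M)
    (m_l_modulus : is_modulus m_l)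
    (l_bounded : forall x, `|l x| <= M)
    (l_cont : forall x y, `|l x - l y| <= m_l (enorm (x - y)))
    (lambda_gt0 : 0 < lambda) :
  (forall x, Gamma x -> Vbar lambda l x = VGamma lambda l x) /\
  cvg_locally_uniformly [set: R * R]
    (Veps lambda l eps @[eps --> 0^'+])
    (Vbar lambda l \o @phi_d R).
Proof.
split; first by move=> x; exact: (Vbar_VGamma M_gt0 m_l_modulus).
exact: (Veps_cvg M_gt0 m_l_modulus).
Qed.
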